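(* Let $V\subset H\subset V'$, $A$ and $F$ be as in the context, and let $\mathcal{K}$ be the set of all mild solutions of $\frac{dy}{dt}+Ay\in F(y)$ on $[0,+\infty)$ with initial data in $H$, with associated strict m-semiflow $G$. Assume that there is a sequence of maps $F_N:H\to\mathcal{P}(H)$, $N\ge1$, with closed, convex, bounded values such that $$F(y)\subset F_N(y)\quad\text{for all } y\in H,\ N\ge 1,$$ $$\mathrm{dist}(F_N(y),F(y))\to 0\ \text{ as } N\to\infty,\quad\text{for all } y\in H,$$ $$\mathrm{dist}_H(F_N(y_1),F_N(y_2))\le c_N\|y_1-y_2\|\quad\text{for all } y_1,y_2\in H,$$ for some constants $c_N>0$. If $\varphi\in\mathcal{K}$ is such that the closure in $H$ of its positive orbit $\bigcup_{t\ge0}\{\varphi(t)\}$ is compact, then $\omega(\varphi)$ is chain recurrent with respect to $G$.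
   Context: $V\subset H\subset V'$ is a Gelfand triple (of real spaces, $H$ a Hilbert space) with compact dense embeddings; $\|\cdot\|$ and $(\cdot,\cdot)$ are the norm and scalar product of $H$, $\langle\cdot,\cdot\rangle$ the pairing between $V$ and $V'$. $A:V\to V'$ is linear, continuous, self-adjoint, with $\lambda_1\|u\|_V^2\le\langle Au,u\rangle\le\lambda_2\|u\|_V^2$ for all $u\in V$, where $0<\lambda_1<\lambda_2$. $\mathcal{P}(H)$ is the set of non-empty subsets of $H$; $\mathrm{dist}(P,Q)=\sup_{a\in P}\inf_{b\in Q}\|a-b\|$, $\mathrm{dist}_H(P,Q)=\max\{\mathrm{dist}(P,Q),\mathrm{dist}(Q,P)\}$. $F:H\to\mathcal{P}(H)$ has closed, convex, bounded values; is w-upper semicontinuous, i.e. for every $y_0\in H$ and $\varepsilon>0$ there is $\delta>0$ such that $\|y-y_0\|<\delta$ implies $F(y)\subset\{z\in H:\mathrm{dist}(z,F(y_0))<\varepsilon\}$; and satisfies $\sup_{a\in F(y)}\|a\|\le C_1+C_2\|y\|$ for all $y\in H$, for some constants $C_1,C_2>0$. A mild solution of $\frac{dy}{dt}+Ay\in F(y)$, $y(0)=y_0\in H$, is a function $y=y(t)$, $t\ge0$, such that for every $T>0$: $y\in L^2(0,T;V)$, $\frac{dy}{dt}\in L^2(0,T;V')$, and there is $f\in L^2(0,T;H)$ with $\frac{dy}{dt}+Ay=f(t)$, $f(t)\in F(y(t))$ for a.a. $t\in(0,T)$, and $y(0)=y_0$. $\mathcal{K}\subset C([0,+\infty);H)$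 is the collection of all mild solutions, and $G(t,x)=\{\varphi(t):\varphi\in\mathcal{K},\varphi(0)=x\}$; it is known that $G$ is a strict m-semiflow: $G(0,x)=\{x\}$, $G(t+s,x)=G(t,G(s,x))$. A map $\phi:\mathbb{R}\to H$ is a complete trajectory of $\mathcal{K}$ if $\phi(\cdot+h)|_{[0,\infty)}\in\mathcal{K}$ for all $h\in\mathbb{R}$. A set $B\subset H$ is quasi-invariant if for each $x\in B$ there is a complete trajectory $\phi$ of $\mathcal{K}$ with $\phi(0)=x$ and $\phi(\mathbb{R})\subset B$. $\omega(\varphi)=\{y\in H:\exists\,t_n\to+\infty\text{ with }\varphi(t_n)\to y\}$; it is quasi-invariant when the positive orbit has compact closure. Chain recurrence: for a quasi-invariant $B\subset H$, $y,z\in B$, $\varepsilon>0$, $t>0$, an $(\varepsilon,t)$-chain from $y$ to $z$ consists of finite sequences $\{y=y_1,\dots,y_{n+1}=z\}\subset B$, $\{t_1,\dots,t_n\}\subset[t,+\infty)$ with $\mathrm{dist}(y_{i+1},G(t_i,y_i))<\varepsilon$ for $i=1,\dots,n$. $B$ is chain recurrent with respect to $G$ if for every $y\in B$, $\varepsilon>0$, $t>0$ there is an $(\varepsilon,t)$-chain from $y$ to $y$. *)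

(* Defs.v *)
From HB Require Import structures.
From mathcomp Require Import all_boot all_order all_algebra.
From mathcomp Require Import sesquilinear.
From mathcomp Require Import all_classical all_reals all_analysis.

Set Implicit Arguments.
Unset Strict Implicit.
Unset Printing Implicit Defensive.

Import Order.TTheory GRing.Theory Num.Theory.
Import numFieldNormedType.Exports.

Local Open Scope classical_set_scope.
Local Open Scope ring_scope.

(* The completeness of [H] is carried by its type, so that this says that [ip]
   makes [H] a real Hilbert space. *)
Definition is_hilbert (R : realType) (H : completeNormedModType R)
    (ip : {dot H for idfun}) : Prop :=
  forall x : H, `|x| ^+ 2 = ip x x.

(* [W], paired with [V] by [pr], is the topological dual of [V]: every
   continuous linear form is represented, and the norm is the dual norm (the
   supremum being extended real, it is never a default value). *)
Definition is_dual (R : realType) (V W : completeNormedModType R)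
    (pr : {bilinear W -> V -> R | *%R & *%R}) : Prop :=
  (forall l : W, (`|l|%:E =
     ereal_sup [set `|pr l v|%:E | v in [set v : V | (`|v| <= 1)%R]])%E) /\
  (forall f : {scalar V}, continuous (f : V -> R) ->
     exists l : W, forall v : V, pr l v = f v).

Definition compact_dense_embedding (R : realType)
    (U W : completeNormedModType R) (i : {linear U -> W}) : Prop :=
  [/\ injective i, continuous i, dense (range i) &
      forall B : set U, bounded_set B -> compact (closure (i @` B))].

(* The inclusions V < H < V' are the injections [iV] and [iH]; [H] is identified
   with its own dual, i.e. <h, v> = (h, v) for h in H and v in V. *)
Definition gelfand_triple (R : realType) (V H V' : completeNormedModType R)
    (ip : {dot H for idfun}) (pr : {bilinear V' -> V -> R | *%R & *%R})
    (iV : {linear V -> H}) (iH : {linear H -> V'}) : Prop :=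
  [/\ is_hilbert ip, is_dual pr,
      compact_dense_embedding iV, compact_dense_embedding iH &
      forall (h : H) (v : V), pr (iH h) v = ip h (iV v)].

(* The distances are extended real: the infimum over the empty set is +oo. *)
Definition point_dist (R : realType) (H : normedModType R)
    (a : H) (Q : set H) : \bar R :=
  ereal_inf [set `|a - b|%:E | b in Q].

Definition semi_dist (R : realType) (H : normedModType R)
    (P Q : set H) : \bar R :=
  ereal_sup [set point_dist a Q | a in P].

Definition hausdorff_dist (R : realType) (H : normedModType R)
    (P Q : set H) : \bar R :=
  maxe (semi_dist P Q) (semi_dist Q P).

Definition closed_convex_bounded_values (R : realType) (H : normedModType R)
    (F : H -> set H) : Prop :=
  forall y : H, [/\ F y !=set0, closed (F y),
    convex_set (F y : set (convex_lmodType H)) & bounded_set (F y)].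

Definition w_usc (R : realType) (H : normedModType R) (F : H -> set H) : Prop :=
  forall (y0 : H) (e : R), 0 < e -> exists2 d : R, 0 < d &
    forall y : H, `|y - y0| < d ->
      F y `<=` [set z | (point_dist z (F y0) < e%:E)%E].

Definition simple_fun (R : realType) (W : normedModType R) (s : R -> W) : Prop :=
  finite_set (range s) /\ forall w : W, measurable (s @^-1` [set w]).

Definition strongly_measurable (R : realType) (W : normedModType R)
    (D : set R) (f : R -> W) : Prop :=
  exists2 s : nat -> R -> W, (forall n, simple_fun (s n)) &
    {ae lebesgue_measure, forall t, D t -> s n t @[n --> \oo] --> f t}.

Definition L2 (R : realType) (W : normedModType R) (T : R) (f : R -> W) : Prop :=
  strongly_measurable `]0, T[ f /\
  (\int[lebesgue_measure]_(t in `]0%R, T[) (`|f t| ^+ 2)%:E < +oo)%E.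

(* C^oo functions with compact support in ]0, T[. *)
Definition test_function (R : realType) (T : R) (phi : R -> R) : Prop :=
  (forall (n : nat) (t : R), derivable (derive1n n phi) t 1) /\
  exists a b : R, [/\ 0 < a, b < T & forall t, t \notin `[a, b] -> phi t = 0].

(* [g] is the derivative of [u] as a V'-valued distribution on ]0, T[: the
   integrals of phi' u and - phi g coincide in V'.  An element of V' is
   determined by its pairings with V, and pairing commutes with the
   integral. *)
Definition weak_derivative (R : realType) (V V' : completeNormedModType R)
    (pr : {bilinear V' -> V -> R | *%R & *%R}) (T : R) (u g : R -> V') : Prop :=
  forall phi : R -> R, test_function T phi -> forall v : V,
    \int[lebesgue_measure]_(t in `]0, T[) (derive1 phi t * pr (u t) v) =
    - \int[lebesgue_measure]_(t in `]0, T[) (phi t * pr (g t) v).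

(* A function on [0, +oo[ is represented by a function on R of which only the
   restriction to [0, +oo[ is used.  Solutions are taken to be their
   continuous representative with values in H. *)
Definition mild_solution (R : realType) (V H V' : completeNormedModType R)
    (pr : {bilinear V' -> V -> R | *%R & *%R})
    (iV : {linear V -> H}) (iH : {linear H -> V'})
    (A : {linear V -> V'}) (F : H -> set H) (y0 : H) (y : R -> H) : Prop :=
  [/\ {within `[0, +oo[, continuous y},
      y 0 = y0 &
      forall T : R, 0 < T ->
        exists (v : R -> V) (g : R -> V') (f : R -> H),
        [/\ L2 T v /\
            {ae lebesgue_measure, forall t, t \in `]0, T[ -> y t = iV (v t)},
            L2 T g /\ weak_derivative pr T (iH \o y) g,
            L2 T f,
            {ae lebesgue_measure, forall t,
               t \in `]0, T[ -> g t + A (v t) = iH (f t)} &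
            {ae lebesgue_measure, forall t, t \in `]0, T[ -> F (y t) (f t)}]].

Definition mild_solutions (R : realType) (V H V' : completeNormedModType R)
    (pr : {bilinear V' -> V -> R | *%R & *%R})
    (iV : {linear V -> H}) (iH : {linear H -> V'})
    (A : {linear V -> V'}) (F : H -> set H) : set (R -> H) :=
  [set y | exists y0 : H, mild_solution pr iV iH A F y0 y].

Definition msemiflow (R : realType) (H : normedModType R) (K : set (R -> H))
    (t : R) (x : H) : set H :=
  [set phi t | phi in [set phi | K phi /\ phi 0 = x]].

(* Meaningful for [K] that only depends on the restrictions to [0, +oo[. *)
Definition complete_trajectory (R : realType) (H : normedModType R)
    (K : set (R -> H)) (phi : R -> H) : Prop :=
  forall h : R, K (fun t => phi (t + h)).

Definition quasi_invariant (R : realType) (H : normedModType R)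
    (K : set (R -> H)) (B : set H) : Prop :=
  forall x : H, B x -> exists phi : R -> H,
    [/\ complete_trajectory K phi, phi 0 = x & range phi `<=` B].

Definition omega_limit (R : realType) (H : normedModType R)
    (phi : R -> H) : set H :=
  [set y | exists2 s : nat -> R, s n @[n --> \oo] --> +oo &
           phi (s n) @[n --> \oo] --> y].

(* Indices are shifted by one: the chain is y_0, ..., y_n, with n >= 1. *)
Definition chain (R : realType) (H : normedModType R) (G : R -> H -> set H)
    (B : set H) (e t : R) (y z : H) : Prop :=
  exists (n : nat) (ys : nat -> H) (ts : nat -> R),
    [/\ (0 < n)%N, ys 0%N = y, ys n = z,
        forall i, (i <= n)%N -> B (ys i) &
        forall i, (i < n)%N -> t <= ts i /\
          (point_dist (ys i.+1) (G (ts i) (ys i)) < e%:E)%E].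

(* Chain recurrence is only defined for quasi-invariant sets. *)
Definition chain_recurrent (R : realType) (H : normedModType R)
    (K : set (R -> H)) (B : set H) : Prop :=
  quasi_invariant K B /\
  forall (y : H) (e t : R), B y -> 0 < e -> 0 < t ->
    chain (msemiflow K) B e t y y.

(* Main.v *)
(* Let K be the closure of the orbit. As phi' + A phi = f with f
   bounded, the derivative A^-1 f - phi of A^-1 phi is bounded; A^-1 is injective
   on the compact set K, so phi itself is uniformly continuous and its translates
   are relatively compact for locally uniform convergence.

   A limit of translates is again a mild solution. The quadratic forms
   ((1 - (1 - kappa A^-1)^n) y, y) increase to |y|^2, and differentiating them
   bounds the translates in L^2(0, T; V). Almost minimizers of the energy over
   the convex hulls of the tails then converge strongly in L^2, and the inclusion
   passes to the limit because F is upper semicontinuous with closed convex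
   values. In particular omega(phi) is quasi-invariant.

   By the same compactness, every x in omega(phi) has a radius d(x) such that,
   whenever |phi(s) - x| < d(x), some solution issued from x is close to phi(s + .)
   on [t, 2t]. Between two late visits of phi to a neighbourhood of x, sample phi
   at times with equal steps in [t, 2t] and replace each sample by a point of
   omega(phi) within its own radius: this is a chain from x to x. *)

Require Import Defs.
From HB Require Import structures.
From mathcomp Require Import all_boot all_order all_algebra.
From mathcomp Require Import sesquilinear.
From mathcomp Require Import all_classical all_reals all_analysis.
From mathcomp Require Import measurable_realfun.
From mathcomp Require Import ring lra.

Set Implicit Arguments.
Unset Strict Implicit.
Unset Printing Implicit Defensive.

Import Order.TTheory GRing.Theory Num.Theory.
Import numFieldNormedType.Exports.

Local Open Scope classical_set_scope.
Local Open Scope ring_scope.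

(** * Symmetric positive forms *)

(** The obstacle is the energy estimate: the equation is known only as a distribution tested with
    one fixed vector of [V] at a time, which does not directly give the derivative of |y|^2. Testing
    with A^-1 k instead, for k in [H], turns a(v, A^-1 k) into (y, k), so that A^-1 y satisfies an
    integral equation with bounded terms. Put Q = 1 - kappa A^-1 and S_n = 1 + Q + ... + Q^(n-1),
    with kappa so small that 0 <= Q <= 1. Then 1 - Q^n = kappa A^-1 S_n, and ((1 - Q^n) y, y) can be
    differentiated from the increments of A^-1 y alone. Its derivative contains -2 kappa (S_n y, y),
    and kappa (S_n y, y) tends to a(v, v) where y = [iV v], so Fatou's lemma yields the bound in V;
    this stands in for a spectral decomposition of A. The other difficulty is that f is merely
    bounded. Averaging v and f jointly preserves the equation, which is linear, while pointwise
    convergence of the translates keeps the averages of f near the convex set F of the limit. *)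

Section PositiveForm.
Variables (R : realType) (E : lmodType R) (b : E -> E -> R).
Hypothesis bC : forall u v, b u v = b v u.
Hypothesis bP : forall c u v w, b (c *: u + v) w = c * b u w + b v w.
Hypothesis b_ge0 : forall u, 0 <= b u u.

Lemma form0l w : b 0 w = 0.
Proof. by have := bP 1 0 0 w; rewrite scaler0 addr0; lra. Qed.

Lemma formDl u v w : b (u + v) w = b u w + b v w.
Proof. by rewrite -[u]scale1r bP mul1r scale1r. Qed.

Lemma formZl c u w : b (c *: u) w = c * b u w.
Proof. by rewrite -[c *: u]addr0 bP form0l addr0. Qed.

Lemma formNl u w : b (- u) w = - b u w.
Proof. by rewrite -scaleN1r formZl mulN1r. Qed.

Lemma formBl u v w : b (u - v) w = b u w - b v w.
Proof. by rewrite formDl formNl. Qed.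

Lemma formDr u v w : b u (v + w) = b u v + b u w.
Proof. by rewrite bC formDl !(bC _ u). Qed.

Lemma formZr c u w : b u (c *: w) = c * b u w.
Proof. by rewrite bC formZl (bC w). Qed.

Lemma formNr u w : b u (- w) = - b u w.
Proof. by rewrite bC formNl (bC w). Qed.

Definition formE := (formDl, formDr, formNl, formNr, formZl, formZr).

Lemma form_parallelogram u v :
  b (u - v) (u - v) =
  2 * b u u + 2 * b v v - 4 * b (2^-1 *: (u + v)) (2^-1 *: (u + v)).
Proof. by rewrite !formE (bC v u); field. Qed.

(** The form may be degenerate, so [b v v = 0] is treated apart from the usual minimization over the
    line u + s v. *)
Lemma form_cauchy_schwarz u v : b u v ^+ 2 <= b u u * b v v.
Proof.
have h s : 0 <= b u u + 2 * s * b u v + s ^+ 2 * b v v.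
  have := b_ge0 (u + s *: v); rewrite !formE (bC v u); lra.
have [vv0|vv0] := eqVneq (b v v) 0.
  rewrite vv0 mulr0 in h *.
  have [->|uv0] := eqVneq (b u v) 0; first by rewrite expr0n.
  (* With [b v v = 0] the polynomial is affine in s; this s gives it the value -1. *)
  have := h (- (b u u + 1) / (2 * b u v)); rewrite mulr0 addr0.
  have -> : 2 * (- (b u u + 1) / (2 * b u v)) * b u v = - (b u u + 1) by field.
  by lra.
have vv : 0 < b v v by rewrite lt_def vv0 b_ge0.
have := h (- b u v / b v v).
have -> : b u u + 2 * (- b u v / b v v) * b u v + (- b u v / b v v) ^+ 2 * b v v =
  (b u u * b v v - b u v ^+ 2) / b v v by field.
by rewrite pmulr_lge0 ?invr_gt0// subr_ge0.
Qed.

(** * Powers of a symmetric positive contraction *)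

Section Contraction.
Variable N : E -> E.
Hypothesis NP : forall c u v, N (c *: u + v) = c *: N u + N v.
Hypothesis Nsym : forall u v, b (N u) v = b u (N v).
Hypothesis N_bnd : forall u, 0 <= b (N u) u <= b u u.

Lemma contraction_sub u v : N (u - v) = N u - N v.
Proof. by rewrite -[u - v]addrC -scaleN1r NP scaleN1r addrC. Qed.

Lemma iter_contraction_sym n u v : b (iter n N u) v = b u (iter n N v).
Proof.
elim: n u v => [//|n IH] u v.
by rewrite iterSr IH /= Nsym.
Qed.

Lemma iter_contraction_split n m u :
  b (iter (n + m) N u) u = b (iter n N u) (iter m N u).
Proof. by rewrite addnC iterD iter_contraction_sym. Qed.

(** By symmetry half of the powers move to the other argument; an odd exponent leaves one factor [N]
    between two equal vectors. *)
Lemma iter_contraction_ge0 n u : 0 <= b (iter n N u) u.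
Proof.
rewrite -(odd_double_half n) -addnn addnA iter_contraction_split.
case: (odd n); last by rewrite add0n.
by rewrite add1n /=; have /andP[] := N_bnd (iter n./2 N u).
Qed.

Lemma contraction_sq u : b (N u) (N u) <= b (N u) u.
Proof.
(* [N - N^2 = N (1 - N) N + (1 - N) N (1 - N)] *)
have /andP[_ h1] := N_bnd (N u).
have /andP[h2 _] := N_bnd (u - N u).
move: h2; rewrite contraction_sub !formE.
rewrite (Nsym (N u) u).
have := Nsym (N u) (N u); lra.
Qed.

(** After half of the powers are moved across, an even n reduces to N <= 1 and an odd n to N^2 <= N,
    each evaluated at an iterate of u. *)
Lemma iter_contraction_le n u : b (iter n.+1 N u) u <= b (iter n N u) u.
Proof.
rewrite -(odd_double_half n) -addnn addnA iter_contraction_split.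
rewrite -addSn iter_contraction_split.
case: (odd n) => /=; last first.
  by rewrite add0n /=; have /andP[] := N_bnd (iter n./2 N u).
by rewrite (Nsym (N _)); exact: contraction_sq.
Qed.

Lemma iter_contraction_decr n m u : (n <= m)%N ->
  b (iter m N u) u <= b (iter n N u) u.
Proof.
move=> /subnK <-; elim: (m - n)%N => [//|k IH].
by rewrite addSn; apply: le_trans IH; exact: iter_contraction_le.
Qed.

Lemma iter_contraction_sq n u : b (iter n N u) (iter n N u) <= b u u.
Proof.
by rewrite -iter_contraction_split; exact: (@iter_contraction_decr 0).
Qed.

End Contraction.
End PositiveForm.

(* Applied to the norm of an [L^2] space and to the convex hulls of the tails
   of a bounded sequence, this replaces weak compactness and Mazur's lemma. *)
Lemma asymptotic_minimizer (R : realType) (E : lmodType R) (C : nat -> set E)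
    (q : E -> R) (M : R) (e : nat -> R) :
  (forall n, 0 < e n) ->
  (forall n, C n.+1 `<=` C n) ->
  (forall n x y, C n x -> C n y -> C n (2^-1 *: (x + y))) ->
  (forall n, exists2 x, C n x & q x <= M) ->
  (forall x, C 0%N x -> 0 <= q x) ->
  (forall x y, C 0%N x -> C 0%N y ->
     q (x - y) = 2 * q x + 2 * q y - 4 * q (2^-1 *: (x + y))) ->
  exists x : nat -> E,
    [/\ forall n, C n (x n),
        forall n m, (n <= m)%N -> q (x n - x m) <= e n &
        forall n z, (forall m, C m z) -> q (x n) <= q z + e n].
Proof.
move=> e0 Cdecr Cmid CM q0 qpar.
have Cle n m : (n <= m)%N -> C m `<=` C n.
  move=> /subnK <-; elim: (m - n)%N => [|k IH]//.
  by rewrite addSn; apply: subset_trans IH; exact: Cdecr.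
pose d n := inf (q @` C n).
have hinf n : has_inf (q @` C n).
  split; first by have [x Cx _] := CM n; exists (q x), x.
  by exists 0 => _ [x Cx <-]; apply: q0; exact: Cle Cx.
have dlb n x : C n x -> d n <= q x.
  by move=> Cx; apply: ge_inf; [exact: (hinf n).2|exists x].
have dM n : d n <= M.
  by have [x Cx] := CM n; apply: le_trans; exact: dlb.
have hsup : has_sup (range d).
  by split; [exists (d 0%N), 0%N|exists M => _ [n _ <-]].
pose D := sup (range d).
have dD n : d n <= D by apply: ub_le_sup; [exact: hsup.2|exists n].
have dmono n m : (n <= m)%N -> d n <= d m.
  move=> nm; apply: lb_le_inf; first exact: (hinf m).1.
  by move=> _ [x Cx <-]; apply: dlb; exact: Cle Cx.
have near_D r : 0 < r -> exists N, D - r < d N.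
  move=> r0; have [_ [N _ <-] h] := sup_adherent r0 hsup.
  by exists N.
(* For n <= m the parallelogram identity below loses at most 6 [r n] + 2 [r m], so nonincreasing
   tolerances below [e n / 8] suffice. *)
pose r := fix r n := if n is k.+1 then Num.min (r k) (e k.+1 / 8) else e 0%N / 8.
have r0 n : 0 < r n.
  elim: n => [|n IH] /=; first by rewrite divr_gt0.
  by rewrite lt_min IH divr_gt0.
have rdecr n m : (n <= m)%N -> r m <= r n.
  move=> /subnK <-; elim: (m - n)%N => [//|k IH].
  by rewrite addSn /= ge_min IH.
have re n : r n <= e n / 8.
  by case: n => [//|n] /=; rewrite ge_min lexx orbT.
have [K0 hK0] := choice (fun n => near_D _ (r0 n)).
(* Adding n and all the earlier thresholds makes [K] nondecreasing and larger than both n and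
   [K0 n]. *)
pose K n := (n + \sum_(i < n.+1) K0 i)%N.
have KK n m : (n <= m)%N -> (K n <= K m)%N.
  move=> nm; rewrite /K leq_add//.
  by rewrite -(subnK nm) addnC -addSn big_split_ord /= leq_addr.
have K0K n : (K0 n <= K n)%N.
  by rewrite /K big_ord_recr /= addnA leq_addl.
have near_inf n : exists x, C (K n) x /\ q x < D + r n.
  have [_ [x Cx <-] h] := inf_adherent (r0 n) (hinf (K n)).
  exists x; split => //; apply: lt_le_trans h _.
  by rewrite lerD2r; exact: dD.
have [x hx] := choice near_inf.
exists x; split.
- by move=> n; apply: Cle (hx n).1; rewrite /K leq_addr.
- move=> n m nm.
  have [Cn qn] := hx n; have [Cm qm] := hx m.
  have Cm' : C (K n) (x m) by apply: Cle Cm; exact: KK.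
  rewrite qpar; [|exact: Cle Cn|exact: Cle Cm'].
  have := dlb _ _ (Cmid _ _ _ Cn Cm').
  have := dmono _ _ (K0K n); have := hK0 n; have := rdecr _ _ nm; have := re n.
  by lra.
- move=> n z Cz.
  have [_ qn] := hx n; have := re n; have := e0 n.
  have : D <= q z.
    apply: ge_sup; first exact: hsup.1.
    by move=> _ [k _ <-]; exact: dlb.
  by lra.
Qed.

(** * The Gelfand triple and the resolvent *)

Lemma cvg_seqP (R : realType) (W : normedModType R) (u : nat -> W) (l : W) :
  (u n @[n --> \oo] --> l) <->
  (forall e, 0 < e -> exists N, forall n, (N <= n)%N -> `|u n - l| < e).
Proof.
split=> [ul e e0|h].
  have /cvgrPdist_lt/(_ e e0)[N _ hN] := ul.
  by exists N => n Nn; rewrite distrC; exact: hN.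
apply/cvgrPdist_lt => e e0; have [N hN] := h e e0.
by exists N => // n /= Nn; rewrite distrC; exact: hN.
Qed.

Lemma ler_cvg_seq (R : realType) (u v : nat -> R) (l l' : R) :
  u n @[n --> \oo] --> l -> v n @[n --> \oo] --> l' ->
  (forall n, u n <= v n) -> l <= l'.
Proof.
by move=> ul vl uv; apply: (ler_cvg_to ul vl); exact: nearW.
Qed.

Lemma seq_complete (R : realType) (W : completeNormedModType R) (u : nat -> W) :
  (forall e, 0 < e -> exists N, forall n m, (N <= n <= m)%N ->
     `|u n - u m| < e) ->
  exists l : W, u n @[n --> \oo] --> l.
Proof.
move=> h; exists (limn u); change (cvgn u).
apply/cauchy_cvgP/cauchy_ballP => e e0; near_simpl.
have [|N hN] := h (e / 2); first by rewrite divr_gt0.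
have hN' n : (N <= n)%N -> `|u N - u n| < e / 2.
  by move=> Nn; apply: hN; rewrite leqnn.
exists ([set n | (N <= n)%N], [set n | (N <= n)%N]); first by split; exists N.
move=> [n m] [/= /hN' n1 /hN' m1]; rewrite -ball_normE /=.
have -> : u n - u m = - (u N - u n) + (u N - u m) by rewrite opprB addrA subrK.
by rewrite (le_lt_trans (ler_normD _ _))// normrN [ltRHS](splitr e) ltrD.
Unshelve. all: by end_near. Qed.

Lemma linear_norm_bound (R : realType) (U W : normedModType R)
    (f : {linear U -> W}) :
  continuous f -> exists2 C : R, 0 < C & forall x, `|f x| <= C * `|x|.
Proof.
move=> cf; have /linear_boundedP/pinfty_ex_gt0[C C0 h] :
  bounded_near f (nbhs 0) by apply/linear_bounded_continuous.
by exists C.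
Qed.

Section Hilbert.
Variables (R : realType) (H : completeNormedModType R) (ip : {dot H for idfun}).
Hypothesis hH : is_hilbert ip.

Lemma ipC u v : ip u v = ip v u.
Proof. by rewrite (hermC ip) expr0 mul1r. Qed.

Lemma ipP c u v w : ip (c *: u + v) w = c * ip u w + ip v w.
Proof. by rewrite linearPl. Qed.

Lemma ip_ge0 u : 0 <= ip u u.
Proof. by rewrite -hH exprn_ge0. Qed.

Lemma ip_le u v : `|ip u v| <= `|u| * `|v|.
Proof.
rewrite -ler_sqr ?nnegrE ?mulr_ge0// exprMn !hH real_normK ?num_real//.
exact: (form_cauchy_schwarz ipC ipP ip_ge0).
Qed.

Lemma ip_ler u v : ip u v <= `|u| * `|v|.
Proof. exact: le_trans (ler_norm _) (ip_le u v). Qed.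

Lemma ip_bound x C : 0 <= C -> (forall k, ip x k <= C * `|k|) -> `|x| <= C.
Proof.
move=> C0 h; have := h x; rewrite -hH expr2.
have [->|x0] := eqVneq x 0; first by rewrite normr0.
by rewrite ler_pM2r// normr_gt0.
Qed.

End Hilbert.

Section Gelfand.
Variables (R : realType) (V H V' : completeNormedModType R).
Variables (ip : {dot H for idfun}) (pr : {bilinear V' -> V -> R | *%R & *%R}).
Variables (iV : {linear V -> H}) (iH : {linear H -> V'}).
Hypothesis hG : gelfand_triple ip pr iV iH.
Variables (A : {linear V -> V'}) (lambda1 lambda2 : R).
Hypothesis hA_sym : forall u v : V, pr (A u) v = pr (A v) u.
Hypothesis hlambda1 : 0 < lambda1.
Hypothesis hA_bounds : forall u : V,
       lambda1 * `|u| ^+ 2 <= pr (A u) u <= lambda2 * `|u| ^+ 2.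

Let hH : is_hilbert ip. Proof. by case: hG. Qed.

Lemma pairing_le (l : V') (v : V) : `|pr l v| <= `|l| * `|v|.
Proof.
have [_ [hd _] _ _ _] := hG.
have [->|v0] := eqVneq v 0; first by rewrite linear0r normr0 normr0 mulr0.
have nv : 0 < `|v| by rewrite normr_gt0.
rewrite -ler_pdivrMr// -lee_fin hd.
apply: ereal_sup_ubound; exists (`|v|^-1 *: v) => /=.
  by rewrite normrZ gtr0_norm ?invr_gt0// mulVf ?gt_eqF.
by rewrite linearZr /= normrM gtr0_norm ?invr_gt0// mulrC.
Qed.

Lemma pairing_eq0 (l : V') : (forall v, pr l v = 0) -> l = 0.
Proof.
have [_ [hd _] _ _ _] := hG; move=> h.
apply/eqP; rewrite -normr_le0 -lee_fin hd; apply: ge_ereal_sup.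
by move=> _ [v _ <-]; rewrite h normr0.
Qed.

Lemma pairing_iH (h : H) (v : V) : pr (iH h) v = ip h (iV v).
Proof. by case: hG. Qed.

Definition energy_form (u v : V) : R := pr (A u) v.
Local Notation a := energy_form.

Lemma energyC u v : a u v = a v u.
Proof. exact: hA_sym. Qed.

Lemma energyP c u v w : a (c *: u + v) w = c * a u w + a v w.
Proof. by rewrite /a linearP linearPl. Qed.

Lemma energy_lb u : lambda1 * `|u| ^+ 2 <= a u u.
Proof. by case/andP: (hA_bounds u). Qed.

Lemma energy_ub u : a u u <= lambda2 * `|u| ^+ 2.
Proof. by case/andP: (hA_bounds u). Qed.

Lemma energy_ge0 u : 0 <= a u u.
Proof. by apply: le_trans (energy_lb u); rewrite mulr_ge0 ?exprn_ge0// ltW. Qed.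

Lemma energy_eq0 u : a u u = 0 -> u = 0.
Proof.
move=> u0; have := energy_lb u; rewrite u0 pmulr_rle0//.
move=> h; apply/eqP.
by rewrite -normr_eq0 -sqrf_eq0 eq_le h exprn_ge0.
Qed.

Lemma energy_inj u : A u = 0 -> u = 0.
Proof. by move=> Au; apply: energy_eq0; rewrite /a Au linear0l. Qed.

Lemma energy_cvg_cauchy (x : nat -> V) :
  (forall n m, (n <= m)%N -> a (x n - x m) (x n - x m) <= (2 ^+ n)^-1) ->
  exists l : V, x n @[n --> \oo] --> l.
Proof.
move=> h; apply: seq_complete => e e0.
have : (GRing.exp (2^-1 : R)) @ \oo --> (0 : R).
  by apply: cvg_expr; rewrite gtr0_norm ?invr_gt0// invf_lt1// ltr1n.
have l0 : 0 < lambda1 * e ^+ 2 by rewrite mulr_gt0// exprn_gt0.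
move=> /(cvg_seqP (fun n => (2^-1 : R) ^+ n) (0 : R))/(_ _ l0)[N hN].
exists N => n m /andP[Nn nm].
rewrite -ltr_sqr ?nnegrE ?(ltW e0)// -(ltr_pM2l hlambda1).
apply: le_lt_trans (energy_lb _) _; apply: le_lt_trans (h n m nm) _.
have := hN n Nn; rewrite subr0 normrX gtr0_norm ?invr_gt0//.
by rewrite exprVn.
Qed.

Lemma pairing_cvg (l : V') (x : nat -> V) (u : V) :
  x n @[n --> \oo] --> u -> pr l (x n) @[n --> \oo] --> pr l u.
Proof.
move=> xu; apply/(cvg_seqP (fun n => pr l (x n)) (pr l u)) => e e0.
have l1 : 0 < `|l| + 1 by rewrite ltr_wpDl.
have /cvg_seqP/(_ (e / (`|l| + 1)))[|N hN] := xu; first by rewrite divr_gt0.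
exists N => n /hN h; rewrite -linearBr; apply: le_lt_trans (pairing_le _ _) _.
apply: le_lt_trans (_ : (`|l| + 1) * `|x n - u| < e).
  by rewrite ler_wpM2r// lerDl.
by rewrite mulrC -ltr_pdivlMr.
Qed.

(** The Riesz theorem by direct minimization: a minimizer u of the energy on the hyperplane
    [pr l u = 1] is orthogonal for the energy to the kernel of l, hence [A u] is a nonzero multiple
    of l. *)
Lemma energy_surj (l : V') : exists u, A u = l.
Proof.
have [[w0 lw0]|] := pselect (exists w, pr l w != 0); last first.
  move=> nl; exists 0; rewrite linear0; apply/esym/pairing_eq0 => v.
  by apply/eqP/negPn/negP => lv; apply: nl; exists v.
pose C (n : nat) : set V := [set u | pr l u = 1].
have [||||||x [xC xcauchy xmin]] := @asymptotic_minimizer R V C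
    (fun u => a u u) (a ((pr l w0)^-1 *: w0) ((pr l w0)^-1 *: w0))
    (fun n => (2 ^+ n)^-1).
- by move=> n; rewrite invr_gt0 exprn_gt0.
- by move=> n u; apply.
- move=> n u v; rewrite /C /= => hu hv.
  by rewrite linearZr linearDr hu hv /= -[1 + 1]/2 mulVf.
- move=> n; exists ((pr l w0)^-1 *: w0) => //.
  by rewrite /C /= linearZr /= mulVf.
- by move=> u _; exact: energy_ge0.
- by move=> u v _ _; exact: (form_parallelogram energyC energyP).
have [u xu] := energy_cvg_cauchy xcauchy.
have lu : pr l u = 1.
  have xl : (fun n => pr l (x n)) = cst (1 : R) by apply/funext => n; exact: xC.
  have := pairing_cvg (l := l) xu; rewrite xl => h.
  exact: (cvg_unique (@Rhausdorff R) h (cvg_cst (1 : R))).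
(* Moving along w stays in the hyperplane, so near-minimality of [x n] passes to the limit as the
   first variation inequality [h]. *)
have orth w : pr l w = 0 -> a u w = 0.
  move=> lw.
  have h s : 0 <= 2 * s * a u w + s ^+ 2 * a w w.
    have h1 n : - (2^-1) ^+ n <= 2 * s * a w (x n) + s ^+ 2 * a w w.
      have Cz m : C m (x n + s *: w).
        by rewrite /C /= linearDr linearZr /= lw mulr0 addr0; exact: xC.
      have := xmin n _ Cz.
      rewrite exprVn !(formE energyC energyP) (energyC (x n) w); lra.
    apply: (ler_cvg_seq (u := fun n => - (2^-1) ^+ n)
        (v := fun n => 2 * s * a w (x n) + s ^+ 2 * a w w)) => //.
      rewrite -oppr0; apply: cvgN; apply: cvg_expr.
      by rewrite gtr0_norm ?invr_gt0// invf_lt1// ltr1n.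
    rewrite (energyC u); apply: cvgD; last exact: cvg_cst.
    by apply: cvgMl_tmp; exact: (pairing_cvg (l := A w) xu).
  apply/eqP/negPn/negP => uw0.
  (* This s makes the variation a nonpositive multiple of [(a u w) ^+ 2]; the added 1 keeps the
     denominator nonzero when w = 0. *)
  have := h (- a u w / (a w w + 1)).
  have ww := energy_ge0 w.
  have w1 : 0 < a w w + 1 by rewrite ltr_wpDl.
  have -> : 2 * (- a u w / (a w w + 1)) * a u w +
     (- a u w / (a w w + 1)) ^+ 2 * a w w =
     - (a u w / (a w w + 1)) ^+ 2 * (a w w + 2) by field; rewrite gt_eqF.
  rewrite mulNr oppr_ge0 pmulr_lle0 ?ltr_wpDl//.
  by rewrite le_eqVlt ltNge sqr_ge0 orbF sqrf_eq0 mulf_eq0 invr_eq0 (negbTE uw0) gt_eqF.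
have uu0 : a u u != 0.
  by apply/eqP => /energy_eq0 u0; move: lu; rewrite u0 linear0r => /esym/eqP; rewrite oner_eq0.
exists ((a u u)^-1 *: u); apply/eqP; rewrite -subr_eq0; apply/eqP.
apply: pairing_eq0 => v; rewrite linearBl linearZ linearZl_LR /= -/(a u v).
have := orth (v - pr l v *: u).
rewrite !(formE energyC energyP) linearBr linearZr /= lu mulr1 subrr => /(_ erefl).
move=> /eqP; rewrite subr_eq0 => /eqP ->.
by rewrite mulrC mulfK// subrr.
Qed.

Lemma energy_ge_embedding :
  exists2 kappa : R, 0 < kappa & forall u, kappa * `|iV u| ^+ 2 <= a u u.
Proof.
have [_ _ [_ ciV _ _] _ _] := hG.
have [C C0 hC] := linear_norm_bound ciV.
exists (lambda1 / C ^+ 2); first by rewrite divr_gt0// exprn_gt0.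
move=> u; apply: le_trans (energy_lb u).
rewrite -mulrA ler_pM2l// mulrC ler_pdivrMr ?exprn_gt0// -exprMn.
by rewrite ler_sqr ?nnegrE ?mulr_ge0 ?(ltW C0)// mulrC hC.
Qed.

(** * The inverse of A on H and its Neumann series *)

Section Resolvent.
Variables (Rz : H -> V) (kappa : R).
Hypothesis hRz : forall k, A (Rz k) = iH k.
Hypothesis kappa_gt0 : 0 < kappa.
Hypothesis hkappa : forall u, kappa * `|iV u| ^+ 2 <= a u u.

Lemma energy_Rz k v : a (Rz k) v = ip k (iV v).
Proof. by rewrite /a hRz pairing_iH. Qed.

Lemma RzP c k l : Rz (c *: k + l) = c *: Rz k + Rz l.
Proof.
apply/eqP; rewrite -subr_eq0; apply/eqP/energy_inj.
by rewrite linearB linearP /= !hRz linearP subrr.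
Qed.

(** A^-1 seen as a bounded symmetric operator of [H]; [Rz] is the same inverse with values kept in
    [V]. *)
Definition resolvent k := iV (Rz k).
Local Notation B := resolvent.

Lemma resolventP c k l : B (c *: k + l) = c *: B k + B l.
Proof. by rewrite /B RzP linearP. Qed.

Lemma resolvent_sub k l : B (k - l) = B k - B l.
Proof. by rewrite addrC -scaleN1r resolventP scaleN1r addrC. Qed.

Lemma resolvent_sym k l : ip (B k) l = ip k (B l).
Proof.
by rewrite (ipC ip) -!energy_Rz energyC.
Qed.

Lemma resolvent_inj k : B k = 0 -> k = 0.
Proof.
move=> Bk0; have [_ _ _ [iHinj _ _ _] _] := hG.
have : Rz k = 0 by apply: energy_eq0; rewrite energy_Rz -/(B k) Bk0 linear0r.
by move=> /(congr1 A); rewrite hRz linear0 -(linear0 iH) => /iHinj.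
Qed.

(** Follows from kappa |B k|^2 <= a(Rz k, Rz k) = (k, B k) <= |k| |B k|. *)
Lemma resolvent_le k : kappa * `|B k| <= `|k|.
Proof.
have [->|Bk0] := eqVneq (B k) 0; first by rewrite normr0 mulr0.
rewrite -(@ler_pM2r _ `|B k|) ?normr_gt0// -mulrA -expr2.
apply: le_trans (hkappa _) _.
by rewrite energy_Rz; apply: le_trans (ip_ler hH _ _) _.
Qed.

(** The operator 1 - kappa A^-1 on [H], and on [V] in the next line. The first is a positive
    symmetric contraction for the scalar product, the second for the energy form, and [iV]
    intertwines them. *)
Definition Qop (k : H) := k - kappa *: B k.
Definition Nop (u : V) := u - kappa *: Rz (iV u).

Lemma QopP c k l : Qop (c *: k + l) = c *: Qop k + Qop l.
Proof.
rewrite /Qop resolventP scalerDr scalerBr opprD !scalerA (mulrC kappa).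
by rewrite addrACA.
Qed.

Lemma Qop_sym k l : ip (Qop k) l = ip k (Qop l).
Proof.
by rewrite /Qop !(formE (ipC ip) (ipP ip)) resolvent_sym.
Qed.

Lemma Qop_bnd k : 0 <= ip (Qop k) k <= ip k k.
Proof.
rewrite /Qop !(formE (ipC ip) (ipP ip)) subr_ge0 gerDl oppr_le0.
apply/andP; split.
  apply: le_trans (_ : `|kappa *: B k| * `|k| <= _).
    by rewrite -(formZl (ipP ip)); exact: ip_ler.
  rewrite normrZ gtr0_norm// -hH expr2 ler_wpM2r//; exact: resolvent_le.
by rewrite mulr_ge0 ?(ltW kappa_gt0)// (ipC ip) -energy_Rz; exact: energy_ge0.
Qed.

Lemma NopP c u v : Nop (c *: u + v) = c *: Nop u + Nop v.
Proof.
rewrite /Nop linearP RzP scalerDr scalerBr opprD !scalerA (mulrC kappa).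
by rewrite addrACA.
Qed.

Lemma energy_RziV u v : a (Rz (iV u)) v = a u (Rz (iV v)).
Proof. by rewrite (energyC u) !energy_Rz (ipC ip). Qed.

Lemma Nop_sym u v : a (Nop u) v = a u (Nop v).
Proof. by rewrite /Nop !(formE energyC energyP) energy_RziV. Qed.

Lemma Nop_bnd u : 0 <= a (Nop u) u <= a u u.
Proof.
rewrite /Nop !(formE energyC energyP) energy_Rz -hH subr_ge0 hkappa.
by rewrite gerDl oppr_le0 mulr_ge0 ?(ltW kappa_gt0) ?exprn_ge0.
Qed.

Lemma iter_Nop n u : iV (iter n Nop u) = iter n Qop (iV u).
Proof. by elim: n => [//|n IH]; rewrite !iterS -IH /Nop linearB linearZ. Qed.

(** A partial sum of the Neumann series of A^-1 = kappa (1 - Q)^-1 kappa^-1 inverted: kappa times it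
    is a bounded approximation of A, whose quadratic forms approach the energy from below. *)
Definition Sop n (k : H) := \sum_(j < n) iter j Qop k.

Lemma SopS n k : Sop n.+1 k = Sop n k + iter n Qop k.
Proof. by rewrite /Sop big_ord_recr. Qed.

Lemma iter_QopP n c k l :
  iter n Qop (c *: k + l) = c *: iter n Qop k + iter n Qop l.
Proof. by elim: n => [//|n IH]; rewrite !iterS IH QopP. Qed.

Lemma SopP n c k l : Sop n (c *: k + l) = c *: Sop n k + Sop n l.
Proof.
rewrite /Sop scaler_sumr -big_split /=.
by apply: eq_bigr => j _; rewrite iter_QopP.
Qed.

Lemma Sop_sym n k l : ip (Sop n k) l = ip k (Sop n l).
Proof.
elim: n => [|n IH]; first by rewrite /Sop !big_ord0 linear0l linear0r.
by rewrite !SopS !(formE (ipC ip) (ipP ip)) IH (iter_contraction_sym Qop_sym).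
Qed.

Lemma resolvent_Sop n k : kappa *: B (Sop n k) = k - iter n Qop k.
Proof.
elim: n => [|n IH].
  have B0 : B 0 = 0 by have := resolvent_sub 0 0; rewrite !subrr.
  by rewrite /Sop big_ord0 /= subrr B0 scaler0.
rewrite SopS -[Sop n k]scale1r resolventP scale1r scalerDr IH.
by rewrite iterS /Qop opprB -addrA [- _ + _]addrC.
Qed.

Lemma iter_Qop_le n k : `|iter n Qop k| <= `|k|.
Proof.
rewrite -ler_sqr ?nnegrE// !hH.
exact: (iter_contraction_sq (ipC ip) (ipP ip) QopP Qop_sym Qop_bnd).
Qed.

Lemma Sop_le n k : `|Sop n k| <= n%:R * `|k|.
Proof.
elim: n => [|n IH]; first by rewrite /Sop big_ord0 normr0 mul0r.
rewrite SopS -natr1 mulrDl mul1r (le_trans (ler_normD _ _))// lerD//.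
exact: iter_Qop_le.
Qed.

Lemma Sop_nd n m k : (n <= m)%N -> ip (Sop n k) k <= ip (Sop m k) k.
Proof.
move=> /subnK <-; elim: (m - n)%N => [//|j IH].
rewrite addSn SopS (formDl (ipP ip)) (le_trans IH)// lerDl.
exact: (iter_contraction_ge0 (ip_ge0 hH) Qop_sym Qop_bnd).
Qed.

(** Telescopes, since each application of [Nop] lowers the energy pairing with u by kappa (Q^n iV u,
    iV u). *)
Lemma energy_Sop n u :
  kappa * ip (Sop n (iV u)) (iV u) = a u u - a (iter n Nop u) u.
Proof.
elim: n => [|n IH].
  by rewrite /Sop big_ord0 /= subrr linear0l mulr0.
rewrite SopS (formDl (ipP ip)) mulrDr IH iterS.
rewrite {2}/Nop !(formE energyC energyP) -iter_Nop -energy_Rz; lra.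
Qed.

(** The pairing of the iterates [p n] and [p m] is c(n + m) for a decreasing sequence c >= 0, so the
    iterates are Cauchy in [V]. The limit q is 0: kappa |iV (p n)|^2 = c(2n) - c(2n + 1) tends to 0,
    hence [iV q = 0], and [iV] is injective. *)
Lemma iter_Nop_cvg0 u : a (iter n Nop u) u @[n --> \oo] --> (0 : R).
Proof.
pose c n := a (iter n Nop u) u.
have c0 n : 0 <= c n.
  exact: (iter_contraction_ge0 energy_ge0 Nop_sym Nop_bnd).
have cd n m : (n <= m)%N -> c m <= c n.
  exact: (iter_contraction_decr energyC energyP NopP Nop_sym Nop_bnd).
have ccauchy e : 0 < e -> exists N, forall n m, (N <= n)%N -> (N <= m)%N ->
    `|c n - c m| < e.
  have : cvgn c.
    apply: nonincreasing_is_cvgn; first by move=> n m; exact: cd.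
    by exists 0 => _ [n _ <-].
  move=> /cvg_ex[l /cvg_seqP cl] e0.
  have [|N hN] := cl (e / 2); first by rewrite divr_gt0.
  exists N => n m Nn Nm; have := hN _ Nn; have := hN _ Nm.
  rewrite /= !ltr_norml; lra.
pose p n := iter n Nop u.
have pa n m : a (p n) (p m) = c (n + m)%N.
  by rewrite /c (iter_contraction_split Nop_sym).
have pcauchy e : 0 < e -> exists N, forall n m, (N <= n <= m)%N ->
     `|p n - p m| < e.
  move=> e0; have l0 : 0 < lambda1 * e ^+ 2 by rewrite mulr_gt0// exprn_gt0.
  have [|N hN] := ccauchy (lambda1 * e ^+ 2 / 2); first by rewrite divr_gt0.
  exists N => n m /andP[Nn nm].
  have Nm := leq_trans Nn nm.
  rewrite -ltr_sqr ?nnegrE ?(ltW e0)// -(ltr_pM2l hlambda1).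
  apply: le_lt_trans (energy_lb _) _.
  rewrite !(formE energyC energyP) !pa.
  have := hN (n + n)%N (n + m)%N (leq_trans Nn (leq_addr _ _)) (leq_trans Nn (leq_addr _ _)).
  have := hN (m + m)%N (m + n)%N (leq_trans Nm (leq_addr _ _)) (leq_trans Nm (leq_addr _ _)).
  rewrite (addnC m n) !ltr_norml; lra.
have [q pq] := seq_complete pcauchy.
suff q0 : q = 0.
  have := pairing_cvg (l := A u) pq; rewrite q0 linear0r.
  by under eq_fun do rewrite -/(a u (p _)) energyC.
have [_ _ [iVinj ciV _ _] _ _] := hG.
apply: iVinj; rewrite linear0.
have iVp : iV (p n) @[n --> \oo] --> iV q by apply: continuous_cvg pq; exact: ciV.
apply: (cvg_unique (@norm_hausdorff _ H) iVp).
apply/cvg_seqP => e e0.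
have [|N hN] := ccauchy (kappa * e ^+ 2).
  by rewrite mulr_gt0// exprn_gt0.
exists N => n Nn; rewrite subr0.
rewrite -ltr_sqr ?nnegrE ?(ltW e0)// -(ltr_pM2l kappa_gt0).
have := hN (n + n)%N (n.+1 + n)%N (leq_trans Nn (leq_addr _ _)) (leq_trans Nn (leq_addl _ _)).
have pS : p n.+1 = Nop (p n) by [].
rewrite -!pa pS /Nop !(formE energyC energyP) energy_Rz -hH.
by move=> /(le_lt_trans (ler_norm _)); rewrite opprB addrC subrK.
Qed.

End Resolvent.
End Gelfand.

(** * Pointwise limits of simple functions *)

Section NonMeasurableIntegrands.
Local Open Scope ereal_scope.
Context d (T : measurableType d) (R : realType).
Variable mu : {measure set T -> \bar R}.

Import HBNNSimple.

(** The integral of any nonnegative function is a supremum over the simple functions below it.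
    Setting such a simple function to 0 on N keeps its integral and places it below g everywhere. *)
Lemma ge0_integral_off_null (N : set T) (f g : T -> \bar R) :
  measurable N -> mu N = 0 -> (forall x, 0 <= f x) -> (forall x, 0 <= g x) ->
  (forall x, ~ N x -> f x <= g x) -> \int[mu]_x f x <= \int[mu]_x g x.
Proof.
move=> mN N0 f0 g0 fg.
rewrite (ge0_integralTE mu f0) (ge0_integralTE mu g0).
apply: ge_ereal_sup => _ [h /= hf <-].
pose k := proj_nnsfun h (measurableC mN).
apply: (@le_trans _ _ (sintegral mu k)).
  rewrite -!integralT_nnsfun.
  rewrite le_eqVlt; apply/orP; left; apply/eqP.
  apply: ge0_ae_eq_integral => //.
  - exact/measurable_EFinP/measurable_funP.
  - exact/measurable_EFinP/measurable_funP.
  - by move=> x _; rewrite lee_fin.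
  - by move=> x _; rewrite lee_fin.
  - exists N; split => // x /= hx; apply: contrapT => Nx; apply: hx => _.
    by rewrite /k /= /mindic indicE mem_set// mulr1.
apply: ereal_sup_ubound; exists k => // x.
rewrite /k /= /mindic indicE; have [xN|xN] := boolP (x \in ~` N).
  by rewrite mulr1; apply: le_trans (hf x) _; apply: fg; move: xN; rewrite inE.
by rewrite mulr0.
Qed.

Lemma ae_le_ge0_integral (D : set T) (f g : T -> \bar R) :
  (forall x, D x -> 0 <= f x) -> (forall x, D x -> 0 <= g x) ->
  {ae mu, forall x, D x -> f x <= g x} ->
  \int[mu]_(x in D) f x <= \int[mu]_(x in D) g x.
Proof.
move=> f0 g0 [N [mN N0 fg]].
rewrite integral_mkcond [leRHS]integral_mkcond.
apply: (@ge0_integral_off_null N) => //.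
- by move=> x; rewrite patchE; case: ifPn => // /[!inE]; exact: f0.
- by move=> x; rewrite patchE; case: ifPn => // /[!inE]; exact: g0.
- move=> x Nx; rewrite !patchE; case: ifPn => // /[!inE] Dx.
  by apply: contrapT => h; apply: Nx; apply: fg => /= /(_ Dx).
Qed.

Lemma ae_eq_integral_nonmeasurable (D : set T) (f g : T -> \bar R) :
  {ae mu, forall x, D x -> f x = g x} ->
  \int[mu]_(x in D) f x = \int[mu]_(x in D) g x.
Proof.
move=> fg; rewrite integralE [RHS]integralE; congr (_ - _).
  by apply/eqP; rewrite eq_le; apply/andP; split; apply: ae_le_ge0_integral => //;
  apply: filterS fg => x /[apply] h; rewrite !funeposE h.
by apply/eqP; rewrite eq_le; apply/andP; split; apply: ae_le_ge0_integral => //;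
  apply: filterS fg => x /[apply] h; rewrite !funenegE h.
Qed.

Lemma ae_eq_Rintegral (D : set T) (f g : T -> R) :
  {ae mu, forall x, D x -> f x = g x} ->
  (\int[mu]_(x in D) f x)%R = (\int[mu]_(x in D) g x)%R.
Proof.
move=> fg; congr fine; apply: ae_eq_integral_nonmeasurable.
by apply: filterS fg => x /[apply] ->.
Qed.

End NonMeasurableIntegrands.

Section SimpleLimits.
Variable R : realType.
Implicit Types W : normedModType R.

Lemma simple_fun2 (W1 W2 W3 : normedModType R) (h : W1 -> W2 -> W3)
    (s1 : R -> W1) (s2 : R -> W2) :
  simple_fun s1 -> simple_fun s2 -> simple_fun (fun t => h (s1 t) (s2 t)).
Proof.
move=> [f1 m1] [f2 m2].
have fX : finite_set (range s1 `*` range s2) by exact: finite_setX.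
split.
  apply: sub_finite_set (finite_image (fun p => h p.1 p.2) fX).
  by move=> _ [t _ <-]; exists (s1 t, s2 t) => //; split; exists t.
move=> w.
rewrite (_ : _ @^-1` _ = \bigcup_(p in (range s1 `*` range s2) `&` [set p | h p.1 p.2 = w])
    ((s1 @^-1` [set p.1]) `&` (s2 @^-1` [set p.2]))); last first.
  apply/seteqP; split => [t /= tw|t [p [_ /= <-] [/= -> ->]]//].
  by exists (s1 t, s2 t) => //; split => //; split; exists t.
apply: fin_bigcup_measurable => [|p _]; first exact: finite_setIl.
by apply: measurableI; [exact: m1|exact: m2].
Qed.

Lemma simple_fun_cst W (w : W) : simple_fun (fun _ : R => w).
Proof.
split; first by apply: sub_finite_set (finite_set1 w) => _ [t _ <-].
move=> w'; have [->|ww'] := pselect (w = w').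
  rewrite (_ : _ @^-1` _ = setT); first exact: measurableT.
  by apply/seteqP; split.
rewrite (_ : _ @^-1` _ = set0); first exact: measurable0.
by apply/seteqP; split.
Qed.

Lemma simple_fun_indic (D : set R) : measurable D ->
  simple_fun (\1_D : R -> R^o).
Proof.
move=> mD; split.
  apply: (@sub_finite_set _ _ [set 0; 1]); last exact: finite_set2.
  by move=> _ [t _ <-]; rewrite indicE; case: (_ \in _); [right|left].
move=> w.
have -> : \1_D @^-1` [set w] =
    (D `&` [set _ | w = 1]) `|` (~` D `&` [set _ | w = 0]).
  apply/seteqP; split => t /=; rewrite indicE.
    by have [tD|tD] := pselect (D t); [rewrite mem_set//|rewrite memNset//] => <-; [left|right].
  by move=> [[tD ->]|[tD ->]]; [rewrite mem_set|rewrite memNset].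
apply: measurableU; apply: measurableI => //; [|exact: measurableC|].
  have [w1|w1] := pselect (w = 1).
    by rewrite (_ : [set _ | _] = setT)//; apply/seteqP; split.
  by rewrite (_ : [set _ | _] = set0)//; apply/seteqP; split.
have [w1|w1] := pselect (w = 0).
  by rewrite (_ : [set _ | _] = setT)//; apply/seteqP; split.
by rewrite (_ : [set _ | _] = set0)//; apply/seteqP; split.
Qed.

Lemma simple_fun_measurable (s : R -> R^o) :
  simple_fun s -> measurable_fun setT (s : R -> R).
Proof.
move=> [fs ms] _ Y mY; rewrite setTI.
rewrite (_ : _ @^-1` _ = \bigcup_(y in range s `&` Y) (s @^-1` [set y])); last first.
  apply/seteqP; split => [t /= tY|t [y [_ /= Yy] /= ->]//].
  by exists (s t) => //; split => //; exists t.
by apply: fin_bigcup_measurable => [|p _]; [exact: finite_setIl|exact: ms].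
Qed.

Lemma measurable_shift (c : R) (D : set R) : measurable D ->
  measurable [set t | D (t + c)].
Proof.
move=> mD; have : measurable_fun setT (fun t : R => t + c).
  by apply: measurable_funD => //; exact: measurable_cst.
by move=> /(_ measurableT _ mD); rewrite setTI.
Qed.

Lemma simple_fun_shift W (s : R -> W) (c : R) :
  simple_fun s -> simple_fun (fun t => s (t + c)).
Proof.
move=> [fs ms]; split.
  by apply: sub_finite_set fs => _ [t _ <-]; exists (t + c).
by move=> w; exact: measurable_shift (ms w).
Qed.

(* Unlike [strongly_measurable], the convergence holds at every point, so that
   compositions are Borel measurable. *)
Definition simple_limit W (f : R -> W) : Prop :=
  exists2 s : nat -> R -> W, (forall n, simple_fun (s n)) &
    forall t, s n t @[n --> \oo] --> f t.

Lemma simple_limit2 (W1 W2 W3 : normedModType R) (h : W1 -> W2 -> W3)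
    (f1 : R -> W1) (f2 : R -> W2) :
  (forall (u1 : nat -> W1) (u2 : nat -> W2) l1 l2,
     u1 n @[n --> \oo] --> l1 -> u2 n @[n --> \oo] --> l2 ->
     h (u1 n) (u2 n) @[n --> \oo] --> h l1 l2) ->
  simple_limit f1 -> simple_limit f2 ->
  simple_limit (fun t => h (f1 t) (f2 t)).
Proof.
move=> hc [s1 ss1 sf1] [s2 ss2 sf2].
exists (fun n t => h (s1 n t) (s2 n t)) => [n|t].
  exact: simple_fun2.
exact: hc.
Qed.

Lemma simple_fun_limit W (s : R -> W) : simple_fun s -> simple_limit s.
Proof. by move=> ss; exists (fun=> s) => // t; exact: cvg_cst. Qed.

Lemma simple_limit_cst W (w : W) : simple_limit (fun _ : R => w).
Proof. by apply: simple_fun_limit; exact: simple_fun_cst. Qed.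

Lemma simple_limit_continuous (W1 W2 : normedModType R) (h : W1 -> W2)
    (f : R -> W1) : continuous h -> simple_limit f ->
  simple_limit (fun t => h (f t)).
Proof.
move=> ch [s ss sf]; exists (fun n t => h (s n t)) => [n|t].
  exact: (simple_fun2 (fun u _ => h u) (ss n) (ss n)).
by apply: continuous_cvg (sf t); exact: ch.
Qed.

Lemma simple_limitD W (f g : R -> W) :
  simple_limit f -> simple_limit g -> simple_limit (fun t => f t + g t).
Proof.
by apply: (simple_limit2 (h := fun u v : W => u + v)) => u1 u2 l1 l2; exact: cvgD.
Qed.

Lemma simple_limitB W (f g : R -> W) :
  simple_limit f -> simple_limit g -> simple_limit (fun t => f t - g t).
Proof.
by apply: (simple_limit2 (h := fun u v : W => u - v)) => u1 u2 l1 l2; exact: cvgB.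
Qed.

Lemma simple_limitZ W (f : R -> R^o) (g : R -> W) :
  simple_limit f -> simple_limit g -> simple_limit (fun t => f t *: g t).
Proof.
by apply: (simple_limit2 (h := fun (u : R^o) (v : W) => u *: v)) => u1 u2 l1 l2; exact: cvgZ.
Qed.

Lemma simple_limit_restrict W (D : set R) (f : R -> W) : measurable D ->
  simple_limit f -> simple_limit (fun t => (\1_D t : R) *: f t).
Proof.
move=> mD sf; apply: simple_limitZ => //.
by apply: simple_fun_limit; exact: simple_fun_indic.
Qed.

Lemma simple_limit_shift W (f : R -> W) (c : R) :
  simple_limit f -> simple_limit (fun t => f (t + c)).
Proof.
move=> [s ss sf]; exists (fun n t => s n (t + c)) => // n.
exact: simple_fun_shift.
Qed.

Lemma simple_limit_measurable (f : R -> R^o) :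
  simple_limit f -> measurable_fun setT (f : R -> R).
Proof.
move=> [s ss sf].
apply: (measurable_fun_cvg (h := s)) => [n|t _].
  exact: simple_fun_measurable.
exact: sf.
Qed.

Lemma simple_limit_norm W (f : R -> W) : simple_limit f ->
  measurable_fun setT (fun t => `|f t|).
Proof.
move=> sf; apply: (@simple_limit_measurable (fun t => `|f t|)).
apply: (@simple_limit_continuous W R^o (fun x => `|x|)) sf.
exact: norm_continuous.
Qed.

Lemma simple_limit_strong W (D : set R) (f : R -> W) :
  simple_limit f -> strongly_measurable D f.
Proof. by move=> [s ss sf]; exists s => //; apply: nearW => t _; exact: sf. Qed.

(** Multiplying by the indicator of D minus the exceptional null set turns convergence almost
    everywhere on D into convergence at every real. *)
Lemma strongly_measurable_simple_limit W (D : set R) (f : R -> W) :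
  measurable D -> strongly_measurable D f ->
  exists g : R -> W, [/\ simple_limit g,
    {ae lebesgue_measure, forall t, D t -> g t = f t} &
    forall t, ~ D t -> g t = 0].
Proof.
move=> mD [s ss [N [mN N0 sf]]].
pose DN := D `\` N.
have mDN : measurable DN by exact: measurableD.
exists (fun t => (\1_DN t : R) *: f t); split.
- exists (fun n t => (\1_DN t : R) *: s n t) => [n|t].
    apply: (simple_fun2 (fun (c : R^o) (w : W) => c *: w)) => //.
    exact: simple_fun_indic.
  rewrite indicE; have [/[!inE] [[tD tN]]|_] := boolP (t \in DN).
    under eq_fun do rewrite scale1r; rewrite scale1r.
    by apply: contrapT => h; apply: tN; apply: sf => /= /(_ tD).
  by under eq_fun do rewrite scale0r; rewrite scale0r; exact: cvg_cst.
- exists N; split => // t /=; apply: contraPP => tN; rewrite not_notE => Dt.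
  by rewrite indicE mem_set ?scale1r.
- by move=> t tD; rewrite indicE memNset ?scale0r// => -[].
Qed.

End SimpleLimits.

(** * Square integrable functions with values in a normed space *)

Lemma ae_imply (R : realType) (P Q : R -> Prop) :
  {ae lebesgue_measure, forall t, P t} -> (forall t, P t -> Q t) ->
  {ae lebesgue_measure, forall t, Q t}.
Proof.
move=> [N [mN N0 hN]] PQ; exists N; split => // t /= nQ.
by apply: hN => /= Pt; exact/nQ/PQ.
Qed.

Lemma ae_imply2 (R : realType) (P1 P2 Q : R -> Prop) :
  {ae lebesgue_measure, forall t, P1 t} ->
  {ae lebesgue_measure, forall t, P2 t} -> (forall t, P1 t -> P2 t -> Q t) ->
  {ae lebesgue_measure, forall t, Q t}.
Proof.
move=> aeP1 aeP2 PQ; apply: negligibleS (negligibleU aeP1 aeP2) => t /= nQ.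
by apply: contrapT => /not_orP[/contrapT p1 /contrapT p2]; exact/nQ/PQ.
Qed.

(** * Translation invariance of the Lebesgue measure *)

Section Translation.
Variable R : realType.
Local Notation mu := (@lebesgue_measure R).

Lemma measurable_addr (c : R) :
  measurable_fun setT (+%R^~ c : measurableTypeR R -> measurableTypeR R).
Proof. by apply: measurable_funD => //; exact: measurable_cst. Qed.

Lemma lebesgue_measure_shift (c : R) (A : set R) : measurable A ->
  pushforward mu (+%R^~ c : _ -> measurableTypeR R) A = mu A.
Proof.
move=> mA; apply/esym/lebesgue_measure_unique => //=.
  exact: measurable_addr.
move=> _ _ [[a b]] _ <-; rewrite /pushforward.
rewrite (_ : _ @^-1` _ = `]a - c, b - c]%classic); last first.
  apply/seteqP; split => t /=; rewrite !in_itv /= => /andP[h1 h2];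
  apply/andP; split; lra.
rewrite !lebesgue_measure_itv/= !lte_fin ltrD2r.
by case: ifP => // _; congr (_%:E); rewrite opprD opprK addrACA addNr addr0.
Qed.

Lemma ge0_integral_shift (c : R) (D : set R) (f : R -> \bar R) :
  measurable D -> measurable_fun setT f -> (forall t, 0 <= f t)%E ->
  (\int[mu]_(t in D) f t =
   \int[mu]_(t in [set t | D (t + c)%R]) f (t + c)%R)%E.
Proof.
move=> mD mf f0.
have := @ge0_integral_pushforward _ _ _ _ R _ (measurable_addr c) mu D f.
move=> /(_ mD (measurable_funTS mf) (fun y _ => f0 y)) <-.
apply: eq_measure_integral; first exact: measurable_addr.
by move=> h A mA _; exact/esym/lebesgue_measure_shift.
Qed.

Lemma Rintegral_shift (c : R) (D : set R) (f : R -> R) :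
  measurable D -> measurable_fun setT f ->
  \int[mu]_(t in D) f t = \int[mu]_(t in [set t | D (t + c)]) f (t + c).
Proof.
move=> mD mf; congr fine.
have mef : measurable_fun setT (fun t => (f t)%:E) by exact/measurable_EFinP.
rewrite integralE [RHS]integralE; congr (_ - _)%E.
  rewrite (ge0_integral_shift c)//; last exact: measurable_funepos.
  by apply: eq_integral => t _; rewrite !funeposE.
rewrite (ge0_integral_shift c)//; last exact: measurable_funeneg.
by apply: eq_integral => t _; rewrite !funenegE.
Qed.

Lemma ae_shift (c : R) (P : R -> Prop) :
  {ae mu, forall t, P t} -> {ae mu, forall t, P (t + c)}.
Proof.
move=> [N [mN N0 hN]]; exists [set t | N (t + c)]; split.
- exact: measurable_shift.
- by rewrite -N0 -(lebesgue_measure_shift c mN).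
- by move=> t /= Pt; apply: hN.
Qed.

End Translation.

(** * Completeness of L^2 for Banach-valued functions *)

Section L2Limits.
Variable R : realType.
Local Notation mu := (@lebesgue_measure R).
Variable D : set R.
Hypothesis mD : measurable D.

Lemma measurable_sqnorm (W : normedModType R) (f : R -> W) : simple_limit f ->
  measurable_fun D (fun t => (`|f t| ^+ 2)%:E).
Proof.
move=> sf; apply/measurable_EFinP; apply: measurable_funTS.
by apply: measurable_funX; exact: simple_limit_norm.
Qed.

(** Approximants are set to 0 where their norm exceeds 2 |f|. They still converge to f at every
    point: trivially where f = 0, and elsewhere because the cut is eventually inactive. The errors
    are now at most 3 |f|, so dominated convergence applies with 9 |f|^2. *)
Lemma simple_L2_approx (W : normedModType R) (f : R -> W) (e : R) : 0 < e ->
  simple_limit f -> (\int[mu]_(t in D) (`|f t| ^+ 2)%:E < +oo)%E ->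
  exists2 s, simple_fun s &
    (\int[mu]_(t in D) (`|f t - s t| ^+ 2)%:E <= e%:E)%E.
Proof.
move=> e0 sf intf; have [s ss scv] := sf.
pose B n := [set t : R | `|s n t| <= 2 * `|f t|].
have mB n : measurable (B n).
  have m1 : measurable_fun setT (fun t : R => `|s n t|).
    by apply: simple_limit_norm; exact: simple_fun_limit.
  have m2 : measurable_fun setT (fun t : R => 2 * `|f t|).
    apply: measurable_funM; first exact: measurable_cst.
    exact: simple_limit_norm.
  by have := measurable_fun_le measurableT m1 m2; rewrite setTI.
pose s' n t := (\1_(B n) t : R) *: s n t.
have ss' n : simple_fun (s' n).
  apply: (simple_fun2 (fun (c : R^o) (w : W) => c *: w)) => //.
  exact: simple_fun_indic.
have s'le n t : `|s' n t| <= 2 * `|f t|.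
  rewrite /s' indicE; have [/[!inE] tB|_] := boolP (t \in B n).
    by rewrite scale1r.
  by rewrite scale0r normr0 mulr_ge0.
have s'cv t : s' n t @[n --> \oo] --> f t.
  have [f0|f0] := eqVneq (f t) 0.
    rewrite f0 (_ : (fun n => s' n t) = fun=> 0); first exact: cvg_cst.
    apply/funext => n; apply/eqP; rewrite -normr_le0.
    by apply: le_trans (s'le n t) _; rewrite f0 normr0 mulr0.
  apply/cvg_seqP => e1 e10.
  have /cvg_seqP h := scv t.
  have [N hN] := h _ e10.
  have [|N' hN'] := h `|f t|; first by rewrite normr_gt0.
  exists (maxn N N') => n; rewrite geq_max => /andP[Nn N'n].
  rewrite /s' indicE mem_set ?scale1r; first exact: hN.
  rewrite /B /= -[s n t](subrK (f t)) (le_trans (ler_normD _ _))//.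
  by have /ltW := hN' n N'n; lra.
have sd n : simple_limit (fun t => f t - s' n t).
  by apply: simple_limitB => //; exact: simple_fun_limit.
pose F n t := (`|f t - s' n t| ^+ 2)%:E.
have [_ _ hcv] : [/\ mu.-integrable D (cst 0%E),
    [sequence \int[mu]_(t in D) `|F n t - cst 0 t|]_n @ \oo --> 0 &
    [sequence \int[mu]_(t in D) (F n t)]_n @ \oo --> \int[mu]_(t in D) cst 0 t]%E.
  apply: (@dominated_convergence _ _ R mu D mD F (cst 0%E)
    (fun t => (9 * `|f t| ^+ 2)%:E)).
  - by move=> n; exact: measurable_sqnorm.
  - exact: measurable_cst.
  - apply: nearW => t _; rewrite /F -[X in _ --> X]/((0 : R)%:E).
    apply/cvg_EFin; first by exact: nearW.
    rewrite -[X in _ --> X](mulr0 0).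
    apply: cvgM; rewrite -(normr0 W) -(subrr (f t)); apply: cvg_norm;
    by apply: cvgB; [exact: cvg_cst|exact: s'cv].
  - apply/integrableP; split.
      apply/measurable_EFinP; apply: measurable_funM; first exact: measurable_cst.
      by apply/measurable_EFinP; exact: measurable_sqnorm.
    under eq_integral do rewrite gee0_abs ?lee_fin ?mulr_ge0 ?exprn_ge0// EFinM.
    rewrite ge0_integralZl//.
      by rewrite lte_mul_pinfty.
    exact: measurable_sqnorm.
  - apply: nearW => t n _; rewrite /F gee0_abs ?lee_fin ?exprn_ge0//.
    have h : `|f t - s' n t| <= 3 * `|f t|.
      by have := ler_normB (f t) (s' n t); have := s'le n t; lra.
    rewrite (_ : 9 * _ = (3 * `|f t|) ^+ 2); last by ring.
    by rewrite ler_sqr ?nnegrE ?mulr_ge0.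
move: hcv; rewrite integral0 => /fine_cvgP[hfin].
move=> /cvg_seqP/(_ e e0)[N hN].
have [N' _ hN'] := hfin.
exists (s' (maxn N N')) => //.
have fn := hN' (maxn N N') (leq_maxr _ _).
rewrite -[leLHS]fineK// lee_fin.
have := hN _ (leq_maxl N N'); rewrite /= subr0 => /ltW.
exact: le_trans (ler_norm _).
Qed.

(** The series of the 4^n u_n has integral at most the sum of the 2^-n, that is 2. It is therefore
    finite almost everywhere, and its sum at t serves as C. *)
Lemma ae_summable (u : nat -> R -> R) :
  (forall n, measurable_fun D (fun t => (u n t)%:E)) ->
  (forall n t, 0 <= u n t) ->
  (forall n, \int[mu]_(t in D) (u n t)%:E <= ((8^-1) ^+ n)%:E)%E ->
  {ae mu, forall t, D t -> exists C : R, forall n, u n t <= C * (4^-1) ^+ n}.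
Proof.
move=> mu_ u0 ule.
pose g t := (\sum_(0 <= n <oo) (4 ^+ n * u n t)%:E)%E.
have mg n : measurable_fun D (fun t => (4 ^+ n * u n t)%:E).
  apply/measurable_EFinP; apply: measurable_funM; first exact: measurable_cst.
  by apply/measurable_EFinP; exact: mu_.
have g0 n t : D t -> (0 <= (4 ^+ n * u n t)%:E)%E.
  by move=> _; rewrite lee_fin mulr_ge0// exprn_ge0.
have intg : (\int[mu]_(t in D) g t < +oo)%E.
  rewrite (integral_nneseries mu mD mg g0).
  apply: (@le_lt_trans _ _ (\sum_(0 <= n <oo) ((2^-1) ^+ n)%:E)%E).
    apply: lee_nneseries => [n _ _|n _].
      by apply: integral_ge0 => t; exact: g0.
    under eq_integral do rewrite EFinM.
    rewrite ge0_integralZl ?lee_fin ?exprn_ge0//.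
    apply: le_trans (lee_wpmul2l _ (ule n)) _.
      by rewrite lee_fin exprn_ge0.
    - rewrite -EFinM lee_fin -exprMn (_ : 4 * 8^-1 = 2^-1 :> R)//; first by field.
    - exact: mu_.
    - by move=> t _; rewrite lee_fin.
  have h : (series (fun n => (2^-1 : R) ^+ n)) @ \oo --> (2 : R).
    have := @cvg_geometric_series R 1 2^-1.
    rewrite gtr0_norm ?invr_gt0// invf_lt1// ltr1n => /(_ isT).
    rewrite (_ : 1 / (1 - 2^-1) = 2 :> R); last by field.
    rewrite (_ : geometric 1 2^-1 = (fun n => (2^-1 : R) ^+ n))//.
    by apply/funext => n; rewrite /geometric /= mul1r.
  have -> : (\sum_(0 <= n <oo) ((2^-1) ^+ n)%:E = (2 : R)%:E)%E.
    apply/cvg_lim => //.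
    under eq_fun do rewrite sumEFin.
    by apply/cvg_EFin; [exact: nearW|exact: h].
  exact: ltry.
have intg' : mu.-integrable D g.
  apply/integrableP; split.
    by apply: ge0_emeasurable_sum => [n t Dt _|n _]; [exact: g0|exact: mg].
  move: intg; rewrite (_ : (\int[mu]_(t in D) g t = \int[mu]_(t in D) `|g t|)%E)//.
  apply: eq_integral => t /[!inE] Dt.
  rewrite gee0_abs//; apply: nneseries_ge0 => n _ _; exact: g0.
apply: filterS (@integrable_ae _ _ R mu D mD g intg') => t h Dt.
exists (fine (g t)) => n.
have gle : ((4 ^+ n * u n t)%:E <= g t)%E.
  rewrite /g (nneseriesD1 (n := n))//; last by move=> k _; exact: g0.
  rewrite leeDl//; apply: nneseries_ge0 => k _ _; exact: g0.
move: gle; rewrite -{1}(fineK (h Dt)) lee_fin => gle.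
by rewrite exprVn ler_pdivlMr ?exprn_gt0// mulrC.
Qed.

(** Fatou's lemma in the form used below: the limit v enters only through its values almost
    everywhere and may fail to be measurable. *)
Lemma fatou_bound (u : nat -> R -> R) (v : R -> R) (c : \bar R) :
  (forall n, measurable_fun D (fun t => (u n t)%:E)) ->
  (forall n t, 0 <= u n t) -> (forall t, 0 <= v t) ->
  (forall n, \int[mu]_(t in D) (u n t)%:E <= c)%E ->
  {ae mu, forall t, D t -> u n t @[n --> \oo] --> v t} ->
  (\int[mu]_(t in D) (v t)%:E <= c)%E.
Proof.
move=> mu_ u0 v0 uc uv.
have eu0 n t : D t -> (0 <= (u n t)%:E)%E by move=> _; rewrite lee_fin.
apply: (@le_trans _ _ (\int[mu]_(t in D) limn_einf (fun n => (u n t)%:E))%E).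
  apply: ae_le_ge0_integral.
  - by move=> t _; rewrite lee_fin.
  - move=> t Dt; rewrite limn_einf_lim; apply: lime_ge.
      exact: is_cvg_einfs.
    by apply: nearW => n; apply: le_ereal_inf_tmp => _ [k /= _ <-]; exact: eu0.
  - apply: (ae_imply uv) => t uvt' Dt; have uvt := uvt' Dt.
    have h : (u n t)%:E @[n --> \oo] --> (v t)%:E.
      by apply/cvg_EFin; [exact: nearW|exact: uvt].
    rewrite is_cvg_limn_einfE; last by apply/cvg_ex; exists (v t)%:E.
    by rewrite (cvg_lim _ h).
apply: le_trans (fatou mu mD mu_ eu0) _.
rewrite limn_einf_lim; apply: lime_le; first exact: is_cvg_einfs.
apply: nearW => n; apply: le_trans (uc n).
by apply: ereal_inf_lbound; exists n => /=.
Qed.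

(* Riesz-Fischer; a simple approximation [s n] of [g n] within [8^-n] makes
   the limit strongly measurable. *)
Lemma L2_limit (W : completeNormedModType R) (g : nat -> R -> W) :
  (forall n, simple_limit (g n)) ->
  (forall n, \int[mu]_(t in D) (`|g n t| ^+ 2)%:E < +oo)%E ->
  (forall n m, (n <= m)%N ->
     \int[mu]_(t in D) (`|g n t - g m t| ^+ 2)%:E <= ((8^-1) ^+ n)%:E)%E ->
  exists f : R -> W, [/\ simple_limit f,
    {ae mu, forall t, D t -> g n t @[n --> \oo] --> f t} &
    forall n, (\int[mu]_(t in D) (`|g n t - f t| ^+ 2)%:E <= ((8^-1) ^+ n)%:E)%E].
Proof.
move=> sg intg gcauchy.
have e0 n : 0 < (8^-1 : R) ^+ n by rewrite exprn_gt0// invr_gt0.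
have /choice[s hs] n : exists s, simple_fun s /\
    (\int[mu]_(t in D) (`|g n t - s t| ^+ 2)%:E <= ((8^-1) ^+ n)%:E)%E.
  by have [s ss h] := simple_L2_approx (e0 n) (sg n) (intg n); exists s.
have sgs n : simple_limit (fun t => g n t - s n t).
  by apply: simple_limitB => //; apply: simple_fun_limit; exact: (hs n).1.
have sgg n m : simple_limit (fun t => g n t - g m t) by exact: simple_limitB.
have h1 := ae_summable (fun n => measurable_sqnorm (sgs n))
  (fun n t => exprn_ge0 2 (normr_ge0 _)) (fun n => (hs n).2).
have h2 := ae_summable (fun n => measurable_sqnorm (sgg n n.+1))
  (fun n t => exprn_ge0 2 (normr_ge0 _)) (fun n => gcauchy n n.+1 (leqnSn n)).
(* A square root without radicals: C <= (C + 1)^2. *)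
have bnd (x C : R) n : 0 <= x -> x ^+ 2 <= C * (4^-1) ^+ n ->
    x <= (C + 1) * (2^-1) ^+ n.
  move=> x0 xC.
  have C0 : 0 <= C.
    have := le_trans (sqr_ge0 x) xC.
    by rewrite pmulr_lge0// exprn_gt0// invr_gt0.
  rewrite -ler_sqr ?nnegrE// ?mulr_ge0 ?exprn_ge0 ?invr_ge0 ?addr_ge0//.
  apply: le_trans xC _; rewrite exprMn -exprM mulnC exprM.
  rewrite (_ : (2^-1) ^+ 2 = 4^-1 :> R); last by rewrite exprVn; congr (_^-1); ring.
  rewrite ler_wpM2r ?exprn_ge0 ?invr_ge0//; have := sqr_ge0 C; lra.
have half_cvg0 (C e : R) : 0 <= C -> 0 < e ->
    exists N, forall n, (N <= n)%N -> C * (2^-1) ^+ n < e.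
  move=> C0 e1.
  have : (GRing.exp (2^-1 : R)) @ \oo --> (0 : R).
    by apply: cvg_expr; rewrite gtr0_norm ?invr_gt0// invf_lt1// ltr1n.
  move=> /(cvg_seqP (fun n => (2^-1 : R) ^+ n) (0 : R)) h.
  have [|N hN] := h (e / (C + 1)); first by rewrite divr_gt0// ltr_wpDl.
  exists N => n /hN; rewrite subr0 ger0_norm ?exprn_ge0 ?invr_ge0//.
  rewrite ltr_pdivlMr ?ltr_wpDl// => h'; apply: le_lt_trans h'.
  by rewrite mulrC ler_wpM2l ?exprn_ge0 ?invr_ge0// lerDl.
have hcv : {ae mu, forall t, D t -> exists l : W,
    g n t @[n --> \oo] --> l /\ s n t @[n --> \oo] --> l}.
  apply: (ae_imply2 h1 h2) => t H1 H2 Dt.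
  have [C1 hC1] := H1 Dt; have [C2 hC2] := H2 Dt.
  have {}hC1 n := bnd _ _ _ (normr_ge0 _) (hC1 n).
  have {}hC2 n := bnd _ _ _ (normr_ge0 _) (hC2 n).
  have C10 : 0 <= C1 + 1 by have := le_trans (normr_ge0 _) (hC1 0%N); rewrite mulr1.
  have C20 : 0 <= C2 + 1 by have := le_trans (normr_ge0 _) (hC2 0%N); rewrite mulr1.
  (* The right-hand side is the geometric sum of (C2 + 1) 2^-j over n <= j < n + k, which telescopes
     in the induction. *)
  have gd n k : `|g n t - g (n + k)%N t| <=
      2 * (C2 + 1) * ((2^-1) ^+ n - (2^-1) ^+ (n + k)%N).
    elim: k => [|k IH]; first by rewrite addn0 !subrr mulr0 normr0.
    rewrite addnS -(subrKA (g (n + k)%N t)) (le_trans (ler_normD _ _))//.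
    have := hC2 (n + k)%N; rewrite exprS; lra.
  have [l gl] : exists l : W, g n t @[n --> \oo] --> l.
    apply: seq_complete => e e1.
    have [|N hN] := half_cvg0 (2 * (C2 + 1)) e _ e1; first by rewrite mulr_ge0.
    exists N => n m /andP[Nn nm]; apply: le_lt_trans (hN n Nn).
    rewrite -(subnKC nm); apply: le_trans (gd n _) _.
    by rewrite ler_wpM2l ?mulr_ge0// gerBl exprn_ge0 ?invr_ge0.
  exists l; split => //.
  have gs0 : (g n t - s n t) @[n --> \oo] --> (0 : W).
    apply/cvg_seqP => e e1; have [N hN] := half_cvg0 _ e C10 e1.
    by exists N => n Nn; rewrite subr0; apply: le_lt_trans (hC1 n) (hN n Nn).
  have h : (g n t - (g n t - s n t)) @[n --> \oo] --> l - 0 by exact: cvgB gl gs0.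
  rewrite subr0 (_ : (fun n => _) = s^~ t) in h => //.
  by apply/funext => n; rewrite opprB addrC subrK.
have [N [mN N0 hN]] := hcv.
pose DN := D `\` N.
have mDN : measurable DN by exact: measurableD.
have /choice[f hf] t : exists l : W, DN t ->
    g n t @[n --> \oo] --> l /\ s n t @[n --> \oo] --> l.
  have [[Dt Nt]|nt] := pselect (DN t); last by exists 0.
  suff [l hl] : exists l : W, g n t @[n --> \oo] --> l /\ s n t @[n --> \oo] --> l.
    by exists l.
  by apply: contrapT => h; apply: Nt; apply: hN => /= /(_ Dt).
(* Vanishing off [DN] makes the truncated [s n] converge to f' at every point, as [simple_limit]
   requires. *)
pose f' t := (\1_DN t : R) *: f t.
have f'E t : DN t -> f' t = f t.
  by move=> tD; rewrite /f' indicE mem_set ?scale1r.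
have sf' : simple_limit f'.
  exists (fun n t => (\1_DN t : R) *: s n t) => [n|t].
    apply: (simple_fun2 (fun (c : R^o) (w : W) => c *: w)); last exact: (hs n).1.
    exact: simple_fun_indic.
  rewrite /f' indicE; have [/[!inE] tD|_] := boolP (t \in DN).
    by under eq_fun do rewrite scale1r; rewrite scale1r; exact: (hf t tD).2.
  by under eq_fun do rewrite scale0r; rewrite scale0r; exact: cvg_cst.
have gf' : {ae mu, forall t, D t -> g n t @[n --> \oo] --> f' t}.
  exists N; split => // t /=; apply: contraPP => tN; rewrite not_notE => Dt.
  by rewrite f'E//; exact: (hf t _).1.
exists f'; split => // n.
apply: (fatou_bound (u := fun m t => `|g n t - g (n + m)%N t| ^+ 2)) => [m|m t|t|m|].
- exact: measurable_sqnorm.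
- by rewrite exprn_ge0.
- by rewrite exprn_ge0.
- exact: gcauchy (leq_addr _ _).
- apply: (ae_imply gf') => t gt' Dt; have gt := gt' Dt.
  have gt1 : (g (n + m)%N t) @[m --> \oo] --> f' t.
    apply/cvg_seqP => e e1; have /cvg_seqP/(_ e e1)[N' hN'] := gt.
    by exists N' => m Nm; apply: hN'; exact: leq_trans Nm (leq_addl _ _).
  by apply: cvgM; apply: cvg_norm; apply: cvgB => //; exact: cvg_cst.
Qed.

End L2Limits.

(** * Smooth bumps and the du Bois-Reymond lemma *)

Section Bump.
Variable R : realType.
Implicit Types (P : {poly R}) (m : nat) (x : R).

(* [P(x) u^-m exp (- 1 / u)] on [0, 1], with [u = x (1 - x)]: a class of
   functions that contains a bump and is closed under differentiation. *)
Definition bump (P : {poly R}) (m : nat) (x : R) : R :=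
  if (0 < x) && (x < 1) then
    P.[x] * (x * (1 - x))^-1 ^+ m * expR (- (x * (1 - x))^-1) else 0.

Lemma poly_bounded P : exists2 K, 0 <= K &
  forall x, 0 <= x <= 1 -> `|P.[x]| <= K.
Proof.
elim/poly_ind: P => [|P c [K K0 hK]].
  by exists 0 => // x _; rewrite horner0 normr0.
exists (K + `|c|) => [|x /andP[x0 x1]]; first by rewrite addr_ge0.
rewrite hornerMXaddC (le_trans (ler_normD _ _))// lerD// normrM.
apply: le_trans (hK x _); last by rewrite x0.
by rewrite ler_piMr// ger0_norm.
Qed.

(** With z = 1/u, exp z >= z^(m+2) / (m+2)! absorbs the pole u^-m and leaves a factor u^2. This
    quadratic decay is what makes all derivatives vanish at 0 and 1. *)
Lemma bump_le P m : exists2 K, 0 <= K &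
  forall x, `|bump P m x| <= K * (x * (1 - x)) ^+ 2.
Proof.
have [K K0 hK] := poly_bounded P.
exists (K * (m.+2)`!%:R) => [|x]; first by rewrite mulr_ge0.
rewrite /bump; case: ifPn => [/andP[x0 x1]|_]; last first.
  by rewrite normr0 mulr_ge0 ?sqr_ge0// mulr_ge0.
have u0 : 0 < x * (1 - x) by rewrite mulr_gt0// subr_gt0.
set z := (x * (1 - x))^-1.
have z0 : 0 < z by rewrite invr_gt0.
have -> : x * (1 - x) = z^-1 by rewrite /z invrK.
clearbody z.
rewrite 2!normrM -!mulrA ler_pM ?mulr_ge0//; first by apply: hK; rewrite !ltW.
rewrite normrX !gtr0_norm ?expR_gt0// expRN ler_pdivrMr ?expR_gt0//.
rewrite exprVn mulrAC ler_pdivlMr ?exprn_gt0// -exprD addn2.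
have h := expR_ge1Dxn m.+1 (ltW z0).
have {}h : z ^+ m.+2 / (m.+2)`!%:R <= expR z.
  by apply: le_trans h; rewrite lerDr ler01.
by move: h; rewrite ler_pdivrMr ?ltr0n ?fact_gt0// mulrC.
Qed.

Lemma is_derive_sq_bound (f : R -> R) (a K : R) :
  0 <= K -> (forall x, `|f x| <= K * (x - a) ^+ 2) -> is_derive a 1 f 0.
Proof.
move=> K0 hf; apply/is_derive1_caratheodory.
have fa : f a = 0.
  apply/eqP; rewrite -normr_le0; apply: le_trans (hf a) _.
  by rewrite subrr expr0n mulr0.
have gle z : `|f z / (z - a)| <= K * `|z - a|.
  have [->|za] := eqVneq z a; first by rewrite subrr invr0 mulr0 !normr0 mulr0.
  rewrite normrM normfV ler_pdivrMr ?normr_gt0 ?subr_eq0//.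
  by rewrite -mulrA -expr2 real_normK ?num_real.
exists (fun z => f z / (z - a)); split.
- move=> z; rewrite fa subr0; have [->|za] := eqVneq z a.
    by rewrite fa subrr mulr0.
  by rewrite divfK// subr_eq0.
- rewrite /prop_for /continuous_at subrr invr0 mulr0.
  apply/cvgrPdist_lt => e e0; near=> z.
  rewrite sub0r normrN; apply: le_lt_trans (gle z) _.
  apply: (@le_lt_trans _ _ ((K + 1) * `|z - a|)); first by rewrite ler_wpM2r ?lerDl.
  rewrite -ltr_pdivlMl ?ltr_wpDl//; near: z.
  apply: cvgr_distC_lt => //; rewrite mulr_gt0// invr_gt0 ltr_wpDl//.
- by rewrite subrr invr0 mulr0.
Unshelve. all: by end_near. Qed.

(** For w = 1/u one has w' = - (1 - 2x) w^2, so differentiating P w^m exp(-w) gives w^(m+2) exp(-w)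
    times P' u^2 + P (1 - 2x) (1 - m u). *)
Definition bump_deriv_poly P m : {poly R} :=
  P^`() * ('X * (1 - 'X)) ^+ 2 + P * (1 - 'X *+ 2) * (1 - ('X * (1 - 'X)) *+ m).

Lemma bump_out P m x : ~~ ((0 < x) && (x < 1)) -> bump P m x = 0.
Proof. by rewrite /bump => /negbTE ->. Qed.

Lemma is_derive_bump P m x :
  is_derive x 1 (bump P m) (bump (bump_deriv_poly P m) m.+2 x).
Proof.
have [K K0 hK] := bump_le P m.
(* At a point x outside ]0, 1[ the function vanishes, and z (1 - z) <= |z - x| for every z in ]0,
   1[, so the bound in u^2 is a bound in (z - x)^2. *)
have [x01|x01] := boolP ((0 < x) && (x < 1)); last first.
  rewrite (bump_out _ _ x01).
  have [x0|x0] := leP x 0; last first.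
    have x1 : 1 <= x by move: x01; rewrite x0 /= -leNgt.
    apply: (@is_derive_sq_bound _ x K K0) => z.
    have [/andP[z0 z1]|z01] := boolP ((0 < z) && (z < 1)); last first.
      by rewrite (bump_out _ _ z01) normr0 mulr_ge0 ?sqr_ge0.
    apply: le_trans (hK z) _; rewrite ler_wpM2l// -[leRHS]sqrrN opprB.
    rewrite ler_sqr ?nnegrE; [nra|by rewrite mulr_ge0 ?subr_ge0 ?ltW|lra].
  apply: (@is_derive_sq_bound _ x K K0) => z.
  have [/andP[z0 z1]|z01] := boolP ((0 < z) && (z < 1)); last first.
    by rewrite (bump_out _ _ z01) normr0 mulr_ge0 ?sqr_ge0.
  apply: le_trans (hK z) _; rewrite ler_wpM2l//.
  rewrite ler_sqr ?nnegrE; [nra|by rewrite mulr_ge0 ?subr_ge0 ?ltW|lra].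
have /andP[x0 x1] := x01.
have u0 : x * (1 - x) != 0 by rewrite gt_eqF// mulr_gt0// subr_gt0.
pose w y : R := (y * (1 - y))^-1.
have dw : is_derive x 1 w (- (1 - x *+ 2) * w x ^+ 2).
  have du : is_derive x 1 (fun y : R => y * (1 - y)) (1 - x *+ 2).
    apply: is_derive_eq; rewrite /GRing.scale /=; ring.
  apply: (is_derive_eq (is_deriveV (f := fun y : R => y * (1 - y)) u0 du)).
  by rewrite /GRing.scale /= /w exprVn mulNr mulrC mulrN.
apply: (@near_eq_is_derive _ _ _ (fun y => P.[y] * w y ^+ m * expR (- w y))).
  near=> y; rewrite /bump ifT//; apply/andP; split; near: y.
    exact: lt_nbhsr. 
  exact: lt_nbhsl.
have dP := is_derive_poly P x.
have dwm := is_deriveX m dw; rewrite exprfctE in dwm.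
have dew : is_derive x 1 (fun y => expR (- w y)) (expR (- w x) * - (- (1 - x *+ 2) * w x ^+ 2)).
  exact: (is_derive1_comp (f := expR) (is_derive_expR _) (is_deriveN dw)).
apply: (is_derive_eq (is_deriveM (is_deriveM dP dwm) dew)).
have hpoly : (bump_deriv_poly P m).[x] = P^`().[x] * (x * (1 - x)) ^+ 2 +
    P.[x] * (1 - x *+ 2) * (1 - x * (1 - x) * m%:R).
  have h1 : (1 - 'X : {poly R}).[x] = 1 - x.
    by rewrite hornerD hornerN hornerX -[1]/(1%:P) hornerC.
  have h2 : (1 - 'X *+ 2 : {poly R}).[x] = 1 - x *+ 2.
    by rewrite hornerD hornerN hornerMn hornerX -[1]/(1%:P) hornerC.
  have h3 : (1 - ('X * (1 - 'X)) *+ m : {poly R}).[x] = 1 - x * (1 - x) * m%:R.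
    by rewrite hornerD hornerN hornerMn hornerM h1 hornerX -[1]/(1%:P) hornerC mulr_natr.
  by rewrite hornerD !hornerM h1 h2 h3 hornerX.
have xu : x * (1 - x) = (w x)^-1 by rewrite /w invrK.
(* Rewrites the truncated exponent [m.-1] as a division by [w x]; at m = 0 the factor [m%:R] makes
   both sides 0. *)
have wm : m%:R * w x ^+ m.-1 = m%:R * w x ^+ m / w x.
  have w0 : w x != 0 by rewrite invr_eq0.
  case: (m) => [|k]; first by rewrite !mul0r.
  by rewrite /= exprSr mulrA mulfK.
rewrite /bump x01 hpoly /GRing.scale /= -/(w x) xu wm !exprS.
rewrite [(horner P * _) x]/=.
have w0 : w x != 0 by rewrite invr_eq0.
rewrite [(GRing.mul (horner P) _) x]/GRing.mul /=.
move: (w x) w0 (w x ^+ m) (expR _) P.[x] P^`().[x] => q q0 a e p p'.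
by field.
Unshelve. all: by end_near. Qed.

End Bump.

Lemma itv_measure_lty (R : realType) (a b : R) (x y : bool) :
  (lebesgue_measure [set` Interval (BSide x a) (BSide y b)] < +oo)%E.
Proof.
rewrite lebesgue_measure_itv /=; case: ifP => _; last by rewrite ltry.
by rewrite -EFinB ltry.
Qed.

Lemma is_derive_derivable (R : realType) (f : R -> R) (x d : R) :
  is_derive x 1 f d -> derivable f x 1.
Proof. by case. Qed.

Lemma is_derive_derive1 (R : realType) (f : R -> R) (x d : R) :
  is_derive x 1 f d -> derive1 f x = d.
Proof. by case=> _ <-; rewrite derive1E. Qed.

Section SmoothStep.
Variable R : realType.
Local Notation mu := (@lebesgue_measure R).
Local Notation b := (@bump R 1 0).
Implicit Types (x y e s t r T : R).

Lemma bump_half_gt0 : 0 < b (2^-1).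
Proof.
rewrite /bump ifT; last by apply/andP; split; lra.
by rewrite hornerC expr0 !mul1r expR_gt0.
Qed.

Lemma bump_ge0 x : 0 <= b x.
Proof.
rewrite /bump; case: ifP => // _.
by rewrite hornerC expr0 !mul1r expR_ge0.
Qed.

Lemma bump_le1 x : b x <= 1.
Proof.
rewrite /bump; case: ifP => // /andP[x0 x1].
rewrite hornerC expr0 !mul1r -[leRHS]expR0 ler_expR oppr_le0 invr_ge0.
by rewrite mulr_ge0 ?subr_ge0 ?ltW.
Qed.

Lemma bump_continuous P m : continuous (@bump R P m).
Proof.
move=> x; have [/derivable1_diffP/differentiable_continuous h _] := is_derive_bump P m x.
exact: h.
Qed.

Lemma bump_measurable P m : measurable_fun setT (@bump R P m).
Proof. by apply: continuous_measurable_fun; exact: bump_continuous. Qed.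

Lemma bump_integrable : mu.-integrable setT (EFin \o b).
Proof.
have h : mu.-integrable `[0, 1] (EFin \o b).
  apply: measurable_bounded_integrable => //.
  - exact: itv_measure_lty.
  - by apply: measurable_funTS; exact: bump_measurable.
  - exists 1; split; first exact: num_real.
    move=> M M1 x _; rewrite /= ger0_norm ?bump_ge0//.
    exact: le_trans (bump_le1 x) (ltW M1).
move: h; rewrite integrable_mkcond//; apply: eq_integrable => //= x _.
rewrite patchE; case: ifPn => // /negP x01; apply/esym/congr1/bump_out.
apply/negP => /andP[x0 x1]; apply: x01.
by rewrite inE /= in_itv /= (ltW x0) (ltW x1).
Qed.

(** A smooth transition from 0 to the total mass of the bump, left unnormalized: the constant
    [step 1] is carried along and cancelled at the end of the du Bois-Reymond lemma. *)
Definition step (x : R) : R := \int[mu]_(t in `]-oo, x]) b t.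

Lemma is_derive_step x : is_derive x 1 step (b x).
Proof.
have xu : x < x + 1 by rewrite ltrDl.
have fi : mu.-integrable [set` Interval -oo%O (BRight (x + 1))] (EFin \o b).
  by apply: (integrableS _ _ _ bump_integrable).
have [|d1 d2] := continuous_FTC1 xu fi _ (@bump_continuous 1 0 x); first by rewrite ltNyr.
constructor; first exact: d1.
by rewrite -derive1E; exact: d2.
Qed.

Lemma step0 x : x <= 0 -> step x = 0.
Proof.
move=> x0; rewrite /step /Rintegral integral0_eq// => t /=.
rewrite in_itv /= => tx; congr EFin; apply: bump_out.
by rewrite ltNge (le_trans tx x0).
Qed.

Lemma step1 x : 1 <= x -> step x = step 1.
Proof.
have h y : 1 <= y -> step y = \int[mu]_(t in setT) b t.
  move=> y1; rewrite /step Rintegral_mkcond; apply: eq_Rintegral => t _.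
  rewrite patchE; case: ifPn => // /negP ty; apply/esym/bump_out.
  apply/negP => /andP[_ t1]; apply: ty.
  by rewrite inE /= in_itv /= (le_trans (ltW t1)).
by move=> x1; rewrite (h 1)// h.
Qed.

Lemma step_le x y : x <= y -> step x <= step y.
Proof.
move=> xy; rewrite /step /Rintegral fine_le//.
- apply: integrable_fin_num => //; by apply: (integrableS _ _ _ bump_integrable).
- apply: integrable_fin_num => //; by apply: (integrableS _ _ _ bump_integrable).
- apply: ge0_subset_integral => //.
  + apply/measurable_EFinP; by apply: measurable_funTS; exact: bump_measurable.
  + by move=> t _; rewrite lee_fin bump_ge0.
  + by move=> t /=; rewrite !in_itv /= => /le_trans; apply.
Qed.

Lemma step_ge0 x : 0 <= step x.
Proof. by apply: Rintegral_ge0 => t _; exact: bump_ge0. Qed.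

Lemma step_le1 x : step x <= step 1.
Proof.
by have [/ltW x1|x1] := ltP x 1; [exact: step_le|rewrite step1].
Qed.

(** Otherwise [step] would be identically 0, whereas its derivative at 1/2 is positive. *)
Lemma step1_gt0 : 0 < step 1.
Proof.
rewrite lt_def step_ge0 andbT; apply/eqP => s1.
have s0 : step = cst 0.
  by apply/funext => x; apply/eqP; rewrite eq_le step_ge0 -s1 step_le1.
have := is_derive_derive1 (is_derive_step (2^-1)); rewrite s0 derive1_cst.
by move/eqP; rewrite lt_eqF// bump_half_gt0.
Qed.

(* [step ((r - s) / e) - step ((r - t) / e)] is a smooth approximation of
   [step 1] times the indicator of [`]s, t]], and [e^-1 bump ((r - s) / e)] of
   [step 1] times the Dirac mass at [s]. *)
Definition plateau (e s t r : R) := step ((r - s) / e) - step ((r - t) / e).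
Definition spike (e s r : R) := e^-1 * b ((r - s) / e).

Lemma is_derive_affine (f : R -> R) (d e s x : R) :
  is_derive ((x - s) / e) 1 f d -> is_derive x 1 (fun r => f ((r - s) / e)) (e^-1 * d).
Proof.
move=> fd; have h : is_derive x 1 (fun r : R => (r - s) / e) e^-1.
  by apply: is_derive_eq; rewrite /GRing.scale /=; ring.
rewrite mulrC.
exact: (is_derive1_comp (f := f) (g := fun r : R => (r - s) / e) fd h).
Qed.

Lemma is_derive_sub (f g : R -> R) (df dg x : R) :
  is_derive x 1 f df -> is_derive x 1 g dg ->
  is_derive x 1 (fun r => f r - g r) (df - dg).
Proof. by move=> hf hg; exact: is_deriveB. Qed.

(** The invariant for the induction on the order of differentiation: it holds for the first
    derivative of a plateau and is preserved by differentiation. *)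
Definition plateau_class e s t (h : R -> R) := exists P1 m1 P2 m2,
  h = fun r => bump P1 m1 ((r - s) / e) - bump P2 m2 ((r - t) / e).

Lemma bump_scale (c : R) P m x : c * bump P m x = bump (c *: P) m x.
Proof.
by rewrite /bump; case: ifP => _; rewrite ?mulr0// hornerZ !mulrA.
Qed.

Lemma plateau_class_derive e s t h : plateau_class e s t h ->
  exists2 h', plateau_class e s t h' & forall x, is_derive x 1 h (h' x).
Proof.
move=> [P1 [m1 [P2 [m2 ->]]]].
eexists; last first.
  by move=> x; apply: is_derive_sub; apply: is_derive_affine; exact: is_derive_bump.
rewrite /plateau_class; exists (e^-1 *: bump_deriv_poly P1 m1), m1.+2.
exists (e^-1 *: bump_deriv_poly P2 m2), m2.+2.
by apply/funext => r; rewrite !bump_scale.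
Qed.

Lemma is_derive_plateau e s t x :
  is_derive x 1 (plateau e s t) (spike e s x - spike e t x).
Proof.
by apply: is_derive_sub; apply: is_derive_affine; exact: is_derive_step.
Qed.

Lemma derive1_plateau e s t :
  derive1 (plateau e s t) = fun x => spike e s x - spike e t x.
Proof.
by apply/funext => x; rewrite (is_derive_derive1 (is_derive_plateau e s t x)).
Qed.

Lemma plateau_smooth e s t n x : derivable (derive1n n (plateau e s t)) x 1.
Proof.
case: n => [|n]; first exact: (is_derive_derivable (is_derive_plateau e s t x)).
suff [h Ch E] : exists2 h, plateau_class e s t h & derive1n n.+1 (plateau e s t) = h.
  have [h' _ dh] := plateau_class_derive Ch.
  by rewrite E; exact: (is_derive_derivable (dh x)).
elim: n => [|n [h Ch E]].
  exists (fun x => spike e s x - spike e t x); last by rewrite derive1n1 derive1_plateau.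
  exists (e^-1 *: 1), 0, (e^-1 *: 1), 0; apply/funext => r.
  by rewrite /spike !bump_scale.
have [h' Ch' dh] := plateau_class_derive Ch.
exists h' => //; rewrite derive1nS E.
by apply/funext => y; rewrite (is_derive_derive1 (dh y)).
Qed.

Lemma plateau_test e s t T : 0 < e -> 0 < s -> s < t -> t + e < T ->
  test_function T (plateau e s t).
Proof.
move=> e0 s0 st tT; split; first by move=> n x; exact: plateau_smooth.
exists s, (t + e); split => // r; rewrite in_itv /= => /nandP[].
  rewrite -ltNge => rs; rewrite /plateau !step0 ?subrr//.
    by rewrite ler_pdivrMr// mul0r subr_le0 ltW// (lt_trans rs).
  by rewrite ler_pdivrMr// mul0r subr_le0 ltW.
rewrite -ltNge => rt; rewrite /plateau !step1 ?subrr//.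
  by rewrite ler_pdivlMr// mul1r; lra.
by rewrite ler_pdivlMr// mul1r; lra.
Qed.

Lemma spike_ge0 e s r : 0 < e -> 0 <= spike e s r.
Proof. by move=> e0; rewrite mulr_ge0 ?bump_ge0// invr_ge0 ltW. Qed.

Lemma spike_out e s r : 0 < e -> ~~ (s < r < s + e) -> spike e s r = 0.
Proof.
move=> e0 hr; rewrite /spike bump_out ?mulr0//.
by rewrite ltr_pdivlMr// mul0r subr_gt0 ltr_pdivrMr// mul1r ltrBlDl.
Qed.

Lemma spike_le e s r : 0 < e -> spike e s r <= e^-1.
Proof. by move=> e0; rewrite /spike ler_piMr ?bump_le1// invr_ge0 ltW. Qed.

Lemma spike_measurable e s : measurable_fun setT (spike e s).
Proof.
apply: measurable_funM; first exact: measurable_cst.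
apply: (measurableT_comp (bump_measurable _ _)).
apply: measurable_funM; last exact: measurable_cst.
by apply: measurable_funB => //; exact: measurable_cst.
Qed.

Lemma spike_integral e s T : 0 < e -> 0 < s -> s + e < T ->
  \int[mu]_(r in `]0, T[) spike e s r = step 1.
Proof.
move=> e0 s0 sT.
have T0 : 0 < T by lra.
pose G r := step ((r - s) / e).
have dG x : is_derive x 1 G (spike e s x).
  by apply: is_derive_affine; exact: is_derive_step.
have cG : continuous G.
  by move=> x; have [/derivable1_diffP/differentiable_continuous h _] := dG x.
have cs : continuous (spike e s).
  move=> x; have dh : is_derive x 1 (spike e s)
     (e^-1 * (e^-1 * bump (bump_deriv_poly 1 0) 2 ((x - s) / e))).
    have h := is_derive_affine (is_derive_bump 1 0 ((x - s) / e)).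
    by have := is_deriveZ e^-1 h.
  by have [/derivable1_diffP/differentiable_continuous h _] := dh.
have := @continuous_FTC2 R (spike e s) G 0 T T0 (continuous_subspaceT cs).
move=> /(_ _ _)/wrap[].
- split.
  + by move=> x _; exact: (is_derive_derivable (dG x)).
  + exact: cvg_at_right_filter (cG 0).
  + exact: cvg_at_left_filter (cG T).
- by move=> x _; rewrite (is_derive_derive1 (dG x)).
move=> h.
rewrite /Rintegral -(@integral_itv_bndoo _ _ _ _ true false) ?h.
  have -> : G 0 = 0.
    by rewrite /G step0// ler_pdivrMr// mul0r sub0r oppr_le0 ltW.
  have -> : G T = step 1 by rewrite /G step1// ler_pdivlMr// mul1r; lra.
  by rewrite /= subr0.
by apply/measurable_EFinP; apply: measurable_funTS; exact: spike_measurable.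
Qed.

End SmoothStep.

Section DuBoisReymond.
Variable R : realType.
Local Notation mu := (@lebesgue_measure R).
Implicit Types (p q : R -> R) (e s t r T K eta : R).

Lemma spike_integrable p e s T K : 0 < e ->
  measurable_fun `]0, T[ p -> 0 <= K ->
  (forall r, s < r < s + e -> `|p r| <= K) ->
  mu.-integrable `]0, T[ (fun r => (spike e s r * p r)%:E).
Proof.
move=> e0 mp K0 pK.
apply: (@measurable_bounded_integrable _ _ R mu (fun r => spike e s r * p r)) => //.
- exact: itv_measure_lty.
- by apply: measurable_funM => //; apply: measurable_funTS; exact: spike_measurable.
- exists (e^-1 * K); split; first exact: num_real.
  move=> M KM r _ /=; apply: le_trans (ltW KM); rewrite normrM.
  have [sr|sr] := boolP (s < r < s + e); last first.
    by rewrite spike_out// normr0 mul0r mulr_ge0// invr_ge0 ltW.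
  rewrite ler_pM//; last exact: pK.
  by rewrite ger0_norm ?spike_ge0// spike_le.
Qed.

Lemma spike_mean p e s T eta : 0 < e -> 0 < s -> s + e < T ->
  measurable_fun `]0, T[ p ->
  (forall r, s < r < s + e -> `|p r - p s| <= eta) ->
  `|\int[mu]_(r in `]0, T[) (spike e s r * p r) - step 1 * p s| <=
  step 1 * eta.
Proof.
move=> e0 s0 sT mp peta.
have eta0 : 0 <= eta.
  have : s < s + e / 2 < s + e by apply/andP; split; lra.
  by move=> /peta; apply: le_trans.
have ic (k : R) : mu.-integrable `]0, T[ (fun r => (spike e s r * k)%:E).
  by apply: (@spike_integrable (fun=> k) _ _ _ `|k|) => //; exact: measurable_cst.
have ip : mu.-integrable `]0, T[ (fun r => (spike e s r * p r)%:E).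
  apply: (@spike_integrable _ _ _ _ (`|p s| + eta)) => //; first by rewrite addr_ge0.
  move=> r /peta h; rewrite -[p r](subrK (p s)) addrC.
  by rewrite (le_trans (ler_normD _ _))// lerD2l.
have Ic (k : R) : \int[mu]_(r in `]0, T[) (spike e s r * k) = step 1 * k.
  rewrite RintegralZr//; first by rewrite spike_integral.
  by have := ic 1; apply: eq_integrable => // r _; rewrite mulr1.
rewrite ler_norml; apply/andP; split.
- rewrite lerBrDl -mulrN -mulrDr -Ic; apply: le_Rintegral => //; first exact: ic.
  move=> r _; have [sr|sr] := boolP (s < r < s + e); last first.
    by rewrite spike_out// !mul0r.
  rewrite ler_wpM2l ?spike_ge0//; have := peta r sr; rewrite ler_norml; lra.
- rewrite lerBlDl -mulrDr -Ic; apply: le_Rintegral => //; first exact: ic.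
  move=> r _; have [sr|sr] := boolP (s < r < s + e); last first.
    by rewrite spike_out// !mul0r.
  rewrite ler_wpM2l ?spike_ge0//; have := peta r sr; rewrite ler_norml; lra.
Qed.

Lemma plateau_abs e s t r : s < t -> 0 < e -> `|plateau e s t r| <= step 1.
Proof.
move=> st e0; rewrite /plateau ger0_norm.
  by have := step_le1 ((r - s) / e); have := step_ge0 ((r - t) / e); lra.
rewrite subr_ge0; apply: step_le.
by rewrite ler_wpM2r ?invr_ge0 ?(ltW e0)// lerD2l lerN2 ltW.
Qed.

(** At each r both steps eventually saturate, so the sequence is eventually constant. Since [step]
    vanishes at 0, the limit is 0 at s and [step 1] at t, whence the half-open interval. *)
Lemma plateau_cvg (e : nat -> R) s t r : s < t -> (forall n, 0 < e n) ->
  e n @[n --> \oo] --> (0 : R) ->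
  plateau (e n) s t r @[n --> \oo] --> step 1 * \1_(`]s, t]) r.
Proof.
move=> st e0 ecv.
have ev d : 0 < d -> exists N, forall n, (N <= n)%N -> e n < d.
  move=> d0; have /cvg_seqP/(_ d d0)[N hN] := ecv.
  by exists N => n /hN; rewrite subr0; apply: le_lt_trans; exact: ler_norm.
apply/cvg_seqP => eta eta0; rewrite indicE.
suff [N hN] : exists N, forall n, (N <= n)%N ->
    plateau (e n) s t r = step 1 * ((r \in `]s, t]%classic) : bool)%:R.
  by exists N => n /hN ->; rewrite subrr normr0.
rewrite mem_setE in_itv /=.
have small d n : 0 < d -> e n < d -> step (d / e n) = step 1.
  by move=> d0 en; rewrite step1// ler_pdivlMr// mul1r ltW.
have neg d n : d <= 0 -> step (d / e n) = 0.
  by move=> d0; rewrite step0// ler_pdivrMr// mul0r.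
have [rs|sr] := leP r s.
  exists 0%N => n _; rewrite mulr0 /plateau !neg ?subrr//; lra.
have [rt|tr] := leP r t.
  have [|N hN] := ev (r - s); first by rewrite subr_gt0.
  exists N => n /hN en; rewrite mulr1 /plateau small ?subr_gt0// neg ?subr0//; lra.
have [|N hN] := ev (r - t); first by rewrite subr_gt0.
exists N => n /hN en; rewrite mulr0 /plateau !small ?subrr//; lra.
Qed.

(** Test with plateaus from s to t whose ramps shrink. The derivative is a spike at s minus a spike
    at t and produces [step 1] times p(s) - p(t) by continuity, while the plateau converges
    boundedly to [step 1] on ]s, t]. *)
Lemma du_bois_reymond T p q :
  (forall s, 0 < s < T -> {for s, continuous p}) ->
  mu.-integrable `]0, T[ (EFin \o q) ->
  (forall phi, test_function T phi ->
    \int[mu]_(t in `]0, T[) (derive1 phi t * p t) =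
    - \int[mu]_(t in `]0, T[) (phi t * q t)) ->
  forall s t, 0 < s -> s < t -> t < T ->
  p t - p s = \int[mu]_(r in `]s, t]) q r.
Proof.
move=> cp iq weak s t s0 st tT.
have mp : measurable_fun `]0, T[ p.
  apply: open_continuous_measurable_fun => // r; rewrite inE /= in_itv /=; exact: cp.
(* The factor (T - t) / 2 keeps t + [e n] below T, so that every plateau has its support inside ]0,
   T[. *)
pose e n := (T - t) / 2 * harmonic n.
have e0 n : 0 < e n by rewrite mulr_gt0// ?divr_gt0 ?subr_gt0// /harmonic invr_gt0.
have eT n : t + e n < T.
  have : e n <= (T - t) / 2.
    rewrite ler_piMr//; last by rewrite /harmonic /= invf_le1 ?ltr0n// ler1n.
    by rewrite divr_ge0 ?subr_ge0 ?ltW.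
  lra.
have ecv : e n @[n --> \oo] --> (0 : R).
  by rewrite -[X in _ --> X](mulr0 ((T - t) / 2)); apply: cvgMl_tmp; exact: cvg_harmonic.
have s1 := step1_gt0 R.
have spk s' eta : 0 < s' -> s' <= t -> 0 < eta -> exists N, forall n, (N <= n)%N ->
    mu.-integrable `]0, T[ (fun r => (spike (e n) s' r * p r)%:E) /\
    `|\int[mu]_(r in `]0, T[) (spike (e n) s' r * p r) - step 1 * p s'| < eta.
  move=> s'0 s't eta0.
  have s'T n : s' + e n < T by apply: le_lt_trans (eT n); rewrite lerD2r.
  have : {for s', continuous p} by apply: cp; rewrite s'0 (le_lt_trans s't).
  move=> /cvgrPdist_le/(_ (eta / (2 * step 1))).
  rewrite divr_gt0 ?mulr_gt0// => /(_ isT)[d /= d0 hd].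
  have /cvg_seqP/(_ d d0)[N hN] := ecv.
  exists N => n /hN; rewrite subr0 gtr0_norm// => en.
  have hp r : s' < r < s' + e n -> `|p r - p s'| <= eta / (2 * step 1).
    move=> /andP[r1 r2]; rewrite distrC; apply: hd => /=.
    rewrite distrC gtr0_norm ?subr_gt0//.
    by rewrite ltrBlDl (lt_trans r2)// ltrD2l.
  split.
    apply: (@spike_integrable _ _ _ _ (`|p s'| + eta / (2 * step 1))) => //.
      by rewrite addr_ge0// divr_ge0 ?mulr_ge0 ?ltW.
    move=> r /hp h; rewrite -[p r](subrK (p s')) addrC.
    by rewrite (le_trans (ler_normD _ _))// lerD2l.
  apply: (@le_lt_trans _ _ (step 1 * (eta / (2 * step 1)))).
    exact: (spike_mean (e0 n) s'0 (s'T n) mp hp).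
  by rewrite (_ : _ * _ = eta / 2); [lra|field; rewrite gt_eqF].
have lhs : \int[mu]_(r in `]0, T[) (derive1 (plateau (e n) s t) r * p r)
     @[n --> \oo] --> step 1 * p s - step 1 * p t.
  have tri (a b x y eta : R) : `|a - x| < eta / 2 -> `|b - y| < eta / 2 ->
      `|(a - b) - (x - y)| < eta by rewrite !ltr_norml; lra.
  apply/cvg_seqP => eta eta0; have eta2 : 0 < eta / 2 by rewrite divr_gt0.
  have [N hN] := spk s _ s0 (ltW st) eta2.
  have [N' hN'] := spk t _ (lt_trans s0 st) (lexx t) eta2.
  exists (maxn N N') => n; rewrite geq_max => /andP[/hN[i1 h1] /hN'[i2 h2]].
  rewrite (_ : \int[mu]_(r in _) _ = \int[mu]_(r in `]0, T[) (spike (e n) s r * p r) -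
      \int[mu]_(r in `]0, T[) (spike (e n) t r * p r)); last first.
    rewrite -RintegralB//; apply: eq_Rintegral => r _.
    by rewrite derive1_plateau mulrBl.
  exact: tri.
pose g r := step 1 * \1_(`]s, t]) r * q r.
have mq : measurable_fun `]0, T[ q.
  by apply/measurable_EFinP; exact: measurable_int iq.
have mplateau n : measurable_fun setT (plateau (e n) s t).
  apply: continuous_measurable_fun => x.
  by have [/derivable1_diffP/differentiable_continuous h _] :=
    is_derive_plateau (e n) s t x.
pose D := `]0, T[%classic.
have [ig _ hcv] : [/\ mu.-integrable D (fun r => (g r)%:E),
    [sequence \int[mu]_(r in D)
       `|(plateau (e n) s t r * q r)%:E - (g r)%:E|]_n @ \oo --> 0 &
    [sequence \int[mu]_(r in D) (plateau (e n) s t r * q r)%:E]_n @ \oo -->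
      \int[mu]_(r in D) (g r)%:E]%E.
  apply: (@dominated_convergence _ _ R mu _ _ _ _ (fun r => (step 1 * `|q r|)%:E)).
  - exact: measurable_itv.
  - move=> n; apply/measurable_EFinP; apply: measurable_funM => //.
    by apply: measurable_funTS; exact: mplateau.
  - apply/measurable_EFinP; apply: measurable_funM => //.
    apply: measurable_funM; first exact: measurable_cst.
    by apply: measurable_funTS; exact: measurable_indic.
  - apply: nearW => r _; apply/cvg_EFin; first exact: nearW.
    apply: cvgM; last exact: cvg_cst.
    exact: plateau_cvg.
  - have := @integrableZl _ _ R mu D (measurable_itv _) (step 1) _ (integrable_abse iq).
    by apply: eq_integrable => [|r _]; [exact: measurable_itv|rewrite /= EFinM].
  - apply: nearW => r n _; rewrite /= lee_fin normrM ler_wpM2r//.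
    exact: plateau_abs.
have rhs : \int[mu]_(r in `]0, T[) (plateau (e n) s t r * q r) @[n --> \oo] -->
    step 1 * \int[mu]_(r in `]s, t]) q r.
  have -> : step 1 * \int[mu]_(r in `]s, t]) q r = \int[mu]_(r in `]0, T[) g r.
    rewrite [RHS](_ : _ = \int[mu]_(r in D) (step 1 * (q \_ (`]s, t])) r)); last first.
      apply: eq_Rintegral => r _; rewrite /g patchE indicE.
      by case: (r \in _); rewrite ?mulr1// mulr0 mul0r.
    have st_D : `]s, t]%classic `<=` D.
      move=> r; rewrite /D /= !in_itv /= => /andP[sr rt].
      by rewrite (lt_trans s0 sr) (le_lt_trans rt tT).
    have iq' : mu.-integrable D (EFin \o (q \_ (`]s, t]))).
      have [h _] := @integrable_restrict _ _ R mu `]s, t]%classic (measurable_itv _)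
        D (measurable_itv _) (EFin \o q).
      rewrite (setIidr st_D) in h.
      have {h} := h (@integrableS _ _ R mu D `]s, t]%classic (EFin \o q)
        (measurable_itv _) (measurable_itv _) st_D iq).
      apply: eq_integrable => [|r _]; first exact: measurable_itv.
      by rewrite /= !patchE; case: ifP.
    rewrite RintegralZl//; last exact: measurable_itv.
    congr (_ * _).
    by rewrite -Rintegral_mkcondr (setIidr st_D).
  by apply: fine_cvg; rewrite fineK ?integrable_fin_num.
have lhs' : (- \int[mu]_(r in `]0, T[) (plateau (e n) s t r * q r))
     @[n --> \oo] --> step 1 * p s - step 1 * p t.
  apply: cvg_trans lhs; apply: near_eq_cvg; apply: nearW => n.
  by rewrite weak//; apply: plateau_test.
have E := cvg_unique (@Rhausdorff R) lhs' (cvgN rhs).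
by apply: (mulfI (lt0r_neq0 s1)); rewrite mulrBr -opprB E opprK.
Qed.

End DuBoisReymond.

(** * The energy bound *)

Section Evolution.
Variables (R : realType) (V H V' : completeNormedModType R).
Variables (ip : {dot H for idfun}) (pr : {bilinear V' -> V -> R | *%R & *%R}).
Variables (iV : {linear V -> H}) (iH : {linear H -> V'}).
Hypothesis hG : gelfand_triple ip pr iV iH.
Variables (A : {linear V -> V'}) (lambda1 lambda2 : R).
Hypothesis hA_sym : forall u v : V, pr (A u) v = pr (A v) u.
Hypothesis hlambda1 : 0 < lambda1.
Hypothesis hA_bounds : forall u : V,
       lambda1 * `|u| ^+ 2 <= pr (A u) u <= lambda2 * `|u| ^+ 2.
Variables (Rz : H -> V) (kappa : R).
Hypothesis hRz : forall k, A (Rz k) = iH k.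
Hypothesis kappa_gt0 : 0 < kappa.
Hypothesis hkappa : forall u, kappa * `|iV u| ^+ 2 <= energy_form pr A u u.

Local Notation mu := (@lebesgue_measure R).
Local Notation a := (energy_form pr A).
Local Notation B := (resolvent iV Rz).

Let hH : is_hilbert ip. Proof. by case: hG. Qed.

(* The pair [(v, f)] solves [(iV v)' + A v = f] on [`]0, T[], the function [y]
   being a representative of [iV v]. *)
Definition evolution (T : R) (y : R -> H) (v : R -> V) (f : R -> H) : Prop :=
  [/\ simple_limit v, simple_limit f,
      {ae mu, forall t, `]0, T[%classic t -> y t = iV (v t)} &
      forall theta, test_function T theta -> forall w : V,
        \int[mu]_(t in `]0, T[) (derive1 theta t * ip (y t) (iV w)) =
        - \int[mu]_(t in `]0, T[) (theta t * (ip (f t) (iV w) - a (v t) w))].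

Lemma ip_cvg (x : nat -> H) (l k : H) :
  x n @[n --> \oo] --> l -> ip (x n) k @[n --> \oo] --> ip l k.
Proof.
move=> xl; apply/(cvg_seqP (fun n => ip (x n) k) (ip l k)) => e e0.
have k1 : 0 < `|k| + 1 by rewrite ltr_wpDl.
have /cvg_seqP/(_ (e / (`|k| + 1)))[|N hN] := xl; first by rewrite divr_gt0.
exists N => n /hN h; rewrite -(formBl (ipP ip)).
apply: le_lt_trans (ip_le hH _ _) _.
apply: le_lt_trans (_ : `|x n - l| * (`|k| + 1) < e).
  by rewrite ler_wpM2l// lerDl.
by rewrite -ltr_pdivlMr.
Qed.

Lemma ip_cvg2 (x z : nat -> H) (l m : H) :
  x n @[n --> \oo] --> l -> z n @[n --> \oo] --> m ->
  ip (x n) (z n) @[n --> \oo] --> ip l m.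
Proof.
move=> xl zm.
have pol u w : ip u w = (`|u + w| ^+ 2 - `|u - w| ^+ 2) / 4.
  by rewrite !hH !(formE (ipC ip) (ipP ip)) (ipC ip w u); field.
rewrite pol (_ : (fun n => ip (x n) (z n)) =
  fun n => (`|x n + z n| ^+ 2 - `|x n - z n| ^+ 2) / 4); last first.
  by apply/funext => n; rewrite pol.
apply: cvgMr_tmp; apply: cvgB.
  by apply: cvgM; apply: cvg_norm; exact: cvgD.
by apply: cvgM; apply: cvg_norm; exact: cvgB.
Qed.

Lemma ip_continuous (y : R -> H) (k : H) : continuous y ->
  continuous (fun t => ip (y t) k).
Proof.
move=> cy t; apply/cvgrPdist_lt => e e0.
have k1 : 0 < `|k| + 1 by rewrite ltr_wpDl.
have := cy t; move=> /cvgrPdist_lt/(_ (e / (`|k| + 1))).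
rewrite divr_gt0// => /(_ isT); apply: filterS => r h.
rewrite -(formBl (ipP ip)); apply: le_lt_trans (ip_le hH _ _) _.
apply: le_lt_trans (_ : `|y t - y r| * (`|k| + 1) < e).
  by rewrite ler_wpM2l// lerDl.
by rewrite -ltr_pdivlMr.
Qed.

Lemma ip_measurable (f g : R -> H) : simple_limit f -> simple_limit g ->
  measurable_fun setT (fun t => ip (f t) (g t)).
Proof.
move=> sf sg; apply: (@simple_limit_measurable R (fun t => ip (f t) (g t))).
by apply: (simple_limit2 (h := fun u w : H => (ip u w : R^o))) => // u1 u2 l1 l2; exact: ip_cvg2.
Qed.

Lemma bounded_integrable (s t : R) (h : R -> R) (K : R) :
  measurable_fun setT h -> (forall r, `|h r| <= K) ->
  mu.-integrable `]s, t] (fun r => (h r)%:E).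
Proof.
move=> mh hK; apply: (@measurable_bounded_integrable _ _ R mu h) => //.
- exact: itv_measure_lty.
- exact: measurable_funTS.
- exists K; split; first exact: num_real.
  by move=> M KM r _ /=; exact: le_trans (hK r) (ltW KM).
Qed.

Lemma Rintegral_bound (s t : R) (h : R -> R) (K : R) : s <= t ->
  measurable_fun setT h -> (forall r, `|h r| <= K) ->
  \int[mu]_(r in `]s, t]) h r <= K * (t - s).
Proof.
move=> st mh hK.
apply: (@le_trans _ _ (\int[mu]_(r in `]s, t]) K)).
  apply: le_Rintegral => //; first exact: bounded_integrable mh hK.
    apply: (@bounded_integrable _ _ (cst K) `|K|) => //; exact: measurable_cst.
  by move=> r _; exact: le_trans (ler_norm _) (hK r).
rewrite Rintegral_cst//.
rewrite (_ : fine _ = t - s)//.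
have := @lebesgue_measure_itv R `]s, t]; rewrite /= lte_fin => ->.
by move: st; rewrite le_eqVlt => /orP[/eqP ->|->//]; rewrite ltxx subrr.
Qed.

Lemma Rintegral_bound_on (s t : R) (h : R -> R) (K : R) : s <= t ->
  measurable_fun setT h -> (forall r, s < r <= t -> `|h r| <= K) ->
  \int[mu]_(r in `]s, t]) h r <= K * (t - s).
Proof.
move=> st mh hK.
have [->|ts] := eqVneq s t.
  rewrite set_itvoc0 subrr mulr0 Rintegral_set0//.
have K0 : 0 <= K.
  have : s < t <= t by rewrite lexx lt_neqAle ts st.
  by move=> /hK; exact: le_trans.
rewrite (_ : \int[mu]_(r in `]s, t]) h r =
  \int[mu]_(r in `]s, t]) (\1_(`]s, t]) r * h r)); last first.
  by apply: eq_Rintegral => r rst; rewrite indicE rst mul1r.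
apply: Rintegral_bound => //.
  by apply: measurable_funM => //; exact: measurable_indic.
move=> r; rewrite indicE; have [rst|_] := boolP (r \in _).
  by rewrite mul1r hK//; move: rst; rewrite inE /= in_itv.
by rewrite mul0r normr0.
Qed.

(** Test the equation with w = [Rz k]. Then a(v, Rz k) = (y, k) almost everywhere, so v disappears,
    and the du Bois-Reymond lemma applies to the scalar function (y, B k). *)
Lemma evolution_resolvent T y v f M M0 : continuous y ->
  (forall t, `|f t| <= M) -> (forall t, `|y t| <= M0) ->
  evolution T y v f -> forall k s t, 0 < s -> s < t -> t < T ->
  ip (B (y t) - B (y s)) k = \int[mu]_(r in `]s, t]) (ip (f r) (B k) - ip (y r) k).
Proof.
move=> cy fM yM [sv sf yv weak] k s t s0 st tT.
have sB := resolvent_sym hG hA_sym hRz.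
rewrite (formBl (ipP ip)) !sB.
have mf : measurable_fun setT (fun r => ip (f r) (B k)).
  by apply: ip_measurable => //; exact: simple_limit_cst.
have my : measurable_fun setT (fun r => ip (y r) k).
  by apply: continuous_measurable_fun; exact: ip_continuous.
apply: (@du_bois_reymond R T (fun r => ip (y r) (B k))
   (fun r => ip (f r) (B k) - ip (y r) k)) => //.
- by move=> r _; exact: ip_continuous.
- apply: (@measurable_bounded_integrable _ _ R mu (fun r => ip (f r) (B k) - ip (y r) k)) => //.
  + exact: itv_measure_lty.
  + by apply: measurable_funTS; exact: measurable_funB.
  + exists (M * `|B k| + M0 * `|k|); split; first exact: num_real.
    move=> N hN r _ /=; apply: le_trans (ltW hN).
    apply: le_trans (ler_normB _ _) _; apply: lerD.
      by apply: le_trans (ip_le hH _ _) _; rewrite ler_wpM2r.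
    by apply: le_trans (ip_le hH _ _) _; rewrite ler_wpM2r.
- move=> theta ht; rewrite (weak _ ht (Rz k)); congr (- _).
  apply: ae_eq_Rintegral; apply: (ae_imply yv) => r h Dr.
  rewrite -/(B k) (energyC hA_sym) (energy_Rz hG hRz) -(h Dr).
  by rewrite (ipC ip k).
Qed.

Lemma resolvent_lipschitz T y v f M M0 : continuous y ->
  (forall t, `|f t| <= M) -> (forall t, `|y t| <= M0) ->
  evolution T y v f -> forall s t, 0 < s -> s < t -> t < T ->
  `|B (y t) - B (y s)| <= (M / kappa + M0) * (t - s).
Proof.
move=> cy fM yM ev s t s0 st tT.
have M_ge0 : 0 <= M by exact: le_trans (fM 0).
have M0_ge0 : 0 <= M0 by exact: le_trans (yM 0).
apply: (ip_bound hH).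
  by rewrite mulr_ge0 ?subr_ge0 ?(ltW st)// addr_ge0// divr_ge0// ltW.
move=> k; rewrite (evolution_resolvent cy fM yM ev)//.
rewrite mulrAC; apply: Rintegral_bound; first exact: ltW.
  apply: measurable_funB.
    by have [_ sf _ _] := ev; apply: ip_measurable => //; exact: simple_limit_cst.
  by apply: continuous_measurable_fun; exact: ip_continuous.
move=> r; apply: le_trans (ler_normB _ _) _; rewrite mulrDl; apply: lerD.
  apply: le_trans (ip_le hH _ _) _; rewrite -mulrA ler_pM//.
  have := resolvent_le hG hRz hkappa k.
  by rewrite ler_pdivlMl.
by apply: le_trans (ip_le hH _ _) _; rewrite ler_wpM2r.
Qed.

(** Subdivide [s, t] into equal steps shorter than d and add the bounds; it plays the part of
    integrating a nonpositive derivative, with differentiability of E replaced by a uniform bound on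
    small increments. *)
Lemma increment_const (E : R -> R) (s t : R) : s < t ->
  (forall e, 0 < e -> exists2 d, 0 < d & forall r r', s <= r -> r < r' ->
     r' <= t -> r' - r < d -> E r' - E r <= e * (r' - r)) ->
  E t <= E s.
Proof.
move=> st hE; rewrite -subr_le0; apply/ler_addgt0Pr => e e0; rewrite add0r.
have ts : 0 < t - s by rewrite subr_gt0.
have [|d d0 hd] := hE (e / (t - s)); first by rewrite divr_gt0.
have [n nlt] : exists n : nat, (t - s) / n.+1%:R < d.
  have /cvg_seqP/(_ (d / (t - s)))[|N hN] := @cvg_harmonic R.
    by rewrite divr_gt0.
  exists N; have := hN N (leqnn N); rewrite subr0 gtr0_norm ?invr_gt0//.
  by rewrite /harmonic ltr_pdivlMr// mulrC.
have n0 : (n.+1%:R : R) != 0 by rewrite pnatr_eq0.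
pose h := (t - s) / n.+1%:R.
have h0 : 0 < h by rewrite divr_gt0// ltr0n.
have ht : s + n.+1%:R * h = t by rewrite /h; field.
have step i : (i <= n.+1)%N -> E (s + i%:R * h) - E s <= e / (t - s) * (i%:R * h).
  elim: i => [_|i IH ile]; first by rewrite !mul0r addr0 subrr mulr0.
  have {}IH := IH (ltnW ile).
  have ih0 : (0 : R) <= i%:R by [].
  have ile' : i.+1%:R * h <= n.+1%:R * h by rewrite ler_wpM2r ?(ltW h0)// ler_nat.
  have := hd (s + i%:R * h) (s + i.+1%:R * h).
  rewrite -natr1 in ile' *.
  rewrite lerDl mulr_ge0 ?(ltW h0)// => /(_ isT).
  rewrite ltrD2l ltr_pM2r// ltrDl ltr01 => /(_ isT).
  have itt : s + (i%:R + 1) * h <= t by rewrite -ht lerD2l.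
  rewrite itt => /(_ isT).
  have -> : s + (i%:R + 1) * h - (s + i%:R * h) = h by ring.
  move=> /(_ nlt) h1; have := lerD h1 IH; rewrite subrKA.
  move=> h2; apply: le_trans h2 _; rewrite le_eqVlt; apply/orP; left.
  by apply/eqP; ring.
have := step n.+1 (leqnn _); rewrite ht.
by rewrite (_ : n.+1%:R * h = t - s) ?divfK ?gt_eqF// -ht; ring.
Qed.

Lemma Rintegral_add (s r t : R) (h : R -> R) (K : R) : s <= r -> r <= t ->
  measurable_fun setT h -> (forall r, `|h r| <= K) ->
  \int[mu]_(x in `]s, t]) h x =
  \int[mu]_(x in `]s, r]) h x + \int[mu]_(x in `]r, t]) h x.
Proof.
move=> sr rt mh hK.
have := @Rintegral_itvB R h (BRight s) (BRight t) r.
move=> /(_ (bounded_integrable _ _ mh hK)).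
rewrite !bnd_simp => /(_ sr rt) <-.
by rewrite addrC subrK.
Qed.

Local Notation Q := (Qop iV Rz kappa).
Local Notation S := (Sop iV Rz kappa).

(** Only f is approximated by simple functions. On each of the finitely many level sets of an
    approximant the product is that of z with a fixed vector. *)
Lemma ip_measurable_continuous (f z : R -> H) : simple_limit f ->
  continuous z -> measurable_fun setT (fun t => ip (f t) (z t)).
Proof.
move=> [s ss sf] cz.
apply: (measurable_fun_cvg (h := fun n t => ip (s n t) (z t))) => [n|t _]; last first.
  exact: ip_cvg (sf t).
have [fs ms] := ss n => _ Y mY; rewrite setTI.
rewrite (_ : _ @^-1` _ = \bigcup_(w in range (s n))
    ((s n @^-1` [set w]) `&` ((fun t => ip (z t) w) @^-1` Y))); last first.
  apply/seteqP; split => [t /= tY|t [w _ /= [-> tY]]]; last by rewrite (ipC ip).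
  by exists (s n t) => /=; [exists t|split => //; rewrite (ipC ip)].
apply: fin_bigcup_measurable => // w _; apply: measurableI; first exact: ms.
have mz : measurable_fun setT (fun t => ip (z t) w).
  by apply: continuous_measurable_fun; exact: ip_continuous.
by rewrite -[X in measurable X]setTI; exact: mz.
Qed.

Lemma ip_continuous2 (y z : R -> H) : continuous y -> continuous z ->
  continuous (fun t => ip (y t) (z t)).
Proof.
move=> cy cz.
have pol u w : ip u w = (`|u + w| ^+ 2 - `|u - w| ^+ 2) / 4.
  by rewrite !hH !(formE (ipC ip) (ipP ip)) (ipC ip w u); field.
rewrite (_ : (fun t => _) =
  fun t => (`|y t + z t| ^+ 2 - `|y t - z t| ^+ 2) / 4); last first.
  by apply/funext => t; rewrite pol.
move=> t; apply: cvgMr_tmp; apply: cvgB.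
  by apply: cvgM; apply: cvg_norm; apply: cvgD; [exact: cy|exact: cz|exact: cy|exact: cz].
by apply: cvgM; apply: cvg_norm; apply: cvgB; [exact: cy|exact: cz|exact: cy|exact: cz].
Qed.

Lemma lipschitz_continuous (y : R -> H) (X : H -> H) (C : R) : 0 <= C ->
  (forall k l, `|X k - X l| <= C * `|k - l|) -> continuous y ->
  continuous (fun t => X (y t)).
Proof.
move=> C0 hX cy t; apply/cvgrPdist_lt => e e0.
have C1 : 0 < C + 1 by rewrite ltr_wpDl.
have := cy t; move=> /cvgrPdist_lt/(_ (e / (C + 1))).
rewrite divr_gt0// => /(_ isT); apply: filterS => r h.
apply: le_lt_trans (hX _ _) _.
apply: le_lt_trans (_ : (C + 1) * `|y t - y r| < e).
  by rewrite ler_wpM2r// lerDl.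
by rewrite mulrC -ltr_pdivlMr.
Qed.

Lemma Sop_sub n k l : S n (k - l) = S n k - S n l.
Proof.
rewrite -[k - l]addrC -scaleN1r (SopP iV hlambda1 hA_bounds kappa hRz).
by rewrite scaleN1r addrC.
Qed.

(* The derivative of [(X y, y)], where [X = 1 - Q^n = kappa B S]. *)
Let rate n (y f : R -> H) (r : R) :=
  2 * (ip (f r) (y r - iter n Q (y r)) - kappa * ip (y r) (S n (y r))).

(** Over [r, r'] the increment of (X y, y) is the exact integral of the equation tested with the
    fixed vector y(r) + y(r'). Replacing that vector by 2 y(x) under the integral gives [rate], and
    uniform continuity of y makes the error small relative to r' - r, uniformly in r. The bound
    obtained does not depend on n. *)
Lemma evolution_energy n T y v f M M0 : continuous y ->
  (forall e, 0 < e -> exists2 d, 0 < d &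
     forall r r', `|r - r'| < d -> `|y r - y r'| < e) ->
  (forall t, `|f t| <= M) -> (forall t, `|y t| <= M0) ->
  evolution T y v f -> forall s t, 0 < s -> s < t -> t < T ->
  kappa * (\int[mu]_(r in `]s, t]) ip (S n (y r)) (y r)) <=
  M0 ^+ 2 * 2 + 2 * M * M0 * (t - s).
Proof.
move=> cy ucy fM yM ev s t s0 st tT.
have M_ge0 : 0 <= M by exact: le_trans (fM 0).
have M0_ge0 : 0 <= M0 by exact: le_trans (yM 0).
have [_ sf _ _] := ev.
pose X k := k - iter n Q k.
have Xsub k l : X (k - l) = X k - X l.
  rewrite /X -[k - l]addrC -scaleN1r (iter_QopP iV hlambda1 hA_bounds kappa hRz).
  by rewrite !scaleN1r [- l + k]addrC [- iter n Q l + _]addrC !opprD !opprK addrACA.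
have Xle k : `|X k| <= 2 * `|k|.
  apply: le_trans (ler_normB _ _) _.
  have := iter_Qop_le hG hA_sym hlambda1 hA_bounds hRz kappa_gt0 hkappa n k; lra.
have XB k : X k = kappa *: B (S n k).
  by rewrite (resolvent_Sop iV hlambda1 hA_bounds kappa hRz).
have Ssub := Sop_sub n.
have Sle k : `|S n k| <= n%:R * `|k|.
  exact: (Sop_le hG hA_sym hlambda1 hA_bounds hRz kappa_gt0 hkappa).
have Xsym k l : ip (X k) l = ip k (X l).
  rewrite /X !(formE (ipC ip) (ipP ip)); congr (_ - _).
  by apply: iter_contraction_sym => u w; exact: (Qop_sym hG hA_sym kappa hRz).
have Ssym k l : ip (S n k) l = ip k (S n l) := Sop_sym hG hA_sym kappa hRz n k l.
have rateE x : rate n y f x =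
    2 * (ip (f x) (X (y x)) - kappa * ip (y x) (S n (y x))) by [].
move: X Xsub Xle XB Xsym rateE => X Xsub Xle XB Xsym rateE.
have cX : continuous (fun r => X (y r)).
  by apply: (lipschitz_continuous (C := 2)) => // k l; rewrite -Xsub.
have cS : continuous (fun r => S n (y r)).
  by apply: (lipschitz_continuous (C := n%:R)) => // k l; rewrite -Ssub.
have mX : measurable_fun setT (fun r => ip (f r) (X (y r))).
  exact: ip_measurable_continuous.
have mS : measurable_fun setT (fun r => ip (y r) (S n (y r))).
  by apply: continuous_measurable_fun; exact: ip_continuous2.
have bX r : `|ip (f r) (X (y r))| <= M * (2 * M0).
  apply: le_trans (ip_le hH _ _) _; apply: ler_pM => //.
  by apply: le_trans (Xle _) _; rewrite ler_wpM2l.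
have bS r : `|ip (y r) (S n (y r))| <= M0 * (n%:R * M0).
  apply: le_trans (ip_le hH _ _) _; apply: ler_pM => //.
  by apply: le_trans (Sle _) _; rewrite ler_wpM2l.
have mfk k : measurable_fun setT (fun r => ip (f r) k).
  by apply: ip_measurable => //; exact: simple_limit_cst.
have myk k : measurable_fun setT (fun r => ip (y r) k).
  by apply: continuous_measurable_fun; exact: ip_continuous.
have mhk k l : measurable_fun setT (fun r => ip (f r) k - kappa * ip (y r) l).
  apply: measurable_funB; first exact: mfk.
  by apply: measurable_funM; [exact: measurable_cst|exact: myk].
have bfk k r : `|ip (f r) k| <= M * `|k|.
  by apply: le_trans (ip_le hH _ _) _; rewrite ler_wpM2r.
have byk k r : `|ip (y r) k| <= M0 * `|k|.
  by apply: le_trans (ip_le hH _ _) _; rewrite ler_wpM2r.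
pose D r := ip (X (y r)) (y r).
have incr r r' : 0 < r -> r < r' -> r' < T -> D r' - D r =
    \int[mu]_(x in `]r, r']) (ip (f x) (X (y r' + y r)) -
                              kappa * ip (y x) (S n (y r' + y r))).
  move=> r0 rr' r'T; set k := y r' + y r.
  (* By symmetry of X the increment of the quadratic form is (X (y r' - y r), y r' + y r), and X =
     kappa B S brings in the increment of B y. *)
  have -> : D r' - D r = kappa * ip (B (y r') - B (y r)) (S n k).
    have -> : D r' - D r = ip (X (y r' - y r)) k.
      rewrite Xsub /k /D !(formE (ipC ip) (ipP ip)).
      by rewrite (Xsym (y r') (y r)) (ipC ip (y r') (X _)); ring.
    rewrite Xsym XB (formZr (ipC ip) (ipP ip)); congr (_ * _).
    rewrite -(resolvent_sub iV hlambda1 hA_bounds hRz).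
    by rewrite (resolvent_sym hG hA_sym hRz).
  rewrite (evolution_resolvent cy fM yM ev)//.
  rewrite -RintegralZl//; last first.
    apply: (@bounded_integrable _ _ _ (M * `|B (S n k)| + M0 * `|S n k|)).
      exact: measurable_funB.
    by move=> x; apply: le_trans (ler_normB _ _) _; exact: lerD.
  apply: eq_Rintegral => x _.
  by rewrite mulrBr XB (formZr (ipC ip) (ipP ip)).
pose I r := \int[mu]_(x in `]s, r]) rate n y f x.
have mrate : measurable_fun setT (rate n y f).
  have -> : rate n y f = (fun x => 2 * (ip (f x) (X (y x)) - kappa * ip (y x) (S n (y x)))).
    by apply/funext => x; exact: rateE.
  apply: measurable_funM; first exact: measurable_cst.
  apply: measurable_funB; first exact: mX.
  by apply: measurable_funM => //; exact: measurable_cst.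
have [K hK] : exists K, forall x, `|rate n y f x| <= K.
  exists (2 * (M * (2 * M0) + kappa * (M0 * (n%:R * M0)))) => x.
  rewrite rateE normrM ger0_norm// ler_wpM2l//.
  apply: le_trans (ler_normB _ _) _; apply: lerD; first exact: bX.
  by rewrite normrM gtr0_norm// ler_wpM2l// ltW.
have decr : D t - I t <= D s - I s.
  apply: (@increment_const (fun r => D r - I r) s t) => // e e0.
  pose C := M * 2 + kappa * (M0 * n%:R).
  have C0 : 0 <= C by rewrite addr_ge0 ?mulr_ge0// ltW.
  have C1 : 0 < 2 * (C + 1) by rewrite mulr_gt0// ltr_wpDl.
  have [|d d0 hd] := ucy (e / (2 * (C + 1))); first by rewrite divr_gt0.
  exists d => // r r' sr rr' r't r'r.
  have r0 := lt_le_trans s0 sr.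
  have r'T := le_lt_trans r't tT.
  have -> : D r' - I r' - (D r - I r) = (D r' - D r) - (I r' - I r) by ring.
  have -> : I r' - I r = \int[mu]_(x in `]r, r']) rate n y f x.
    by rewrite /I (Rintegral_add sr (ltW rr') mrate hK) [LHS]addrC addKr.
  rewrite (incr r r')// -RintegralB//; last 2 first.
  - apply: (@bounded_integrable _ _ _ (M * `|X (y r' + y r)| + kappa * (M0 * `|S n (y r' + y r)|))).
      exact: mhk.
    move=> x; apply: le_trans (ler_normB _ _) _; apply: lerD => //.
    by rewrite normrM gtr0_norm// ler_wpM2l// ltW.
  - exact: bounded_integrable mrate hK.
  apply: Rintegral_bound_on; first exact: ltW.
    by apply: measurable_funB => //; exact: mhk.
  move=> x /andP[rx xr'].
  (* The deviation of y r' + y r from 2 y x; the integrand below differs from [rate] by a linear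
     expression in z. *)
  pose z := (y r' - y x) + (y r - y x).
  have zle : `|z| <= e / (C + 1).
    have -> : e / (C + 1) = e / (2 * (C + 1)) + e / (2 * (C + 1)).
      by field; rewrite gt_eqF// ltr_wpDl.
    apply: le_trans (ler_normD _ _) _; apply: lerD; apply/ltW/hd.
      rewrite ger0_norm ?subr_ge0//; apply: le_lt_trans r'r.
      by rewrite lerD2l lerN2 ltW.
    rewrite distrC ger0_norm ?subr_ge0 ?(ltW rx)//; apply: le_lt_trans r'r.
    by rewrite lerD2r.
  have -> : ip (f x) (X (y r' + y r)) - kappa * ip (y x) (S n (y r' + y r)) -
     rate n y f x = ip (f x) (X z) - kappa * ip (y x) (S n z).
    have zE : z = (y r' + y r) - (y x + y x) by rewrite /z opprD addrACA.
    rewrite zE Xsub Ssub rateE.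
    (* X and [S n] are at hand only through their compatibility with differences, so the sum is
       written as a double difference. *)
    have -> : y x + y x = y x - (0 - y x) by rewrite sub0r opprK.
    rewrite !Xsub !Ssub !(formE (ipC ip) (ipP ip)).
    have -> : X 0 = 0 by have := Xsub 0 0; rewrite !subrr.
    have -> : S n 0 = 0 by have := Ssub 0 0; rewrite !subrr.
    by rewrite !linear0r; ring.
  apply: le_trans (ler_normB _ _) _; rewrite normrM (gtr0_norm kappa_gt0).
  have h1 := le_trans (bfk (X z) x) (ler_wpM2l M_ge0 (Xle z)).
  have h2 := le_trans (byk (S n z) x) (ler_wpM2l M0_ge0 (Sle z)).
  have h3 := ler_wpM2l (ltW kappa_gt0) h2.
  apply: le_trans (lerD h1 h3) _.
  have -> : M * (2 * `|z|) + kappa * (M0 * (n%:R * `|z|)) = C * `|z|.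
    by rewrite /C; ring.
  apply: le_trans (ler_wpM2l C0 zle) _.
  rewrite mulrC -mulrA ler_piMr ?(ltW e0)//.
  by rewrite mulrC ler_pdivrMr ?ltr_wpDl// mul1r lerDl.
have Is : I s = 0 by rewrite /I set_itvoc0 Rintegral_set0.
have Dle r : `|D r| <= 2 * M0 ^+ 2.
  by rewrite /D (ipC ip); apply: le_trans (byk _ _) _; have := Xle (y r); have := yM r; nra.
have -> : kappa * (\int[mu]_(r in `]s, t]) ip (S n (y r)) (y r)) =
    \int[mu]_(r in `]s, t]) (ip (f r) (X (y r))) - 2^-1 * I t.
  rewrite -RintegralZl//; last first.
    apply: (@bounded_integrable _ _ (fun r => ip (S n (y r)) (y r)) (M0 * (n%:R * M0))).
      by under eq_fun do rewrite (ipC ip).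
    by move=> r; rewrite (ipC ip).
  rewrite -RintegralZl//; last exact: bounded_integrable mrate hK.
  rewrite -RintegralB//; last 2 first.
  - exact: bounded_integrable mX bX.
  - apply: (@bounded_integrable _ _ (fun r => 2^-1 * rate n y f r) (2^-1 * K)).
      by apply: measurable_funM => //; exact: measurable_cst.
    by move=> r; rewrite normrM ger0_norm ?invr_ge0// ler_wpM2l ?invr_ge0.
  by apply: eq_Rintegral => r _; rewrite rateE (ipC ip (S n _)); field.
(* The term with f contributes 2 M M0 (t - s). Since |D| <= 2 M0^2, the integral [I t] is at least
   -4 M0^2, and half of it contributes the constant 2 M0^2. *)
have h1 := Rintegral_bound (ltW st) mX bX.
have h2 := Dle t; have h3 := Dle s; rewrite !ler_norml in h2 h3.
rewrite Is subr0 in decr.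
move: h1 h2 h3 decr; move: (\int[mu]_(r in _) _) (D t) (D s) (I t) => i1 d1 d2 i2.
rewrite -!mulrA !(mulrA _ _ (t - s)) => h1 /andP[h2 _] /andP[_ h3] h4.
by lra.
Qed.

(** Fatou's lemma in n: the bounds of [evolution_energy] are uniform in n, and the integrands
    converge to a(v, v) wherever y = [iV v], by [energy_Sop] and [iter_Nop_cvg0]. *)
Lemma evolution_energy_bound T y v f M M0 : continuous y ->
  (forall e, 0 < e -> exists2 d, 0 < d &
     forall r r', `|r - r'| < d -> `|y r - y r'| < e) ->
  (forall t, `|f t| <= M) -> (forall t, `|y t| <= M0) ->
  evolution T y v f -> forall s t, 0 < s -> s < t -> t < T ->
  (\int[mu]_(r in `]s, t]) (a (v r) (v r))%:E <=
   (M0 ^+ 2 * 2 + 2 * M * M0 * (t - s))%:E)%E.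
Proof.
move=> cy ucy fM yM ev s t s0 st tT.
have [_ _ yv _] := ev.
have mS n : measurable_fun setT (fun r => ip (S n (y r)) (y r)).
  apply: continuous_measurable_fun; apply: ip_continuous2 => //.
  apply: (lipschitz_continuous (C := n%:R)) => // k l.
  rewrite -Sop_sub.
  exact: (Sop_le hG hA_sym hlambda1 hA_bounds hRz kappa_gt0 hkappa).
have S0 n k : 0 <= ip (S n k) k.
  have := Sop_nd hG hA_sym hlambda1 hA_bounds hRz kappa_gt0 hkappa k (leq0n n).
  by rewrite {1}/Sop big_ord0 linear0l.
have M0_ge0 : 0 <= M0 by exact: le_trans (yM 0).
have bS n r : `|kappa * ip (S n (y r)) (y r)| <= kappa * (n%:R * M0 * M0).
  rewrite normrM gtr0_norm// ler_wpM2l ?(ltW kappa_gt0)//.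
  apply: le_trans (ip_le hH _ _) _; apply: ler_pM => //.
  apply: le_trans (Sop_le hG hA_sym hlambda1 hA_bounds hRz kappa_gt0 hkappa _ _) _.
  by rewrite ler_wpM2l.
have mkS n : measurable_fun setT (fun r => kappa * ip (S n (y r)) (y r)).
  by apply: measurable_funM => //; exact: measurable_cst.
apply: (@fatou_bound R `]s, t]%classic (measurable_itv _)
  (fun n r => kappa * ip (S n (y r)) (y r))).
- by move=> n; apply/measurable_EFinP; apply: measurable_funTS; exact: mkS.
- by move=> n r; rewrite mulr_ge0 ?(ltW kappa_gt0).
- by move=> r; exact: (energy_ge0 hlambda1 hA_bounds).
- move=> n; have ik := bounded_integrable s t (mkS n) (bS n).
  rewrite -[leLHS]fineK; last exact: integrable_fin_num ik.
  rewrite lee_fin; have := evolution_energy n cy ucy fM yM ev s0 st tT.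
  rewrite -RintegralZl//.
  apply: (@bounded_integrable _ _ (fun r => ip (S n (y r)) (y r)) (n%:R * M0 * M0)) => //.
  move=> r; have := bS n r; rewrite normrM gtr0_norm//.
  by rewrite ler_pM2l.
- apply: (ae_imply yv) => r yr; rewrite /= in_itv /= => /andP[sr rt].
  rewrite yr; last by rewrite /= in_itv /= (lt_trans s0 sr) (le_lt_trans rt tT).
  have h := iter_Nop_cvg0 hG hA_sym hlambda1 hA_bounds hRz kappa_gt0 hkappa (v r).
  rewrite (_ : (fun n => _) = fun n => a (v r) (v r) - a (iter n (Nop iV Rz kappa) (v r)) (v r)).
    by rewrite -[X in _ --> X]subr0; apply: cvgB => //; exact: cvg_cst.
  by apply/funext => n; rewrite (energy_Sop hG kappa hRz).
Qed.

End Evolution.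

(** * Compactness of translates *)

Lemma interval_net (R : realType) (k d : R) : 0 < d ->
  exists ts : seq R, forall t, `|t| <= k -> exists2 r, r \in ts & `|t - r| <= d.
Proof.
move=> d0; exists [seq j%:R * d - k | j <- iota 0 (Num.truncn (2 * k / d)).+1].
move=> t tk; have tk' : - k <= t <= k by rewrite -ler_norml.
have q0 : 0 <= (t + k) / d by rewrite divr_ge0 ?(ltW d0)//; lra.
have := truncn_itv q0; set j := Num.truncn _ => /andP[j1 j2].
exists (j%:R * d - k).
  apply/mapP; exists j => //; rewrite mem_iota /= add0n ltnS.
  apply: le_truncn; rewrite ler_pM2r ?invr_gt0//; lra.
move: j1 j2; rewrite ler_pdivlMr// ltr_pdivrMr// -natr1 mulrDl mul1r => j1 j2.
rewrite ler_norml; apply/andP; split; lra.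
Qed.

Section Compactness.
Variables (R : realType) (H : completeNormedModType R).
Variable K : set H.
Hypothesis cK : compact K.

(** The extraction h is asked only to dominate the identity, not to increase; this is enough for
    every limit taken along it. *)
Lemma compact_subseq (x : nat -> H) : (forall n, K (x n)) ->
  exists2 l, K l & exists2 h : nat -> nat, (forall k, (k <= h k)%N) &
    x (h k) @[k --> \oo] --> l.
Proof.
move=> Kx; have [|l [Kl cl]] := cK (F := x n @[n --> \oo]); first by exists 0%N => // n _; exact: Kx.
exists l => //.
have sel k : exists n, (k <= n)%N /\ `|x n - l| < k.+1%:R^-1.
  have [] := cl [set x n | n in [set n | (k <= n)%N]] (ball l k.+1%:R^-1).
  - by exists k => // n kn; exists n.
  - by apply: nbhsx_ballx; rewrite invr_gt0.
  - by move=> _ [[n kn <-]]; rewrite -ball_normE /= distrC => hn; exists n.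
have [h hh] := choice sel.
exists h => [k|]; first exact: (hh k).1.
apply/cvg_seqP => e e0.
have /cvg_seqP/(_ e e0)[N hN] := @cvg_harmonic R.
exists N => n Nn; apply: lt_trans (hh n).2 _.
by have := hN n Nn; rewrite subr0 /harmonic /= gtr0_norm ?invr_gt0 ?ltr0n.
Qed.

(** The inverse of a continuous injection on a compact set is uniformly continuous. Pairs violating
    this would accumulate at some (k, l) with B (k - l) = 0 and |k - l| >= e. *)
Lemma injective_compact_modulus (B : H -> H) (C : R) : 0 <= C ->
  (forall k l, B (k - l) = B k - B l) -> (forall k, `|B k| <= C * `|k|) ->
  (forall k, B k = 0 -> k = 0) ->
  forall e, 0 < e -> exists2 d, 0 < d & forall k l, K k -> K l ->
    `|B k - B l| < d -> `|k - l| < e.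
Proof.
move=> C0 Bsub BC Binj e e0; apply: contrapT => nd.
have sel n : exists kl : H * H, [/\ K kl.1, K kl.2,
    `|B kl.1 - B kl.2| < n.+1%:R^-1 & e <= `|kl.1 - kl.2|].
  apply: contrapT => h; apply: nd; exists n.+1%:R^-1; first by rewrite invr_gt0.
  move=> k l Kk Kl Bkl; rewrite ltNge; apply/negP => ekl.
  by apply: h; exists (k, l).
have [kl hkl] := choice sel.
have [|k Kk [h hh kcv]] := @compact_subseq (fun n => (kl n).1).
  by move=> n; have [] := hkl n.
have [|l Kl [g hg lcv]] := @compact_subseq (fun n => (kl (h n)).2).
  by move=> n; have [] := hkl (h n).
have close eta : 0 < eta -> exists n, [/\ `|(kl n).1 - k| < eta,
    `|(kl n).2 - l| < eta, `|B (kl n).1 - B (kl n).2| < eta & e <= `|(kl n).1 - (kl n).2|].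
  move=> eta0; have /cvg_seqP/(_ _ eta0)[N1 hN1] := kcv.
  have /cvg_seqP/(_ _ eta0)[N2 hN2] := lcv.
  have /cvg_seqP/(_ _ eta0)[N3 hN3] := @cvg_harmonic R.
  (* As j <= [g j] <= [h (g j)], one index passes the three thresholds: the first along h, the
     second along the composite, the third in the original numbering. *)
  pose j := (N1 + N2 + N3)%N.
  have [_ _ h3 h4] := hkl (h (g j)).
  have gj := hg j.
  exists (h (g j)); split => //.
  - by apply: hN1; rewrite (leq_trans _ gj)// /j -addnA leq_addr.
  - by apply: hN2; rewrite /j addnAC leq_addl.
  - have hgj : (N3 <= h (g j))%N.
      by rewrite (leq_trans _ (hh _))// (leq_trans _ gj)// leq_addl.
    apply: lt_trans h3 _; have := hN3 _ hgj.
    by rewrite subr0 /harmonic /= gtr0_norm ?invr_gt0 ?ltr0n.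
have kl0 : k - l = 0.
  apply: Binj; apply/eqP; rewrite -normr_le0; apply/ler_addgt0Pr => eps eps0.
  rewrite add0r.
  have C1 : 0 < 2 * C + 1 by rewrite ltr_wpDl ?mulr_ge0.
  have [|n [h1 h2 h3 _]] := close (eps / (2 * C + 1)); first by rewrite divr_gt0.
  have b1 := le_trans (BC _) (ler_wpM2l C0 (ltW h1)).
  have b2 := le_trans (BC _) (ler_wpM2l C0 (ltW h2)).
  have -> : B (k - l) = (B (kl n).1 - B (kl n).2) - B ((kl n).1 - k) + B ((kl n).2 - l).
    by rewrite !Bsub opprB [_ - _ + (_ - _)]addrC !subrKA.
  apply: le_trans (ler_normD _ _) _; apply: le_trans (lerD (ler_normB _ _) (lexx _)) _.
  have := lerD (lerD (ltW h3) b1) b2; move=> hh'; apply: le_trans hh' _.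
  by rewrite le_eqVlt; apply/orP; left; apply/eqP; field; rewrite gt_eqF.
have [|n [h1 h2 _ h4]] := close (e / 2); first by rewrite divr_gt0.
move: h4; rewrite leNgt => /negP; apply.
have -> : (kl n).1 - (kl n).2 = ((kl n).1 - k) - ((kl n).2 - l).
  by rewrite (subr0_eq kl0) opprB subrKA.
apply: le_lt_trans (ler_normB _ _) _; lra.
Qed.

Lemma compact_lipschitz_uniform (B : H -> H) (C L : R) (y : R -> H) : 0 <= C ->
  (forall k l, B (k - l) = B k - B l) -> (forall k, `|B k| <= C * `|k|) ->
  (forall k, B k = 0 -> k = 0) -> 0 <= L ->
  (forall t, K (y t)) -> (forall s t, `|B (y t) - B (y s)| <= L * `|t - s|) ->
  forall e, 0 < e -> exists2 d, 0 < d &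
    forall r r', `|r - r'| < d -> `|y r - y r'| < e.
Proof.
move=> C0 Bsub BC Binj L0 Ky By e e0.
have [d d0 hd] := injective_compact_modulus C0 Bsub BC Binj e0.
have L1 : 0 < L + 1 by rewrite ltr_wpDl.
exists (d / (L + 1)); first by rewrite divr_gt0.
move=> r r' rr'; apply: hd => //; apply: le_lt_trans (By _ _) _.
apply: le_lt_trans (_ : (L + 1) * `|r - r'| < _); first by rewrite ler_wpM2r// lerDl.
by rewrite mulrC -ltr_pdivlMr.
Qed.

(* Arzela-Ascoli for the translates of a single function; the limit is a
   cluster point for the topology of pointwise convergence. *)
Lemma translates_compact (y : R -> H) (s : nat -> R) :
  (forall t, K (y t)) ->
  (forall e, 0 < e -> exists2 d, 0 < d &
     forall r r', `|r - r'| < d -> `|y r - y r'| < e) ->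
  exists psi : R -> H, exists h : nat -> nat,
    [/\ forall k, (k <= h k)%N, continuous psi, forall t, K (psi t) &
        forall k t, `|t| <= k%:R -> `|y (s (h k) + t) - psi t| < k.+1%:R^-1].
Proof.
move=> Ky ucy.
have cP := @tychonoff R (fun=> H) (fun=> K) (fun=> cK).
pose F := (fun n => (fun t => y (s n + t)) : prod_topology (fun _ : R => H)) n @[n --> \oo].
have [|psi [Kpsi clpsi]] := cP F; first by exists 0%N => // n _ /= t; exact: Ky.
(* Neighbourhoods for pointwise convergence control finitely many times at once, and the cluster
   property supplies arbitrarily late indices n. *)
have approx e N (ts : seq R) : 0 < e -> exists2 n, (N <= n)%N &
    forall t, t \in ts -> `|y (s n + t) - psi t| < e.
  move=> e0.
  have nb : nbhs (psi : prod_topology (fun _ : R => H))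
      [set f | forall t, t \in ts -> ball (psi t) e (f t)].
    elim: ts => [|t0 ts IH].
      rewrite (_ : [set _ | _] = setT).
        exact: (@filterT _ _ (nbhs_filter (psi : prod_topology (fun _ : R => H)))).
      by apply/seteqP; split => // f _ t; rewrite in_nil.
    have nt0 : nbhs (psi : prod_topology (fun _ : R => H)) [set f | ball (psi t0) e (f t0)].
      have := @proj_continuous R (fun=> H) t0 psi.
      by move=> /(_ (ball (psi t0) e) (nbhsx_ballx _ _ e0)).
    have nf := nbhs_filter (psi : prod_topology (fun _ : R => H)).
    apply: (@filterS _ _ nf _ _ _ (@filterI _ _ nf _ _ nt0 IH)) => f [f0 fts] t.
    by rewrite inE => /orP[/eqP ->//|]; exact: fts.
  have [] := clpsi [set (fun t => y (s n + t)) | n in [set n | (N <= n)%N]] _ _ nb.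
    by exists N => // n Nn; exists n.
  move=> _ [[n /= Nn <-] hf]; exists n => // t /hf.
  by rewrite -ball_normE /= distrC.
have ucpsi e : 0 < e -> exists2 d, 0 < d &
     forall r r', `|r - r'| < d -> `|psi r - psi r'| <= e.
  move=> e0; have [d d0 hd] := ucy e e0; exists d => // r r' rr'.
  apply/ler_addgt0Pr => eta eta0.
  have [|n _ hn] := @approx (eta / 2) 0 [:: r; r']; first by rewrite divr_gt0.
  have h1 := hn r (mem_head _ _).
  have h2 : `|y (s n + r') - psi r'| < eta / 2 by apply: hn; rewrite !inE eqxx orbT.
  have h3 : `|y (s n + r) - y (s n + r')| < e.
    by apply: hd; rewrite opprD addrACA subrr add0r.
  have -> : psi r - psi r' = (y (s n + r) - y (s n + r')) -
     (y (s n + r) - psi r) + (y (s n + r') - psi r').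
    by rewrite opprB [_ - _ + (_ - _)]addrC !subrKA.
  apply: le_trans (ler_normD _ _) _; apply: le_trans (lerD (ler_normB _ _) (lexx _)) _.
  lra.
(* Approximation on a finite net of [-k, k] extends to the whole interval: the moduli of y and of
   psi and the error at the nearest net point each cost a quarter of 1 / (k + 1). *)
have sel k : exists n, (k <= n)%N /\
    forall t, `|t| <= k%:R -> `|y (s n + t) - psi t| < k.+1%:R^-1.
  pose e : R := k.+1%:R^-1.
  have e0 : 0 < e by rewrite invr_gt0.
  have [|d1 d10 hd1] := ucy (e / 4); first by rewrite divr_gt0.
  have [|d2 d20 hd2] := ucpsi (e / 4); first by rewrite divr_gt0.
  pose d := Num.min d1 d2 / 2.
  have d0 : 0 < d by rewrite divr_gt0// lt_min d10.
  have dd1 : d < d1 by have := ge_min d1 d1 d2; rewrite lexx /= /d => ?; lra.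
  have dd2 : d < d2 by have := ge_min d2 d1 d2; rewrite lexx orbT /= /d => ?; lra.
  have [ts hts] := interval_net k%:R d0.
  have [|n kn hn] := @approx (e / 4) k ts; first by rewrite divr_gt0.
  exists n; split => // t tk.
  have [r rts rt] := hts t tk.
  have h1 := hn r rts.
  have h2 : `|y (s n + t) - y (s n + r)| < e / 4.
    by apply: hd1; rewrite opprD addrACA subrr add0r (le_lt_trans rt).
  have h3 : `|psi t - psi r| <= e / 4 by apply: hd2; exact: le_lt_trans rt dd2.
  have -> : y (s n + t) - psi t = (y (s n + t) - y (s n + r)) +
     (y (s n + r) - psi r) - (psi t - psi r).
    by rewrite opprB [_ + (psi r - _)]addrC subrKA addrC subrKA.
  apply: le_lt_trans (ler_normB _ _) _; apply: le_lt_trans (lerD (ler_normD _ _) (lexx _)) _.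
  rewrite -/e; lra.
have [h hh] := choice sel.
exists psi, h; split.
- by move=> k; exact: (hh k).1.
- move=> t; apply/cvgrPdist_lt => e e0.
  have [|d d0 hd] := ucpsi (e / 2); first by rewrite divr_gt0.
  exists d => //= r rt; apply: le_lt_trans (hd t r rt) _; lra.
- exact: Kpsi.
- by move=> k t tk; exact: (hh k).2.
Qed.

End Compactness.

(** * Restriction and translation of solutions *)

Section TestFunctions.
Variable R : realType.
Local Notation mu := (@lebesgue_measure R).

Lemma derivable1_continuous (f : R -> R) :
  (forall t : R, derivable f t 1) -> continuous f.
Proof.
by move=> df t; have /derivable1_diffP/differentiable_continuous := df t.
Qed.

Lemma test_function_derive1_continuous (T : R) (theta : R -> R) :
  test_function T theta -> continuous (derive1 theta).
Proof. by move=> [d _]; apply: derivable1_continuous => t; exact: (d 1 t). Qed.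

Lemma test_function_continuous (T : R) (theta : R -> R) :
  test_function T theta -> continuous theta.
Proof. by move=> [d _]; apply: derivable1_continuous => t; exact: (d 0 t). Qed.

(** The support lies in a compact interval inside ]0, T[, so theta vanishes in a neighbourhood of t
    and its derivative vanishes too. *)
Lemma test_function_out (T : R) (theta : R -> R) : test_function T theta ->
  forall t, ~ (0 < t < T) -> theta t = 0 /\ derive1 theta t = 0.
Proof.
move=> [_ [a [b [a0 bT h]]]] t tT.
have out r : r \notin `]a, b[ -> r != a -> r != b -> theta r = 0.
  move=> rab ra rb; apply: h; move: rab; rewrite !in_itv /=.
  by apply: contra => /andP[r1 r2]; rewrite !lt_neqAle r1 r2 eq_sym ra rb.
have ht : t < a \/ b < t.
  apply/orP; apply/negPn/negP; rewrite negb_or -!leNgt => /andP[t1 t2].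
  by apply: tT; rewrite (lt_le_trans a0 t1) (le_lt_trans t2 bT).
have th : theta t = 0.
  by apply: h; rewrite in_itv /= negb_and -!ltNge; case: ht => ->; rewrite ?orbT.
split => //; apply: is_derive_derive1.
have d0 : is_derive t (1 : R) (cst (0 : R)) 0 by exact: is_derive_cst.
apply: (near_eq_is_derive _ d0).
case: ht => ht; near=> r; rewrite /=; apply/esym/h; rewrite in_itv /= negb_and -!ltNge.
  by apply/orP; left; near: r; exact: lt_nbhsl.
by apply/orP; right; near: r; exact: lt_nbhsr.
Unshelve. all: by end_near. Qed.

Lemma test_function_bounded (T : R) (theta : R -> R) : test_function T theta ->
  exists2 C, 0 <= C & forall t, `|theta t| <= C /\ `|derive1 theta t| <= C.
Proof.
move=> ht.
have bnd (g : R -> R) : continuous g -> (forall t, ~ (0 < t < T) -> g t = 0) ->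
    exists2 C, 0 <= C & forall t, `|g t| <= C.
  move=> cg g0.
  have /compact_bounded[M [_ hM]] : compact (g @` `[0, T]).
    by apply: continuous_compact; [exact: continuous_subspaceT|exact: segment_compact].
  exists (`|M| + 1) => [|t]; first by rewrite addr_ge0.
  have [/andP[t0 tT]|tn] := boolP (0 < t < T); last first.
    by rewrite g0 ?normr0 ?addr_ge0//; exact/negP.
  apply: hM; first by rewrite (le_lt_trans (ler_norm M))// ltrDl.
  by exists t => //=; rewrite in_itv /= (ltW t0) (ltW tT).
have [C1 C10 h1] := bnd _ (test_function_continuous ht)
  (fun t tT => (test_function_out ht tT).1).
have [C2 C20 h2] := bnd _ (test_function_derive1_continuous ht)
  (fun t tT => (test_function_out ht tT).2).
exists (C1 + C2) => [|t]; first exact: addr_ge0.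
by split; [rewrite (le_trans (h1 t))// lerDl|rewrite (le_trans (h2 t))// lerDr].
Qed.

Lemma derive1n_shift (g : R -> R) (s : R) :
  (forall n (t : R), derivable (derive1n n g) t 1) ->
  forall n, derive1n n (fun r => g (r - s)) = fun r => derive1n n g (r - s).
Proof.
move=> dg; elim=> [//|n IH]; rewrite derive1nS IH.
apply/funext => t; apply: is_derive_derive1.
have h : is_derive (t - s) 1 (derive1n n g) (derive1n n.+1 g (t - s)).
  by constructor; [exact: dg|rewrite derive1nS derive1E].
have hs : is_derive t 1 (fun r : R => r - s) 1.
  by apply: is_derive_eq; rewrite subr0.
have := is_derive1_comp (f := derive1n n g) (g := fun r : R => r - s) h hs.
by rewrite mulr1.
Qed.

Lemma test_function_shift (T T' s : R) (theta : R -> R) : 0 < s -> s + T < T' ->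
  test_function T theta -> test_function T' (fun r => theta (r - s)).
Proof.
move=> s0 sT [dth [a [b [a0 bT hab]]]]; split.
  move=> n t; rewrite derive1n_shift//.
  have h : is_derive (t - s) 1 (derive1n n theta) (derive1n n.+1 theta (t - s)).
    by constructor; [exact: dth|rewrite derive1nS derive1E].
  have hs : is_derive t 1 (fun r : R => r - s) 1.
    by apply: is_derive_eq; rewrite subr0.
  exact: (is_derive_derivable
    (is_derive1_comp (f := derive1n n theta) (g := fun r : R => r - s) h hs)).
exists (a + s), (b + s); split; [lra|lra|].
move=> t; rewrite in_itv /= => ht; apply: hab; rewrite in_itv /=.
by move: ht; rewrite lerBrDr lerBlDr.
Qed.

(* [h] vanishes off [`]0, T[] *)
Lemma Rintegral_test_shift (T T' s : R) (h k : R -> R) : 0 < s -> s + T < T' ->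
  (forall t, ~ (0 < t < T) -> h t = 0) ->
  measurable_fun setT h -> measurable_fun setT k ->
  \int[mu]_(t in `]0, T'[) (h (t - s) * k t) =
  \int[mu]_(t in `]0, T[) (h t * k (t + s)).
Proof.
move=> s0 sT h0 mh mk.
have mhs : measurable_fun setT (fun t : R => h (t - s)).
  exact: (measurableT_comp mh (measurable_addr (- s))).
rewrite (Rintegral_shift s)//; last exact: measurable_funM.
rewrite Rintegral_mkcond [RHS]Rintegral_mkcond; apply: eq_Rintegral => t _.
rewrite !patchE addrK.
have [/andP[t0 tT]|tn] := boolP (0 < t < T).
  rewrite ifT; last by rewrite inE /= in_itv /=; apply/andP; split; lra.
  by rewrite ifT// inE /= in_itv /= t0.
by rewrite h0 ?mul0r; [case: ifP; case: ifP|exact/negP].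
Qed.

End TestFunctions.

Lemma max0_lipschitz (R : realType) (t r : R) :
  `|Num.max t 0 - Num.max r 0| <= `|t - r|.
Proof.
have h1 := ler_norm (t - r); have h2 := ler_norm (r - t).
rewrite distrC in h2; rewrite ler_norml !maxElt.
by case: (ltP t 0) => ?; case: (ltP r 0) => ?; apply/andP; split; lra.
Qed.

Lemma ae_and (R : realType) (P Q : R -> Prop) :
  {ae lebesgue_measure, forall t, P t} -> {ae lebesgue_measure, forall t, Q t} ->
  {ae lebesgue_measure, forall t, P t /\ Q t}.
Proof. by move=> hP hQ; apply: (ae_imply2 hP hQ). Qed.

Section MildSolutions.
Variables (R : realType) (V H V' : completeNormedModType R).
Variables (ip : {dot H for idfun}) (pr : {bilinear V' -> V -> R | *%R & *%R}).
Variables (iV : {linear V -> H}) (iH : {linear H -> V'}).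
Hypothesis hG : gelfand_triple ip pr iV iH.
Variables (A : {linear V -> V'}).
Hypothesis hA_sym : forall u v : V, pr (A u) v = pr (A v) u.
Variables (F : H -> set H).
Variables (C1 C2 : R).
Hypothesis hF_growth : forall y : H,
       (ereal_sup [set `|a|%:E | a in F y] <= (C1 + C2 * `|y|)%:E)%E.

Local Notation mu := (@lebesgue_measure R).
Local Notation a := (energy_form pr A).

(** Extends the restriction of phi to [0, +oo[ by the constant [phi 0], so that continuity within
    the half-line becomes continuity on R and the values at negative times never matter. *)
Definition forward (phi : R -> H) (t : R) : H := phi (Num.max t 0).

Lemma forward_continuous (phi : R -> H) :
  {within `[0, +oo[, continuous phi} -> continuous (forward phi).
Proof.
move=> /subspace_continuousP cphi t; apply/cvgrPdist_lt => e e0.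
have t0 : `[0, +oo[%classic (Num.max t 0) by rewrite /= in_itv /= le_max lexx orbT.
have := cphi _ t0; move=> /cvgrPdist_lt/(_ e e0)[d /= d0 hd].
exists d => //= r rt; apply: hd => /=; last by rewrite in_itv /= le_max lexx orbT.
by apply: le_lt_trans rt; exact: max0_lipschitz.
Qed.

(** Chooses representatives of v and f that are limits of simple functions everywhere, and with f
    bounded by M everywhere. *)
Lemma mild_solution_evolution (y0 : H) (phi : R -> H) (T M : R) : 0 <= M ->
  (forall t, C1 + C2 * `|forward phi t| <= M) ->
  mild_solution pr iV iH A F y0 phi -> 0 < T ->
  exists v f, [/\ evolution ip pr iV A T (forward phi) v f,
    forall t, `|f t| <= M &
    {ae mu, forall t, `]0, T[%classic t -> F (forward phi t) (f t)}].
Proof.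
move=> M0 hM [_ _ /(_ T)]h T0; have {h} := h T0.
move=> [v0 [g0 [f0 [[[mv0 _] yv0] [[mg0 _] weak] [mf0 _] eq0 inF]]]].
have mD : measurable (`]0, T[%classic : set R) by exact: measurable_itv.
have [v [sv vv0 _]] := strongly_measurable_simple_limit mD mv0.
have [f1 [sf1 ff1 _]] := strongly_measurable_simple_limit mD mf0.
(* By the growth condition, selections of F along the orbit have norm at most M, so this cut changes
   f only on a null set of ]0, T[. *)
pose f t := (\1_([set t | `|f1 t| <= M]) t : R) *: f1 t.
have mset : measurable [set t | `|f1 t| <= M].
  have m1 : measurable_fun setT (fun t : R => `|f1 t|) by exact: simple_limit_norm.
  by have := measurable_fun_le measurableT m1 (measurable_cst M); rewrite setTI.
have fwd t : `]0, T[%classic t -> forward phi t = phi t.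
  by rewrite /= in_itv /= => /andP[t0 _]; rewrite /forward max_l// ltW.
have Fbnd t w : F (forward phi t) w -> `|w| <= M.
  move=> Fw; apply: le_trans (hM t); rewrite -lee_fin.
  apply: le_trans (hF_growth (forward phi t)).
  by apply: ereal_sup_ubound; exists w.
have ff0 : {ae mu, forall t, `]0, T[%classic t -> F (forward phi t) (f t) /\ f t = f0 t}.
  apply: (ae_imply2 ff1 inF) => t h1 h2 Dt.
  have Ff0 : F (forward phi t) (f0 t) by rewrite fwd//; apply: h2; rewrite inE in Dt *.
  have -> : f t = f0 t.
    rewrite /f indicE mem_set; first by rewrite scale1r h1.
    by rewrite /= h1//; exact: (Fbnd _ _ Ff0).
  by [].
exists v, f; split.
- split => //.
  + exact: simple_limit_restrict.
  + apply: (ae_imply2 vv0 yv0) => t h1 h2 Dt.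
    by rewrite fwd// h1// h2.
  + move=> theta ht w; have := weak _ ht w.
    rewrite (_ : \int[mu]_(t in _) (derive1 theta t * pr _ _) =
      \int[mu]_(t in `]0, T[) (derive1 theta t * ip (forward phi t) (iV w))); last first.
      apply: eq_Rintegral => t; rewrite inE => Dt.
      by rewrite fwd//= (pairing_iH hG).
    move=> ->; congr (- _); apply: ae_eq_Rintegral.
    apply: (ae_imply2 (ae_and vv0 ff0) eq0) => t [h1 h2] h3 Dt.
    have [_ ->] := h2 Dt.
    have -> : g0 t = iH (f0 t) - A (v t).
      by rewrite h1// -h3 ?addrK// inE.
    by rewrite linearBl /= (pairing_iH hG).
- move=> t; rewrite /f indicE; have [tM|_] := boolP (t \in _).
    by rewrite scale1r; move: tM; rewrite inE.
  by rewrite scale0r normr0.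
- by apply: (ae_imply ff0) => t h /h[].
Qed.

Lemma energy_continuous (w : V) : continuous (fun u => a u w : R^o).
Proof.
move=> u; apply/cvgrPdist_lt => e e0.
have Aw1 : 0 < `|A w| + 1 by rewrite ltr_wpDl.
apply/nbhs_ballP; exists (e / (`|A w| + 1)); first by rewrite /= divr_gt0.
move=> u'; rewrite -ball_normE /= => uu'; rewrite -(formBl (energyP pr A)) (energyC hA_sym).
apply: le_lt_trans (pairing_le hG _ _) _.
apply: le_lt_trans (_ : (`|A w| + 1) * `|u - u'| < e).
  by rewrite ler_wpM2r// lerDl.
by rewrite mulrC -ltr_pdivlMr.
Qed.

(** The translation is moved onto the test function, which is admissible on the longer interval ]0,
    T'[ because s > 0 and s + T < T'. *)
Lemma evolution_shift (T T' s : R) (y : R -> H) (v : R -> V) (f : R -> H) :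
  continuous y -> 0 < s -> s + T < T' -> evolution ip pr iV A T' y v f ->
  evolution ip pr iV A T (fun t => y (t + s)) (fun t => v (t + s)) (fun t => f (t + s)).
Proof.
move=> cy s0 sT [sv sf yv weak]; split.
- exact: simple_limit_shift.
- exact: simple_limit_shift.
- apply: (ae_imply (ae_shift s yv)) => t h; rewrite /= in_itv /= => /andP[t0 tT].
  by apply: h; rewrite /= in_itv /=; apply/andP; split; lra.
- move=> theta ht w.
  have my : measurable_fun setT (fun t => ip (y t) (iV w)).
    by apply: continuous_measurable_fun; exact: (ip_continuous hG).
  have mq : measurable_fun setT (fun t => ip (f t) (iV w) - a (v t) w).
    apply: measurable_funB.
      by apply: (ip_measurable hG) => //; exact: simple_limit_cst.
    apply: (@simple_limit_measurable R (fun t => a (v t) w)).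
    exact: (simple_limit_continuous (@energy_continuous w) sv).
  have := weak _ (test_function_shift s0 sT ht) w.
  have hd : derive1 (fun r => theta (r - s)) = fun r => derive1 theta (r - s).
    have [dth _] := ht; have := derive1n_shift s dth 1.
    by rewrite !derive1n1.
  rewrite hd.
  have out := test_function_out ht.
  rewrite (Rintegral_test_shift s0 sT (fun t tT => (out t tT).2) _ my); last first.
    by apply: continuous_measurable_fun; exact: test_function_derive1_continuous ht.
  rewrite (Rintegral_test_shift s0 sT (fun t tT => (out t tT).1) _ mq)//.
  by apply: continuous_measurable_fun; exact: test_function_continuous ht.
Qed.

End MildSolutions.

(** * Strong limits of averages of solutions *)

(** The closure of a tail under midpoints, as the intersection of all midpoint-stable sets
    containing it: a property is proved on the hull by taking it for [S]. Midpoints are all that the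
    parallelogram identity requires. *)
Definition tail_hull (R : realType) (E : lmodType R) (z : nat -> E) (n : nat) : set E :=
  [set x | forall S : set E, (forall k, (n <= k)%N -> S (z k)) ->
    (forall u w, S u -> S w -> S (2^-1 *: (u + w))) -> S x].

Section TailHull.
Variables (R : realType) (E : lmodType R) (z : nat -> E).

Lemma tail_hull_decr n : tail_hull z n.+1 `<=` tail_hull z n.
Proof. by move=> x hx S Sz Smid; apply: hx => // k /ltnW; exact: Sz. Qed.

Lemma tail_hull_mid n u w :
  tail_hull z n u -> tail_hull z n w -> tail_hull z n (2^-1 *: (u + w)).
Proof. by move=> hu hw S Sz Smid; apply: (Smid); [exact: hu|exact: hw]. Qed.

Lemma tail_hull_gen n : tail_hull z n (z n).
Proof. by move=> S Sz _; exact: Sz. Qed.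

End TailHull.

(** * Stability of square integrability *)

Section SquareIntegrable.
Variables (R : realType) (D : set R).
Hypothesis mD : measurable D.
Local Notation mu := (@lebesgue_measure R).

Definition square_integrable (W : normedModType R) (u : R -> W) : Prop :=
  simple_limit u /\ (\int[mu]_(t in D) (`|u t| ^+ 2)%:E < +oo)%E.

Lemma square_integrableP (W : normedModType R) (u : R -> W) :
  square_integrable u -> mu.-integrable D (fun t => (`|u t| ^+ 2)%:E).
Proof.
move=> [su iu]; apply/integrableP; split; first exact: measurable_sqnorm.
apply: le_lt_trans iu; apply: ae_le_ge0_integral => [t _|t _|].
- exact: abse_ge0.
- by rewrite lee_fin exprn_ge0.
- by apply: nearW => t _; rewrite gee0_abs ?lee_fin ?exprn_ge0.
Qed.

Lemma square_integrable_dominated (W1 W2 W3 : normedModType R)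
    (u : R -> W1) (w : R -> W2) (x : R -> W3) (C : R) : 0 <= C ->
  square_integrable u -> square_integrable w -> simple_limit x ->
  (forall t, `|x t| <= C * (`|u t| + `|w t|)) -> square_integrable x.
Proof.
move=> C0 hu hw sx xle; split => //.
have iu := square_integrableP hu; have iw := square_integrableP hw.
have i2 := @integrableD _ _ R mu D mD _ _ iu iw.
have i3 : mu.-integrable D
    (fun t => (2 * C ^+ 2 * (`|u t| ^+ 2 + `|w t| ^+ 2))%:E).
  have := @integrableZl _ _ R mu D mD (2 * C ^+ 2) _ i2.
  by apply: eq_integrable => [|t _]; [exact: mD|rewrite EFinM EFinD].
have /integrableP[_] : mu.-integrable D (fun t => (`|x t| ^+ 2)%:E).
  apply: (@le_integrable _ _ R mu D mD _ _ _ _ i3); first exact: measurable_sqnorm.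
  move=> t _; rewrite /= lee_fin.
  rewrite ger0_norm ?exprn_ge0// ger0_norm; last first.
    by rewrite !mulr_ge0 ?addr_ge0 ?exprn_ge0.
  have h : `|x t| ^+ 2 <= (C * (`|u t| + `|w t|)) ^+ 2.
    by rewrite ler_sqr ?nnegrE ?mulr_ge0 ?addr_ge0.
  apply: le_trans h _; rewrite exprMn -[leRHS]mulrA [leRHS]mulrCA ler_wpM2l ?exprn_ge0//.
  have := sqr_ge0 (`|u t| - `|w t|); rewrite sqrrB sqrrD; lra.
apply: le_lt_trans; apply: ae_le_ge0_integral => [t _|t _|].
- by rewrite lee_fin exprn_ge0.
- exact: abse_ge0.
- by apply: nearW => t _; rewrite gee0_abs ?lee_fin ?exprn_ge0.
Qed.

Lemma square_integrable_mid (W : normedModType R) (u w : R -> W) :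
  square_integrable u -> square_integrable w ->
  square_integrable (fun t => 2^-1 *: (u t + w t)).
Proof.
move=> hu hw; apply: (square_integrable_dominated (C := 1) _ hu hw) => //.
  apply: (simple_limitZ (f := fun=> 2^-1)); first exact: simple_limit_cst.
  by apply: simple_limitD; [exact: hu.1|exact: hw.1].
move=> t; rewrite normrZ mul1r gtr0_norm ?invr_gt0//.
have h1 := ler_normD (u t) (w t); have := normr_ge0 (u t); have := normr_ge0 (w t).
lra.
Qed.

Lemma square_integrable_sub (W : normedModType R) (u w : R -> W) :
  square_integrable u -> square_integrable w ->
  square_integrable (fun t => u t - w t).
Proof.
move=> hu hw; apply: (square_integrable_dominated (C := 1) _ hu hw) => //.
  by apply: simple_limitB; [exact: hu.1|exact: hw.1].
by move=> t; rewrite mul1r ler_normB.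
Qed.

End SquareIntegrable.

Lemma ae_forall_nat (R : realType) (P : nat -> R -> Prop) :
  (forall n, {ae lebesgue_measure, forall t, P n t}) ->
  {ae lebesgue_measure, forall t, forall n, P n t}.
Proof.
move=> h; apply: negligibleS (negligible_bigcup h) => t /= nP.
by apply: contrapT => hn; apply: nP => n; apply: contrapT => nPn; apply: hn; exists n.
Qed.

Lemma point_dist_ltP (R : realType) (H : normedModType R) (w : H) (Q : set H) (e : R) :
  (point_dist w Q < e%:E)%E <-> exists2 b, Q b & `|w - b| < e.
Proof.
split=> [h|[b Qb wb]].
  have [_ [b Qb <-]] := ereal_inf_lt h; rewrite lte_fin => wb.
  by exists b.
by apply: le_lt_trans (_ : `|w - b|%:E < _)%E; [apply: ereal_inf_lbound; exists b|].
Qed.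

(** * The weak equation as a linear functional of the pair (v, f) *)

Section WeakDefect.
Variables (R : realType) (V H V' : completeNormedModType R).
Variables (ip : {dot H for idfun}) (pr : {bilinear V' -> V -> R | *%R & *%R}).
Variables (iV : {linear V -> H}) (iH : {linear H -> V'}).
Hypothesis hG : gelfand_triple ip pr iV iH.
Variables (A : {linear V -> V'}).
Hypothesis hA_cont : continuous A.
Hypothesis hA_sym : forall u v : V, pr (A u) v = pr (A v) u.
Variables (F : H -> set H).
Hypothesis hF_val : closed_convex_bounded_values F.

Local Notation mu := (@lebesgue_measure R).
Local Notation a := (energy_form pr A).

Let hH : is_hilbert ip. Proof. by case: hG. Qed.

Let ciV : continuous iV. Proof. by have [_ _ [_ h _ _] _ _] := hG. Qed.

Lemma F_midpoint y u w : F y u -> F y w -> F y (2^-1 *: (u + w)).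
Proof.
have [_ _ hconv _] := hF_val y; move=> Fu Fw.
have h0 : 0 <= (2^-1 : R) by rewrite invr_ge0.
have h1 : (2^-1 : R) <= 1 by lra.
have h : F y (2^-1 *: u + (1 - 2^-1) *: w) :=
  set_mem (hconv u w (Itv01 h0 h1) (mem_set Fu) (mem_set Fw)).
have half : 1 - 2^-1 = 2^-1 :> R by field.
by move: h; rewrite half scalerDr.
Qed.

Variable T : R.
Local Notation D := (`]0, T[%classic : set R).
Let mD : measurable D. Proof. exact: measurable_itv. Qed.

Definition weak_integrand (theta : R -> R) (w : V) (v : R -> V) (f : R -> H) (t : R) : R :=
  derive1 theta t * ip (iV (v t)) (iV w) + theta t * (ip (f t) (iV w) - a (v t) w).

Lemma weak_integrand_measurable theta w v f : test_function T theta ->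
  simple_limit v -> simple_limit f ->
  measurable_fun setT (fun t => derive1 theta t * ip (iV (v t)) (iV w)) /\
  measurable_fun setT (fun t => theta t * (ip (f t) (iV w) - a (v t) w)).
Proof.
move=> ht sv sf; split.
  apply: measurable_funM.
    by apply: continuous_measurable_fun; exact: test_function_derive1_continuous ht.
  by apply: (ip_measurable hG); [exact: simple_limit_continuous|exact: simple_limit_cst].
apply: measurable_funM.
  by apply: continuous_measurable_fun; exact: test_function_continuous ht.
apply: measurable_funB.
  by apply: (ip_measurable hG) => //; exact: simple_limit_cst.
apply: (@simple_limit_measurable R (fun t => a (v t) w)).
exact: (simple_limit_continuous (@energy_continuous _ _ _ _ _ _ _ _ hG _ hA_sym w) sv).
Qed.

Lemma weak_integrand_bound theta w : test_function T theta ->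
  exists2 C, 0 <= C & forall (v : R -> V) (f : R -> H) t,
    `|derive1 theta t * ip (iV (v t)) (iV w)| <= C * (`|v t| + `|f t|) /\
    `|theta t * (ip (f t) (iV w) - a (v t) w)| <= C * (`|v t| + `|f t|).
Proof.
move=> ht; have [Ct Ct0 hCt] := test_function_bounded ht.
have [CV CV0 hCV] := linear_norm_bound ciV.
pose K := CV * `|iV w| + `|iV w| + `|A w|.
have K0 : 0 <= K by rewrite !addr_ge0 ?mulr_ge0 ?(ltW CV0).
exists (Ct * K) => [|v f t]; first exact: mulr_ge0.
have [h1 h2] := hCt t; split; rewrite normrM -mulrA ler_pM//.
  apply: le_trans (ip_le hH _ _) _.
  apply: le_trans (_ : CV * `|v t| * `|iV w| <= _); first by rewrite ler_wpM2r.
  have -> : CV * `|v t| * `|iV w| = (CV * `|iV w|) * `|v t| by ring.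
  apply: ler_pM => //; first by rewrite mulr_ge0 ?(ltW CV0).
    by rewrite /K -addrA lerDl addr_ge0.
  by rewrite lerDl.
apply: le_trans (ler_normB _ _) _.
apply: le_trans (lerD (ip_le hH _ _) (_ : _ <= `|A w| * `|v t|)) _.
  by rewrite (energyC hA_sym); exact: (pairing_le hG).
rewrite /K; have : 0 <= CV * `|iV w| by rewrite mulr_ge0 ?(ltW CV0).
have := normr_ge0 (v t); have := normr_ge0 (f t).
have := normr_ge0 (iV w); have := normr_ge0 (A w).
move: (`|v t|) (`|f t|) (`|iV w|) (`|A w|) => n1 n2 n3 n4; nra.
Qed.

Lemma norm_integrable (v : R -> V) (f : R -> H) (C : R) : 0 <= C ->
  square_integrable D v -> square_integrable D f ->
  mu.-integrable D (fun t => (C * (`|v t| + `|f t|))%:E).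
Proof.
move=> C0 hv hf.
have iv := square_integrableP hv; have jf := square_integrableP hf.
have i1 : mu.-integrable D (EFin \o cst (2 : R)).
  apply: (@measurable_bounded_integrable _ _ R mu (cst 2) D) => //.
  - exact: itv_measure_lty.
  - exists 2; split; first exact: num_real.
    by move=> M hM t _ /=; rewrite ger0_norm// ltW.
have i3 := @integrableD _ _ R mu D mD _ _ i1 (@integrableD _ _ R mu D mD _ _ iv jf).
have i4 : mu.-integrable D (fun t => (C * (2 + (`|v t| ^+ 2 + `|f t| ^+ 2)))%:E).
  have := @integrableZl _ _ R mu D mD C _ i3.
  by apply: eq_integrable => [|t _]; [exact: mD|rewrite /= EFinM !EFinD].
apply: (@le_integrable _ _ R mu D mD _ _ _ _ i4).
  apply/measurable_EFinP; apply: measurable_funM; first exact: measurable_cst.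
  by apply: measurable_funD; apply: measurable_funTS; apply: simple_limit_norm;
    [exact: hv.1|exact: hf.1].
move=> t _; rewrite /= lee_fin.
rewrite ger0_norm ?mulr_ge0 ?addr_ge0// ger0_norm ?mulr_ge0 ?addr_ge0 ?exprn_ge0//.
rewrite ler_wpM2l//.
have h1 := sqr_ge0 (`|v t| - 1); have h2 := sqr_ge0 (`|f t| - 1).
move: h1 h2 (normr_ge0 (v t)) (normr_ge0 (f t)).
move: (`|v t|) (`|f t|) => n1 n2; rewrite !expr2; nra.
Qed.

Lemma weak_integrand_integrable theta w v f : test_function T theta ->
  square_integrable D v -> square_integrable D f ->
  mu.-integrable D (EFin \o (fun t => derive1 theta t * ip (iV (v t)) (iV w))) /\
  mu.-integrable D (EFin \o (fun t => theta t * (ip (f t) (iV w) - a (v t) w))).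
Proof.
move=> ht hv hf; have [m1 m2] := weak_integrand_measurable w ht hv.1 hf.1.
have [C C0 hC] := weak_integrand_bound w ht.
have iC := norm_integrable C0 hv hf.
split; apply: (@le_integrable _ _ R mu D mD _ _ _ _ iC).
- by apply/measurable_EFinP; exact: measurable_funTS.
- move=> t _; rewrite /= lee_fin [leRHS]ger0_norm ?mulr_ge0 ?addr_ge0//.
  exact: (hC v f t).1.
- by apply/measurable_EFinP; exact: measurable_funTS.
- move=> t _; rewrite /= lee_fin [leRHS]ger0_norm ?mulr_ge0 ?addr_ge0//.
  exact: (hC v f t).2.
Qed.

(** The weak equation with everything on one side and [iV v] in place of y. It is linear in (v, f),
    so its vanishing passes to midpoints and to L^2 limits. *)
Definition weak_defect theta w (v : R -> V) (f : R -> H) : R :=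
  \int[mu]_(t in D) weak_integrand theta w v f t.

Lemma weak_defectE theta w v f : test_function T theta ->
  square_integrable D v -> square_integrable D f ->
  weak_defect theta w v f =
  \int[mu]_(t in D) (derive1 theta t * ip (iV (v t)) (iV w)) +
  \int[mu]_(t in D) (theta t * (ip (f t) (iV w) - a (v t) w)).
Proof.
move=> ht hv hf; have [i1 i2] := weak_integrand_integrable w ht hv hf.
by rewrite /weak_defect -(@RintegralD _ _ R mu D _ _ mD i1 i2).
Qed.

Lemma weak_integrand_integrable_sum theta w v f : test_function T theta ->
  square_integrable D v -> square_integrable D f ->
  mu.-integrable D (EFin \o weak_integrand theta w v f).
Proof.
move=> ht hv hf; have [i1 i2] := weak_integrand_integrable w ht hv hf.
have := @integrableD _ _ R mu D mD _ _ i1 i2.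
by apply: eq_integrable => [|t _]; [exact: mD|rewrite /= EFinD].
Qed.

Lemma weak_defect_lin theta w (c1 c2 : R) v1 v2 f1 f2 : test_function T theta ->
  square_integrable D v1 -> square_integrable D f1 ->
  square_integrable D v2 -> square_integrable D f2 ->
  weak_defect theta w (fun t => c1 *: v1 t + c2 *: v2 t)
    (fun t => c1 *: f1 t + c2 *: f2 t) =
  c1 * weak_defect theta w v1 f1 + c2 * weak_defect theta w v2 f2.
Proof.
move=> ht hv1 hf1 hv2 hf2.
have i1 := weak_integrand_integrable_sum w ht hv1 hf1.
have i2 := weak_integrand_integrable_sum w ht hv2 hf2.
have e1 := @RintegralZl _ _ R mu D _ c1 mD i1.
have e2 := @RintegralZl _ _ R mu D _ c2 mD i2.
rewrite /weak_defect -e1 -e2 -(@RintegralD _ _ R mu D _ _ mD).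
- apply: eq_Rintegral => t _; rewrite /weak_integrand.
  rewrite (linearD iV) !(linearZ_LR iV) /= !(formE (ipC ip) (ipP ip)) !(formE (energyC hA_sym) (energyP pr A)).
  ring.
- by have := @integrableZl _ _ R mu D mD c1 _ i1; apply: eq_integrable => [|t _]; [exact: mD|rewrite /= EFinM].
- by have := @integrableZl _ _ R mu D mD c2 _ i2; apply: eq_integrable => [|t _]; [exact: mD|rewrite /= EFinM].
Qed.

Lemma energy_diag_continuous : continuous (fun u => a u u : R^o).
Proof.
move=> u; apply/cvgrPdist_lt => e e0.
have [C C0 hC] := linear_norm_bound hA_cont.
pose K := C * (2 * `|u| + 1).
have K0 : 0 < K by rewrite mulr_gt0// ltr_wpDl ?mulr_ge0.
apply/nbhs_ballP; exists (Num.min 1 (e / K)); first by rewrite /= lt_min ltr01 divr_gt0.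
move=> u'; rewrite -ball_normE /= lt_min => /andP[u1 u2].
have -> : a u u - a u' u' = a (u - u') (u + u').
  rewrite (formBl (energyP pr A)) !(formDr (energyC hA_sym) (energyP pr A)).
  by rewrite (energyC hA_sym u' u); ring.
apply: le_lt_trans (pairing_le hG _ _) _.
apply: le_lt_trans (_ : `|u - u'| * K < e); last by rewrite -ltr_pdivlMr.
rewrite /K mulrCA mulrA; apply: ler_pM => //.
have h1 : `|u'| <= `|u| + `|u - u'|.
  by rewrite -[X in `|X| <= _](subKr u) (le_trans (ler_normB _ _)).
have h2 := ler_normD u u'; lra.
Qed.

End WeakDefect.

Lemma Rintegral_le_bound (R : realType) (D : set R) (h : R -> R) (c : R) :
  measurable D ->
  (lebesgue_measure).-integrable D (fun t => (h t)%:E) ->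
  (\int[lebesgue_measure]_(t in D) (h t)%:E <= c%:E)%E ->
  \int[lebesgue_measure]_(t in D) h t <= c.
Proof.
move=> mD ih hc; rewrite -lee_fin /Rintegral fineK//.
by have := @integrable_fin_num _ _ R lebesgue_measure D mD _ ih.
Qed.

Section SmallDefect.
Variables (R : realType) (V H V' : completeNormedModType R).
Variables (ip : {dot H for idfun}) (pr : {bilinear V' -> V -> R | *%R & *%R}).
Variables (iV : {linear V -> H}) (iH : {linear H -> V'}).
Hypothesis hG : gelfand_triple ip pr iV iH.
Variables (A : {linear V -> V'}).
Hypothesis hA_sym : forall u v : V, pr (A u) v = pr (A v) u.

Local Notation mu := (@lebesgue_measure R).
Local Notation a := (energy_form pr A).

Variable T : R.
Hypothesis T_gt0 : 0 < T.
Local Notation D := (`]0, T[%classic : set R).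
Let mD : measurable D. Proof. exact: measurable_itv. Qed.

(** Instead of Cauchy-Schwarz, x <= d + x^2 / d with d = 2^-n: the squares have integral at most
    8^-n = d^3, so both terms are of order d after integration over ]0, T[. *)
Lemma weak_defect_small theta w : test_function T theta ->
  exists2 C, 0 <= C & forall n v f,
    square_integrable D v -> square_integrable D f ->
    (\int[mu]_(t in D) (`|v t| ^+ 2)%:E <= ((8^-1) ^+ n)%:E)%E ->
    (\int[mu]_(t in D) (`|f t| ^+ 2)%:E <= ((8^-1) ^+ n)%:E)%E ->
    `|weak_defect ip pr iV A T theta w v f| <= C * (2^-1) ^+ n.
Proof.
move=> ht; have [C0 C00 hC0] := weak_integrand_bound hG hA_sym w ht.
exists (2 * C0 * (2 * T + 2)) => [|n v f hv hf v8 f8].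
  by rewrite !mulr_ge0// addr_ge0// mulr_ge0// ltW.
have i1 : mu.-integrable D (EFin \o cst (2 : R)).
  apply: (@measurable_bounded_integrable _ _ R mu (cst 2) D) => //.
  - exact: itv_measure_lty.
  - exists 2; split; first exact: num_real.
    by move=> M hM t _ /=; rewrite ger0_norm// ltW.
have iv := square_integrableP hv; have jf := square_integrableP hf.
pose d : R := (2^-1) ^+ n; pose D2 : R := 2 ^+ n.
have d0 : 0 < d by rewrite exprn_gt0// invr_gt0.
have D20 : 0 < D2 by rewrite exprn_gt0.
have dD : d * D2 = 1 by rewrite -exprMn mulVf// expr1n.
have d8 : (8^-1 : R) ^+ n = d * d * d.
  by rewrite -!exprMn; congr (_ ^+ n); field.
have is1 := @integrableD _ _ R mu D mD _ _ iv jf.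
have is2 : mu.-integrable D (fun t => (D2 * (`|v t| ^+ 2 + `|f t| ^+ 2))%:E).
  have := @integrableZl _ _ R mu D mD D2 _ is1.
  by apply: eq_integrable => [|t _]; [exact: mD|rewrite [in RHS](EFinM D2) EFinD].
have is3 : mu.-integrable D (fun t => (d * 2)%:E).
  by have := @integrableZl _ _ R mu D mD d _ i1; apply: eq_integrable.
have is4 : mu.-integrable D (fun t => (d * 2 + D2 * (`|v t| ^+ 2 + `|f t| ^+ 2))%:E).
  have := @integrableD _ _ R mu D mD _ _ is3 is2.
  by apply: eq_integrable => [|t _]; [exact: mD|rewrite EFinD].
have is5 : mu.-integrable D
    (fun t => ((2 * C0) * (d * 2 + D2 * (`|v t| ^+ 2 + `|f t| ^+ 2)))%:E).
  have := @integrableZl _ _ R mu D mD (2 * C0) _ is4.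
  by apply: eq_integrable => [|t _]; [exact: mD|rewrite [in RHS](EFinM (2 * C0))].
have iw := weak_integrand_integrable_sum hG hA_sym w ht hv hf.
have inw : mu.-integrable D (EFin \o (fun t => `|weak_integrand ip pr iV A theta w v f t|)).
  have := @integrable_norm _ _ R mu D _ iw.
  by apply: eq_integrable.
apply: le_trans (@le_normr_Rintegral _ _ R mu D _ mD iw) _.
apply: le_trans (_ : \int[mu]_(t in D)
    ((2 * C0) * (d * 2 + D2 * (`|v t| ^+ 2 + `|f t| ^+ 2))) <= _).
  apply: (@le_Rintegral _ _ R mu D _ _ mD inw is5) => t _.
  apply: le_trans (ler_normD _ _) _; have [h1 h2] := hC0 v f t.
  apply: le_trans (lerD h1 h2) _.
  have -> : C0 * (`|v t| + `|f t|) + C0 * (`|v t| + `|f t|) =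
    (2 * C0) * (`|v t| + `|f t|) by ring.
  rewrite ler_wpM2l ?mulr_ge0//.
  have amgm x : x <= d + D2 * x ^+ 2.
    have h : 0 <= D2 * (x - d) ^+ 2 by rewrite mulr_ge0 ?sqr_ge0 ?ltW.
    have : D2 * (x - d) ^+ 2 = D2 * x ^+ 2 - 2 * x * (d * D2) + d * (d * D2) by ring.
    rewrite dD => e; rewrite e in h.
    have h' : 0 <= D2 * x ^+ 2 by rewrite mulr_ge0 ?sqr_ge0 ?ltW.
    lra.
  have := lerD (amgm `|v t|) (amgm `|f t|).
  by move/le_trans; apply; rewrite le_eqVlt; apply/orP; left; apply/eqP; ring.
rewrite (@RintegralZl _ _ R mu D _ (2 * C0) mD is4) -[leRHS]mulrA ler_wpM2l ?mulr_ge0//.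
rewrite (@RintegralD _ _ R mu D _ _ mD is3 is2) (@RintegralZl _ _ R mu D _ D2 mD is1).
rewrite (@RintegralD _ _ R mu D _ _ mD iv jf).
have b1 := Rintegral_le_bound mD iv v8.
have b2 := Rintegral_le_bound mD jf f8.
have -> : \int[mu]_(t in D) (d * 2) = d * 2 * T.
  by rewrite (@Rintegral_cst _ _ R mu) //= lebesgue_measure_itv /= lte_fin T_gt0 /= subr0.
have : D2 * (\int[mu]_(t in D) `|v t| ^+ 2 + \int[mu]_(t in D) `|f t| ^+ 2) <= D2 * (d * d * d + d * d * d).
  by rewrite ler_wpM2l ?(ltW D20)// -d8 lerD.
have -> : D2 * (d * d * d + d * d * d) = 2 * (d * D2) * d * d by ring.
rewrite dD; have d1 : d <= 1 by rewrite exprn_ile1// ?invr_ge0// invf_le1// ler1n.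
have : d * d <= d by rewrite ler_piMr// ltW.
rewrite -/d; move: (D2 * _) => X h1 h2; nra.
Qed.

End SmallDefect.

(** * The Hilbertian energy of a pair (v, f) *)

Section TotalEnergy.
Variables (R : realType) (V H V' : completeNormedModType R).
Variables (ip : {dot H for idfun}) (pr : {bilinear V' -> V -> R | *%R & *%R}).
Variables (iV : {linear V -> H}) (iH : {linear H -> V'}).
Hypothesis hG : gelfand_triple ip pr iV iH.
Variables (A : {linear V -> V'}) (lambda1 lambda2 : R).
Hypothesis hA_cont : continuous A.
Hypothesis hA_sym : forall u v : V, pr (A u) v = pr (A v) u.
Hypothesis hlambda1 : 0 < lambda1.
Hypothesis hA_bounds : forall u : V,
       lambda1 * `|u| ^+ 2 <= pr (A u) u <= lambda2 * `|u| ^+ 2.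

Local Notation mu := (@lebesgue_measure R).
Local Notation a := (energy_form pr A).

Let hH : is_hilbert ip. Proof. by case: hG. Qed.

Variable T : R.
Local Notation D := (`]0, T[%classic : set R).
Let mD : measurable D. Proof. exact: measurable_itv. Qed.

Local Notation E := ((R -> V) * (R -> H))%type.

Definition total_density (x : E) (t : R) : R :=
  a (x.1 t) (x.1 t) + ip (x.2 t) (x.2 t).

Definition square_integrable2 (x : E) : Prop :=
  square_integrable D x.1 /\ square_integrable D x.2.

Definition total_energy (x : E) : R := \int[mu]_(t in D) total_density x t.

Lemma total_density_ge0 x t : 0 <= total_density x t.
Proof. by rewrite addr_ge0 ?(energy_ge0 hlambda1 hA_bounds)// ip_ge0. Qed.

Lemma total_density_measurable x : square_integrable2 x ->
  measurable_fun setT (total_density x).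
Proof.
move=> [[s1 _] [s2 _]]; apply: measurable_funD.
  apply: (@simple_limit_measurable R (fun t => a (x.1 t) (x.1 t))).
  exact: (simple_limit_continuous (energy_diag_continuous hG hA_cont hA_sym) s1).
exact: (ip_measurable hG).
Qed.

Lemma total_density_integrable x : square_integrable2 x ->
  mu.-integrable D (EFin \o total_density x).
Proof.
move=> hx; have [hv hf] := hx.
have iv := square_integrableP hv; have jf := square_integrableP hf.
have i1 := @integrableZl _ _ R mu D mD lambda2 _ iv.
have i2 := @integrableD _ _ R mu D mD _ _ i1 jf.
have i3 : mu.-integrable D (fun t => (lambda2 * `|x.1 t| ^+ 2 + `|x.2 t| ^+ 2)%:E).
  by move: i2; apply: eq_integrable => [|t _]; [exact: mD|rewrite EFinD (EFinM lambda2)].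
apply: (@le_integrable _ _ R mu D mD _ _ _ _ i3).
  by apply/measurable_EFinP; apply: measurable_funTS; exact: total_density_measurable.
move=> t _; rewrite /= lee_fin ger0_norm ?total_density_ge0//.
apply: le_trans (ler_norm _); rewrite /total_density -hH lerD2r.
exact: (energy_ub hA_bounds).
Qed.

Lemma square_integrable2_mid x z : square_integrable2 x -> square_integrable2 z ->
  square_integrable2 (2^-1 *: (x + z)).
Proof. by move=> [h1 h2] [h3 h4]; split; exact: square_integrable_mid. Qed.

Lemma square_integrable2_sub x z : square_integrable2 x -> square_integrable2 z ->
  square_integrable2 (x - z).
Proof. by move=> [h1 h2] [h3 h4]; split; exact: square_integrable_sub. Qed.

Lemma total_energy_parallelogram x z : square_integrable2 x -> square_integrable2 z ->
  total_energy (x - z) =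
  2 * total_energy x + 2 * total_energy z - 4 * total_energy (2^-1 *: (x + z)).
Proof.
move=> hx hz.
have ix := total_density_integrable hx; have iz := total_density_integrable hz.
have im := total_density_integrable (square_integrable2_mid hx hz).
have scale c u : mu.-integrable D (EFin \o total_density u) ->
    mu.-integrable D (EFin \o (fun t => c * total_density u t)).
  move=> iu; have := @integrableZl _ _ R mu D mD c _ iu.
  by apply: eq_integrable => [|t _]; [exact: mD|rewrite /= EFinM].
rewrite /total_energy -!(@RintegralZl _ _ R mu D _ _ mD)//.
rewrite -(@RintegralD _ _ R mu D _ _ mD); [|exact: scale|exact: scale].
rewrite -(@RintegralB _ _ R mu D _ _ mD); [| |exact: scale]; last first.
  have := @integrableD _ _ R mu D mD _ _ (scale 2 _ ix) (scale 2 _ iz).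
  by apply: eq_integrable => [|t _]; [exact: mD|rewrite /= EFinD].
apply: eq_Rintegral => t _; rewrite /total_density /=.
rewrite (form_parallelogram (energyC hA_sym) (energyP pr A)).
rewrite (form_parallelogram (ipC ip) (ipP ip)).
rewrite -[(2^-1 *: (x.1 + z.1)) t]/(2^-1 *: (x.1 t + z.1 t)).
rewrite -[(2^-1 *: (x.2 + z.2)) t]/(2^-1 *: (x.2 t + z.2 t)).
ring.
Qed.

Lemma total_energy_dominates (k c : R) x : 0 < k -> k <= lambda1 -> k <= 1 ->
  square_integrable2 x -> total_energy x <= k * c ->
  (\int[mu]_(t in D) (`|x.1 t| ^+ 2)%:E <= c%:E)%E /\
  (\int[mu]_(t in D) (`|x.2 t| ^+ 2)%:E <= c%:E)%E.
Proof.
move=> k0 kl k1 hx; have [hv hf] := hx => qx.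
have ix := total_density_integrable hx.
have iv := square_integrableP hv; have jf := square_integrableP hf.
have main (h : R -> R) : mu.-integrable D (fun t => (h t)%:E) ->
    (forall t, k * h t <= total_density x t) ->
    (\int[mu]_(t in D) (h t)%:E <= c%:E)%E.
  move=> ih hle; have fn := @integrable_fin_num _ _ R mu D mD _ ih.
  rewrite -(fineK fn) lee_fin -(ler_pM2l k0); apply: le_trans qx.
  have kh : mu.-integrable D (EFin \o (fun t => k * h t)).
    have := @integrableZl _ _ R mu D mD k _ ih.
    by apply: eq_integrable => [|t _]; [exact: mD|rewrite /= EFinM].
  rewrite -[fine _]/(\int[mu]_(t in D) h t) -(@RintegralZl _ _ R mu D _ _ mD)//.
  by apply: (@le_Rintegral _ _ R mu D _ _ mD kh ix) => t _; exact: hle.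
split; apply: main => // t; rewrite /total_density.
  apply: le_trans (_ : a (x.1 t) (x.1 t) <= _); last by rewrite lerDl ip_ge0.
  by apply: le_trans (energy_lb hA_bounds _); rewrite ler_wpM2r ?exprn_ge0.
apply: le_trans (_ : ip (x.2 t) (x.2 t) <= _).
  by rewrite -hH ler_piMl ?exprn_ge0.
by rewrite lerDr (energy_ge0 hlambda1 hA_bounds).
Qed.

End TotalEnergy.

(** * Midpoint hulls of solutions *)

Section ConvexHulls.
Variables (R : realType) (V H V' : completeNormedModType R).
Variables (ip : {dot H for idfun}) (pr : {bilinear V' -> V -> R | *%R & *%R}).
Variables (iV : {linear V -> H}) (iH : {linear H -> V'}).
Hypothesis hG : gelfand_triple ip pr iV iH.
Variables (A : {linear V -> V'}) (lambda1 lambda2 : R).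
Hypothesis hA_cont : continuous A.
Hypothesis hA_sym : forall u v : V, pr (A u) v = pr (A v) u.
Hypothesis hlambda1 : 0 < lambda1.
Hypothesis hA_bounds : forall u : V,
       lambda1 * `|u| ^+ 2 <= pr (A u) u <= lambda2 * `|u| ^+ 2.
Variables (F : H -> set H).
Hypothesis hF_val : closed_convex_bounded_values F.
Hypothesis hF_usc : w_usc F.

Local Notation mu := (@lebesgue_measure R).
Local Notation a := (energy_form pr A).

Let hH : is_hilbert ip. Proof. by case: hG. Qed.

Variable T : R.
Hypothesis T_gt0 : 0 < T.
Local Notation D := (`]0, T[%classic : set R).
Let mD : measurable D. Proof. exact: measurable_itv. Qed.

Local Notation E := ((R -> V) * (R -> H))%type.

(** At a fixed t, the pairs whose first component is near c and whose second is near F(c) form a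
    midpoint-stable set, because F(c) is convex; by upper semicontinuity this set contains a tail of
    the sequence. *)
Lemma hull_member_close (v : nat -> R -> V) (f : nat -> R -> H) (t : R) (c : H) (e : R) :
  0 < e -> iV (v n t) @[n --> \oo] --> c -> (forall n, F (iV (v n t)) (f n t)) ->
  exists N, forall n x, (N <= n)%N -> tail_hull (fun n => (v n, f n) : E) n x ->
    `|iV (x.1 t) - c| < e /\ exists2 b, F c b & `|x.2 t - b| < e.
Proof.
move=> e0 /cvg_seqP vc inF; have [d d0 hd] := hF_usc c e0.
have [|N hN] := vc (Num.min d e); first by rewrite lt_min d0 e0.
exists N => n x Nn.
move=> /(_ (fun x : E => `|iV (x.1 t) - c| < e /\ exists2 b, F c b & `|x.2 t - b| < e)).
have half0 : 0 < (2^-1 : R) by rewrite invr_gt0.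
apply=> [k nk|u w [u1 [b Fb u2]] [w1 [b' Fb' w2]]] /=.
  have := hN k (leq_trans Nn nk); rewrite lt_min => /andP[h1 h2]; split => //.
  by apply/point_dist_ltP; exact: (hd _ h1 _ (inF k)).
have mid (W : normedModType R) (p q r s : W) : `|p - r| < e -> `|q - s| < e ->
    `|2^-1 *: (p + q) - 2^-1 *: (r + s)| < e.
  move=> h1 h2; rewrite -scalerBr normrZ gtr0_norm// opprD addrACA.
  by have := ler_normD (p - r) (q - s); lra.
split.
  rewrite (linearZ_LR iV) (linearD iV) /=.
  have half : 2^-1 + 2^-1 = 1 :> R by field.
  have cE : c = 2^-1 *: (c + c) by rewrite scalerDr -scalerDl half scale1r.
  by rewrite [X in _ - X]cE; exact: mid.
exists (2^-1 *: (b + b')); first exact: (F_midpoint hF_val).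
exact: mid.
Qed.

Lemma weak_defect_eq0 theta w y v f : test_function T theta ->
  square_integrable D v -> square_integrable D f ->
  evolution ip pr iV A T y v f -> weak_defect ip pr iV A T theta w v f = 0.
Proof.
move=> ht hv hf [_ _ yv /(_ _ ht w)h]; rewrite (weak_defectE hG hA_sym w ht hv hf).
apply/eqP; rewrite addr_eq0 -h; apply/eqP; apply: ae_eq_Rintegral.
by apply: (ae_imply yv) => t yt Dt; rewrite yt.
Qed.

Lemma weak_defect_mid theta w (x z : E) : test_function T theta ->
  square_integrable2 T x -> square_integrable2 T z ->
  weak_defect ip pr iV A T theta w x.1 x.2 = 0 ->
  weak_defect ip pr iV A T theta w z.1 z.2 = 0 ->
  weak_defect ip pr iV A T theta w (2^-1 *: (x + z)).1 (2^-1 *: (x + z)).2 = 0.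
Proof.
move=> ht [x1 x2] [z1 z2] hx hz.
have := weak_defect_lin hG hA_sym w 2^-1 2^-1 ht x1 x2 z1 z2.
rewrite hx hz !mulr0 addr0 => <-; congr weak_defect; apply/funext => t;
  by rewrite -scalerDr.
Qed.

Lemma evolution_square_integrable (y : R -> H) (v : R -> V) (f : R -> H) (M C : R) :
  0 <= M -> evolution ip pr iV A T y v f -> (forall t, `|f t| <= M) ->
  (\int[mu]_(t in D) (a (v t) (v t))%:E <= C%:E)%E ->
  square_integrable2 T (v, f) /\ 
  total_energy ip pr A T (v, f) <= C + M ^+ 2 * T.
Proof.
move=> M0 [sv sf _ _] fM aC.
have mDT : mu D = T%:E.
  by have := @lebesgue_measure_itv R `]0, T[; rewrite /= lte_fin T_gt0 => ->; rewrite -EFinD subr0.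
have ma : measurable_fun setT (fun t => a (v t) (v t)).
  apply: (@simple_limit_measurable R (fun t => a (v t) (v t))).
  exact: (simple_limit_continuous (energy_diag_continuous hG hA_cont hA_sym) sv).
have f2 : (\int[mu]_(t in D) (`|f t| ^+ 2)%:E <= (M ^+ 2 * T)%:E)%E.
  apply: (@le_trans _ _ (\int[mu]_(t in D) (M ^+ 2)%:E)%E).
    apply: ae_le_ge0_integral => [t _|t _|].
    - by rewrite lee_fin exprn_ge0.
    - by rewrite lee_fin exprn_ge0.
    - by apply: nearW => t _; rewrite lee_fin ler_sqr ?nnegrE.
  by rewrite (@integral_cst _ _ R mu D) //= -/mu mDT -EFinM.
have hf : square_integrable D f by split => //; apply: le_lt_trans f2 _; exact: ltry.
have hv : square_integrable D v.
  split => //; apply: (@le_lt_trans _ _ (\int[mu]_(t in D) (lambda1^-1%:E * (a (v t) (v t))%:E))%E).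
    apply: ae_le_ge0_integral => [t _|t _|].
    - by rewrite lee_fin exprn_ge0.
    - by rewrite -EFinM lee_fin mulr_ge0 ?invr_ge0 ?(ltW hlambda1)// (energy_ge0 hlambda1 hA_bounds).
    - apply: nearW => t _; rewrite -EFinM lee_fin.
      by rewrite mulrC ler_pdivlMr// mulrC (energy_lb hA_bounds).
  rewrite (@ge0_integralZl_EFin _ _ R mu D mD)//.
  - apply: le_lt_trans (_ : lambda1^-1%:E * C%:E < +oo)%E; last by rewrite -EFinM ltry.
    by apply: lee_pmul => //; rewrite ?lee_fin ?invr_ge0 ?(ltW hlambda1)//; apply: integral_ge0 => t _;
      rewrite lee_fin (energy_ge0 hlambda1 hA_bounds).
  - by move=> t _; rewrite lee_fin (energy_ge0 hlambda1 hA_bounds).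
  - by apply/measurable_EFinP; exact: measurable_funTS.
  - by rewrite invr_ge0 ltW.
have hx : square_integrable2 T (v, f) by [].
split => //; apply: (Rintegral_le_bound mD).
  exact: (total_density_integrable hG hA_cont hA_sym hlambda1 hA_bounds hx).
have -> : (\int[mu]_(t in D) (total_density ip pr A (v, f) t)%:E =
    \int[mu]_(t in D) ((a (v t) (v t))%:E + (`|f t| ^+ 2)%:E))%E.
  by apply: eq_integral => t _; rewrite /total_density /= -hH -EFinD.
rewrite (@ge0_integralD _ _ R mu D mD).
- by rewrite EFinD leeD.
- by move=> t _; rewrite lee_fin (energy_ge0 hlambda1 hA_bounds).
- by apply/measurable_EFinP; exact: measurable_funTS.
- by move=> t _; rewrite lee_fin exprn_ge0.
- exact: measurable_sqnorm.
Qed.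

End ConvexHulls.

(** * Passage to the limit in the equation and in the inclusion *)

Section LimitOfEvolutions.
Variables (R : realType) (V H V' : completeNormedModType R).
Variables (ip : {dot H for idfun}) (pr : {bilinear V' -> V -> R | *%R & *%R}).
Variables (iV : {linear V -> H}) (iH : {linear H -> V'}).
Hypothesis hG : gelfand_triple ip pr iV iH.
Variables (A : {linear V -> V'}) (lambda1 lambda2 : R).
Hypothesis hA_cont : continuous A.
Hypothesis hA_sym : forall u v : V, pr (A u) v = pr (A v) u.
Hypothesis hlambda1 : 0 < lambda1.
Hypothesis hA_bounds : forall u : V,
       lambda1 * `|u| ^+ 2 <= pr (A u) u <= lambda2 * `|u| ^+ 2.
Variables (F : H -> set H).
Hypothesis hF_val : closed_convex_bounded_values F.
Hypothesis hF_usc : w_usc F.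

Local Notation mu := (@lebesgue_measure R).
Local Notation a := (energy_form pr A).

Let ciV : continuous iV. Proof. by have [_ _ [_ h _ _] _ _] := hG. Qed.
Let ciH : continuous iH. Proof. by have [_ _ _ [_ h _ _] _] := hG. Qed.

Variable T : R.
Hypothesis T_gt0 : 0 < T.
Local Notation D := (`]0, T[%classic : set R).
Let mD : measurable D. Proof. exact: measurable_itv. Qed.

Local Notation E := ((R -> V) * (R -> H))%type.

Lemma weak_defect_limit theta w (x : nat -> E) (v : R -> V) (f : R -> H) :
  test_function T theta -> (forall n, square_integrable2 T (x n)) ->
  square_integrable2 T (v, f) ->
  (forall n, weak_defect ip pr iV A T theta w (x n).1 (x n).2 = 0) ->
  (forall n, \int[mu]_(t in D) (`|(x n).1 t - v t| ^+ 2)%:E <= ((8^-1) ^+ n)%:E)%E ->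
  (forall n, \int[mu]_(t in D) (`|(x n).2 t - f t| ^+ 2)%:E <= ((8^-1) ^+ n)%:E)%E ->
  weak_defect ip pr iV A T theta w v f = 0.
Proof.
move=> ht hx [hv hf] x0 xv xf.
have [C C0 hC] := weak_defect_small hG hA_sym T_gt0 w ht.
apply/eqP; rewrite -normr_le0; apply/ler_addgt0Pl => e e0; rewrite addr0.
have Ce : 0 < e / (C + 1) by rewrite divr_gt0// ltr_wpDl.
have /cvg_seqP/(_ _ Ce)[n hn] : (2^-1 : R) ^+ n @[n --> \oo] --> (0 : R).
  by apply: cvg_expr; rewrite ger0_norm ?invr_ge0// invf_lt1// ltr1n.
have {hn} := hn n (leqnn n).
rewrite subr0 ger0_norm ?exprn_ge0 ?invr_ge0// ltr_pdivlMr ?ltr_wpDl// => ne.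
have [x1 x2] := hx n.
have := hC n _ _ (square_integrable_sub mD x1 hv) (square_integrable_sub mD x2 hf)
  (xv n) (xf n).
have -> : weak_defect ip pr iV A T theta w (fun t => (x n).1 t - v t) (fun t => (x n).2 t - f t) =
    - weak_defect ip pr iV A T theta w v f.
  have := weak_defect_lin hG hA_sym w 1 (-1) ht x1 x2 hv hf.
  rewrite x0 mulr0 add0r mulN1r => <-; congr weak_defect; apply/funext => t;
    by rewrite scale1r scaleN1r.
rewrite normrN => h; apply: le_trans h _; apply: le_trans (ltW ne).
by rewrite mulrC ler_wpM2l ?exprn_ge0 ?invr_ge0// lerDl.
Qed.

(** Let e tend to 0 in [hull_member_close]: the first component identifies c with [iV u], and the
    second puts g in F(c), which is closed. *)
Lemma hull_limit (v : nat -> R -> V) (f : nat -> R -> H) (x : nat -> E) t (c : H) u g :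
  iV (v n t) @[n --> \oo] --> c -> (forall n, F (iV (v n t)) (f n t)) ->
  (forall n, tail_hull (fun n => (v n, f n) : E) n (x n)) ->
  (x n).1 t @[n --> \oo] --> u -> (x n).2 t @[n --> \oo] --> g ->
  c = iV u /\ F c g.
Proof.
move=> vc inF hx xu xg.
have close e : 0 < e -> exists n,
    [/\ `|iV ((x n).1 t) - c| < e, `|iV ((x n).1 t) - iV u| < e,
       `|(x n).2 t - g| < e & exists2 b, F c b & `|(x n).2 t - b| < e].
  move=> e0; have [N1 h1] := hull_member_close hF_val hF_usc e0 vc inF.
  have /cvg_seqP/(_ _ e0)[N2 h2] : iV ((x n).1 t) @[n --> \oo] --> iV u.
    by apply: continuous_cvg xu; exact: ciV.
  have [N3 h3] := (cvg_seqP _ _).1 xg e e0.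
  pose n := maxn N1 (maxn N2 N3).
  have [a1 a2] := h1 n (x n) (leq_maxl _ _) (hx n).
  exists n; split => //.
  - by apply: h2; rewrite /n leq_max leq_maxl orbT.
  - by apply: h3; rewrite /n leq_max leq_maxr orbT.
split.
  apply/eqP; rewrite -subr_eq0 -normr_le0; apply/ler_addgt0Pl => e e0; rewrite addr0.
  have e2 : 0 < e / 2 by rewrite divr_gt0.
  have [n [h1 h2 _ _]] := close _ e2.
  have -> : c - iV u = (iV ((x n).1 t) - iV u) - (iV ((x n).1 t) - c).
    by rewrite opprB [RHS]addrC addrA subrK.
  by have := ler_normB (iV ((x n).1 t) - iV u) (iV ((x n).1 t) - c); lra.
have [_ Fclosed _ _] := hF_val c.
apply: Fclosed => B /nbhs_ballP[e /= e0 eB].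
have e2 : 0 < e / 2 by rewrite divr_gt0.
have [n [_ _ h1 [b Fb h2]]] := close _ e2.
exists b; split => //; apply: eB; rewrite -ball_normE /=.
have -> : g - b = ((x n).2 t - b) - ((x n).2 t - g).
  by rewrite opprB [RHS]addrC addrA subrK.
by have := ler_normB ((x n).2 t - b) ((x n).2 t - g); lra.
Qed.

(** The pairs (v n, f n) are averaged with common weights, so that one sequence of averages
    satisfies the linear equation, has its first components close to chi and its second close to
    F(chi). Only these averages need to converge in L^2. *)
Lemma evolutions_limit (y : nat -> R -> H) (v : nat -> R -> V) (f : nat -> R -> H)
    (chi : R -> H) (M C : R) : 0 <= M ->
  (forall n, evolution ip pr iV A T (y n) (v n) (f n)) ->
  (forall n t, `|f n t| <= M) ->
  (forall n, (\int[mu]_(t in D) (a (v n t) (v n t))%:E <= C%:E)%E) ->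
  (forall n, {ae mu, forall t, D t -> F (y n t) (f n t)}) ->
  (forall t, D t -> y n t @[n --> \oo] --> chi t) ->
  exists (v : R -> V) (g : R -> V') (f : R -> H),
    [/\ L2 T v /\ {ae mu, forall t, t \in `]0, T[ -> chi t = iV (v t)},
        L2 T g /\ weak_derivative pr T (iH \o chi) g,
        L2 T f,
        {ae mu, forall t, t \in `]0, T[ -> g t + A (v t) = iH (f t)} &
        {ae mu, forall t, t \in `]0, T[ -> F (chi t) (f t)}].
Proof.
move=> M0 ev fM aC inF ychi.
pose z n : E := (v n, f n).
have hz n := evolution_square_integrable hG hA_cont hA_sym hlambda1 hA_bounds T_gt0
  M0 (ev n) (fM n) (aC n).
have hull_sq n x : tail_hull z n x -> square_integrable2 T x.
  move=> /(_ (square_integrable2 T)); apply => [k _|u w]; first exact: (hz k).1.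
  exact: square_integrable2_mid.
(* The energy controls |v|^2 with factor lambda1 and |f|^2 with factor 1. Tolerances k 8^-n for the
   energy thus give 8^-n for both L^2 distances, the rate that [L2_limit] expects. *)
pose k := Num.min lambda1 1.
have k0 : 0 < k by rewrite lt_min hlambda1 ltr01.
have kl : k <= lambda1 by rewrite ge_min lexx.
have k1 : k <= 1 by rewrite ge_min lexx orbT.
have [||||||x [xhull xcauchy _]] := @asymptotic_minimizer R E (tail_hull z)
  (total_energy ip pr A T) (C + M ^+ 2 * T) (fun n => k * (8^-1) ^+ n).
- by move=> n; rewrite mulr_gt0// exprn_gt0// invr_gt0.
- by move=> n; exact: tail_hull_decr.
- by move=> n u w; exact: tail_hull_mid.
- by move=> n; exists (z n); [exact: tail_hull_gen|exact: (hz n).2].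
- move=> x _; apply: Rintegral_ge0 => t _.
  exact: (total_density_ge0 hG hlambda1 hA_bounds).
- move=> u w /hull_sq hu /hull_sq hw.
  exact: (total_energy_parallelogram hG hA_cont hA_sym hlambda1 hA_bounds hu hw).
have sx n : square_integrable2 T (x n) by exact: hull_sq (xhull n).
have xdom n m : (n <= m)%N ->
    (\int[mu]_(t in D) (`|(x n).1 t - (x m).1 t| ^+ 2)%:E <= ((8^-1) ^+ n)%:E)%E /\
    (\int[mu]_(t in D) (`|(x n).2 t - (x m).2 t| ^+ 2)%:E <= ((8^-1) ^+ n)%:E)%E.
  move=> nm; exact: (total_energy_dominates hG hA_cont hA_sym hlambda1 hA_bounds k0 kl k1
    (square_integrable2_sub (sx n) (sx m)) (xcauchy n m nm)).
have [v0 [sv0 xv0 xv8]] := L2_limit mD (fun n => (sx n).1.1) (fun n => (sx n).1.2)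
  (fun n m nm => (xdom n m nm).1).
have [f0 [sf0 xf0 xf8]] := L2_limit mD (fun n => (sx n).2.1) (fun n => (sx n).2.2)
  (fun n m nm => (xdom n m nm).2).
have sq_limit (W : normedModType R) (u u0 : R -> W) (c : R) : square_integrable D u ->
    simple_limit u0 -> (\int[mu]_(t in D) (`|u t - u0 t| ^+ 2)%:E <= c%:E)%E ->
    square_integrable D u0.
  move=> hu su0 huc; apply: (square_integrable_dominated mD ler01 hu (w := fun t => u t - u0 t)) => //.
    split; first by apply: simple_limitB => //; exact: hu.1.
    by apply: le_lt_trans huc _; exact: ltry.
  by move=> t; rewrite mul1r -[X in `|X| <= _](subKr (u t)) ler_normB.
have hv0 : square_integrable D v0 by exact: sq_limit (sx 0%N).1 sv0 (xv8 0%N).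
have hf0 : square_integrable D f0 by exact: sq_limit (sx 0%N).2 sf0 (xf8 0%N).
have point : {ae mu, forall t, D t -> chi t = iV (v0 t) /\ F (chi t) (f0 t)}.
  have yv : {ae mu, forall t, forall n, D t -> y n t = iV (v n t)}.
    by apply: ae_forall_nat => n; have [] := ev n.
  apply: (ae_imply2 (ae_and yv (ae_forall_nat inF)) (ae_and xv0 xf0)) => t [e1 e2] [e3 e4] Dt.
  apply: (hull_limit (v := v) (f := f) (x := x) (t := t)).
  - have -> : (fun n => iV (v n t)) = (fun n => y n t) by apply/funext => n; rewrite e1.
    exact: ychi.
  - by move=> n; rewrite -e1//; exact: e2.
  - exact: xhull.
  - exact: e3.
  - exact: e4.
have weak theta w : test_function T theta -> weak_defect ip pr iV A T theta w v0 f0 = 0.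
  move=> ht; apply: (weak_defect_limit (x := x) ht sx _ _ xv8 xf8) => // n.
  pose S (x : E) := square_integrable2 T x /\ weak_defect ip pr iV A T theta w x.1 x.2 = 0.
  suff [] : S (x n) by [].
  apply: (xhull n) => [j _|p q [p1 p2] [q1 q2]].
    have [[h1 h2] _] := hz j; split => //=.
    exact: (weak_defect_eq0 hG hA_sym w ht h1 h2 (ev j)).
  split; first exact: square_integrable2_mid.
  exact: (weak_defect_mid hG hA_sym ht p1 q1 p2 q2).
(* The derivative is defined by the equation itself; what has to be proved is that it is the weak
   derivative, which is the vanishing of the defect. *)
pose g t := iH (f0 t) - A (v0 t).
have hg : square_integrable D g.
  have [c1 c10 hc1] := linear_norm_bound ciH.
  have [c2 c20 hc2] := linear_norm_bound hA_cont.
  apply: (square_integrable_dominated mD (C := c1 + c2) _ hf0 hv0) => //.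
  - by rewrite addr_ge0 ?ltW.
  - by apply: simple_limitB; apply: simple_limit_continuous.
  - move=> t; apply: le_trans (ler_normB _ _) _.
    apply: le_trans (lerD (hc1 _) (hc2 _)) _.
    have := mulr_ge0 (ltW c10) (normr_ge0 (v0 t)).
    have := mulr_ge0 (ltW c20) (normr_ge0 (f0 t)).
    by rewrite mulrDr !mulrDl; lra.
have DE t : (t \in `]0, T[) = (`]0, T[%classic t) :> Prop by [].
exists v0, g, f0; split.
- split; first by split; [exact: simple_limit_strong|exact: hv0.2].
  by apply: (ae_imply point) => t h Dt; have [] := h Dt.
- split; first by split; [exact: (simple_limit_strong _ hg.1)|exact: hg.2].
  move=> theta ht w; have := weak theta w ht.
  rewrite (weak_defectE hG hA_sym w ht hv0 hf0) => /eqP; rewrite addr_eq0 => /eqP h.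
  transitivity (\int[mu]_(t in D) (derive1 theta t * ip (iV (v0 t)) (iV w))).
    apply: ae_eq_Rintegral; apply: (ae_imply point) => t pt Dt.
    by have [ct _] := pt Dt; rewrite /= (pairing_iH hG) ct.
  rewrite h; congr (- _); apply: eq_Rintegral => t _.
  by rewrite linearBl /= (pairing_iH hG).
- by split; [exact: simple_limit_strong|exact: hf0.2].
- by apply: nearW => t _; rewrite /g subrK.
- by apply: (ae_imply point) => t h Dt; have [] := h Dt.
Qed.

End LimitOfEvolutions.

(** * Limits of translates are solutions *)

Section Translates.
Variables (R : realType) (V H V' : completeNormedModType R).
Variables (ip : {dot H for idfun}) (pr : {bilinear V' -> V -> R | *%R & *%R}).
Variables (iV : {linear V -> H}) (iH : {linear H -> V'}).
Hypothesis hG : gelfand_triple ip pr iV iH.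
Variables (A : {linear V -> V'}) (lambda1 lambda2 : R).
Hypothesis hA_cont : continuous A.
Hypothesis hA_sym : forall u v : V, pr (A u) v = pr (A v) u.
Hypothesis hlambda1 : 0 < lambda1.
Hypothesis hA_bounds : forall u : V,
       lambda1 * `|u| ^+ 2 <= pr (A u) u <= lambda2 * `|u| ^+ 2.
Variables (F : H -> set H).
Hypothesis hF_val : closed_convex_bounded_values F.
Hypothesis hF_usc : w_usc F.

Local Notation mu := (@lebesgue_measure R).
Local Notation a := (energy_form pr A).

Variables (C1 C2 : R).
Hypothesis hC1 : 0 < C1.
Hypothesis hC2 : 0 < C2.
Hypothesis hF_growth : forall y : H,
       (ereal_sup [set `|a|%:E | a in F y] <= (C1 + C2 * `|y|)%:E)%E.

Lemma compact_norm_bound (K : set H) : compact K ->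
  exists2 M0, 0 <= M0 & forall k, K k -> `|k| <= M0.
Proof.
move=> /compact_bounded/pinfty_ex_gt0[M0 M00 h].
by exists M0; [exact: ltW|exact: h].
Qed.

Variables (y0 : H) (phi : R -> H) (K : set H).
Hypothesis phi_sol : mild_solution pr iV iH A F y0 phi.
Hypothesis cK : compact K.
Hypothesis phiK : forall t, K (forward phi t).

(** The Lipschitz estimate for A^-1 phi holds at times 0 < s < t. Continuity extends it to s = 0,
    and [forward] being constant before 0 extends it to all of R; compactness then transfers uniform
    continuity to phi. *)
Lemma mild_solution_uniformly_continuous e : 0 < e -> exists2 d, 0 < d &
  forall r r', `|r - r'| < d -> `|forward phi r - forward phi r'| < e.
Proof.
have [M0 M00 hM0] := compact_norm_bound cK.
have [Rz hRz] := choice (fun k => energy_surj hG hA_sym hlambda1 hA_bounds (iH k)).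
have [kappa kappa0 hkappa] := energy_ge_embedding hG hlambda1 hA_bounds.
pose M := C1 + C2 * M0.
have M_ge0 : 0 <= M by rewrite addr_ge0 ?mulr_ge0 ?(ltW hC1) ?(ltW hC2).
have phiM t : C1 + C2 * `|forward phi t| <= M.
  by rewrite lerD2l ler_wpM2l ?(ltW hC2)// hM0.
have cphi : continuous (forward phi).
  by apply: forward_continuous; have [] := phi_sol.
pose L := M / kappa + M0.
have L0 : 0 <= L by rewrite addr_ge0 ?divr_ge0 ?(ltW kappa0).
have lip s t : 0 < s -> s < t ->
    `|resolvent iV Rz (forward phi t) - resolvent iV Rz (forward phi s)| <= L * (t - s).
  move=> s0 st; have T0 : 0 < t + 1 by lra.
  have [v [f [ev fM _]]] := mild_solution_evolution hG hF_growth M_ge0 phiM phi_sol T0.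
  apply: (resolvent_lipschitz hG hA_sym hRz kappa0 hkappa cphi fM _ ev s0 st).
    by move=> r; exact: hM0.
  by rewrite ltrDl.
have Bsub := resolvent_sub iV hlambda1 hA_bounds hRz.
have Ble k : `|resolvent iV Rz k| <= kappa^-1 * `|k|.
  by rewrite mulrC ler_pdivlMr// mulrC (resolvent_le hG hRz hkappa).
have lip0 s t : 0 <= s -> s <= t ->
    `|resolvent iV Rz (forward phi t) - resolvent iV Rz (forward phi s)| <= L * (t - s).
  move=> s0; rewrite le_eqVlt => /orP[/eqP ->|st].
    by rewrite !subrr normr0 mulr0.
  apply/ler_addgt0Pl => d d0; have dk : 0 < d * kappa by rewrite mulr_gt0.
  have /cvgrPdist_lt/(_ _ dk)[b /= b0 hb] := cphi s.
  pose r := s + Num.min (b / 2) ((t - s) / 2).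
  have m0 : 0 < Num.min (b / 2) ((t - s) / 2) by rewrite lt_min !divr_gt0// subr_gt0.
  have m1 : Num.min (b / 2) ((t - s) / 2) <= b / 2 by rewrite ge_min lexx.
  have m2 : Num.min (b / 2) ((t - s) / 2) <= (t - s) / 2 by rewrite ge_min lexx orbT.
  have rs : `|s - r| < b by rewrite /r opprD addNKr normrN gtr0_norm//; lra.
  have h1 : `|resolvent iV Rz (forward phi r) - resolvent iV Rz (forward phi s)| <= d.
    rewrite -Bsub; apply: le_trans (Ble _) _; rewrite mulrC ler_pdivrMr//.
    by rewrite distrC; apply: ltW; exact: hb.
  have h2 := lip r t; rewrite /r in h1 h2.
  move: h1 h2; set x := resolvent _ _ _; set x1 := resolvent _ _ _; set x2 := resolvent _ _ _.
  move=> h1 h2.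
  have -> : x2 - x1 = (x - x1) + (x2 - x) by rewrite [RHS]addrC addrA subrK.
  apply: le_trans (ler_normD _ _) _; apply: lerD h1 _.
  apply: le_trans (h2 _ _) _; [lra|lra|].
  by rewrite ler_wpM2l//; lra.
have lipT s t : `|resolvent iV Rz (forward phi t) - resolvent iV Rz (forward phi s)| <=
    L * `|t - s|.
  wlog st : s t / s <= t.
    move=> h; have [/h//|/ltW/h] := leP s t.
    by rewrite distrC [in leRHS]distrC.
  have fwd r : forward phi r = forward phi (Num.max r 0).
    by rewrite /forward [Num.max (Num.max r 0) 0]max_l// le_max lexx orbT.
  rewrite fwd [in X in _ - X]fwd; apply: le_trans (lip0 _ _ _ _) _.
  - by rewrite le_max lexx orbT.
  - by rewrite ge_max !le_max st lexx !orbT.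
  - rewrite ler_wpM2l//; apply: le_trans (max0_lipschitz t s); exact: ler_norm.
move=> e0; apply: (compact_lipschitz_uniform cK _ Bsub Ble _ L0 phiK lipT e0).
- by rewrite invr_ge0 ltW.
- by move=> k; exact: (resolvent_inj hG hlambda1 hA_bounds hRz).
Qed.

Lemma mild_solution_translates (chi : R -> H) (s : nat -> R) :
  (forall n, 0 < s n) -> continuous chi ->
  (forall t, 0 <= t -> forward phi (s n + t) @[n --> \oo] --> chi t) ->
  mild_solution pr iV iH A F (chi 0) chi.
Proof.
move=> s0 cchi hchi; split => // [|T T0].
  exact: continuous_subspaceT.
have [M0 M00 hM0] := compact_norm_bound cK.
have [Rz hRz] := choice (fun k => energy_surj hG hA_sym hlambda1 hA_bounds (iH k)).
have [kappa kappa0 hkappa] := energy_ge_embedding hG hlambda1 hA_bounds.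
pose M := C1 + C2 * M0.
have M_ge0 : 0 <= M by rewrite addr_ge0 ?mulr_ge0 ?(ltW hC1) ?(ltW hC2).
have phiM t : C1 + C2 * `|forward phi t| <= M.
  by rewrite lerD2l ler_wpM2l ?(ltW hC2)// hM0.
have cphi : continuous (forward phi).
  by apply: forward_continuous; have [] := phi_sol.
(* The extra unit of time keeps [s n + T] strictly inside the interval of the equation. The energy
   bound on [s n, s n + T] depends on T but not on [s n]. *)
have sel n : exists vf : (R -> V) * (R -> H),
    [/\ evolution ip pr iV A (s n + T + 1) (forward phi) vf.1 vf.2,
        forall t, `|vf.2 t| <= M &
        {ae mu, forall t, `]0, s n + T + 1[%classic t -> F (forward phi t) (vf.2 t)}].
  have T1 : 0 < s n + T + 1 by rewrite !addr_gt0.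
  have [v [f h]] := mild_solution_evolution hG hF_growth M_ge0 phiM phi_sol T1.
  by exists (v, f).
have [vf hvf] := choice sel.
apply: (evolutions_limit hG hA_cont hA_sym hlambda1 hA_bounds hF_val hF_usc T0
  (y := fun n t => forward phi (t + s n)) (v := fun n t => (vf n).1 (t + s n))
  (f := fun n t => (vf n).2 (t + s n)) (M := M) (C := M0 ^+ 2 * 2 + 2 * M * M0 * T)) => //.
- move=> n; have [ev _ _] := hvf n.
  by apply: (evolution_shift hG hA_sym cphi (s0 n) _ ev); rewrite ltrDl.
- by move=> n t; have [_ h _] := hvf n; exact: h.
- move=> n; have [ev fM _] := hvf n; have [sv _ _ _] := ev.
  have ma : measurable_fun setT (fun t => a ((vf n).1 t) ((vf n).1 t)).
    apply: (@simple_limit_measurable R (fun t => a ((vf n).1 t) ((vf n).1 t))).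
    exact: (simple_limit_continuous (energy_diag_continuous hG hA_cont hA_sym) sv).
  have en := evolution_energy_bound hG hA_sym hlambda1 hA_bounds hRz kappa0 hkappa
    cphi mild_solution_uniformly_continuous fM (fun t => hM0 _ (phiK t)) ev.
  have sT : s n < s n + T by rewrite ltrDl.
  have sT1 : s n + T < s n + T + 1 by rewrite ltrDl.
  have {en} := en _ _ (s0 n) sT sT1.
  have -> : s n + T - s n = T by rewrite [X in X - _]addrC addrK.
  apply: le_trans.
  rewrite (@ge0_integral_shift R (s n) `]s n, s n + T]%classic); last 3 first.
  + exact: measurable_itv.
  + exact/measurable_EFinP.
  + by move=> t; rewrite lee_fin (energy_ge0 hlambda1 hA_bounds).
  apply: ge0_subset_integral.
  + exact: measurable_itv.
  + by apply: measurable_shift; exact: measurable_itv.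
  + apply/measurable_EFinP; apply: measurable_funTS.
    apply: (@simple_limit_measurable R (fun t => a ((vf n).1 (t + s n)) ((vf n).1 (t + s n)))).
    apply: (simple_limit_continuous (energy_diag_continuous hG hA_cont hA_sym)).
    exact: simple_limit_shift.
  + by move=> t _; rewrite lee_fin (energy_ge0 hlambda1 hA_bounds).
  + move=> t; rewrite /= !in_itv /= => /andP[t0 tT].
    by apply/andP; split; lra.
- move=> n; have [_ _ hF] := hvf n.
  apply: (ae_imply (ae_shift (s n) hF)) => t h; rewrite /= in_itv /= => /andP[t0 tT].
  apply: h; rewrite /= in_itv /=; have := s0 n => ?; apply/andP; split; lra.
- move=> t; rewrite /= in_itv /= => /andP[t0 _].
  rewrite (_ : (fun n => _) = fun n => forward phi (s n + t)); first exact: hchi (ltW t0).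
  by apply/funext => n; rewrite addrC.
Qed.

End Translates.

(** * Chain recurrence of the omega-limit set *)

Lemma omega_limitE (R : realType) (H : normedModType R) (y : R -> H) (x : H) :
  omega_limit y x <->
  forall N e, 0 < e -> exists2 r, N <= r & `|y r - x| < e.
Proof.
split=> [[s /cvgryPge s_oo /cvg_seqP ys] N e e0|h].
  have [n1 _ h1] := s_oo N; have [n2 h2] := ys e e0.
  exists (s (maxn n1 n2)); first by apply: h1; rewrite /= leq_maxl.
  by apply: h2; exact: leq_maxr.
have sel n : exists r, n%:R <= r /\ `|y r - x| < n.+1%:R^-1.
  by have [|r nr yr] := h n%:R n.+1%:R^-1; [rewrite invr_gt0|exists r].
have [s hs] := choice sel; exists s.
  apply/cvgryPge => B; near=> n; apply: le_trans (hs n).1.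
  near: n; exact: nbhs_infty_ger.
apply/cvg_seqP => e e0; exists (Num.truncn e^-1) => n en.
apply: lt_le_trans (hs n).2 _.
rewrite invf_ple ?posrE// ltW//; apply: lt_le_trans (truncnS_gt _) _.
by rewrite ler_nat ltnS.
Unshelve. all: by end_near.
Qed.

Lemma omega_limit_forward (R : realType) (H : completeNormedModType R) (phi : R -> H) :
  omega_limit phi = omega_limit (forward phi).
Proof.
have fwd r : 0 <= r -> forward phi r = phi r by move=> r0; rewrite /forward max_l.
apply/seteqP; split => x /omega_limitE h; apply/omega_limitE => N e e0;
  have [r] := h (Num.max N 0) e e0; rewrite ge_max => /andP[Nr r0] xr; exists r => //;
  by [rewrite fwd|rewrite -fwd].
Qed.

Section OmegaLimit.
Variables (R : realType) (H : completeNormedModType R) (y : R -> H) (K : set H).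
Variable Sol : set (R -> H).
Hypothesis cK : compact K.
Hypothesis yK : forall t, K (y t).
Hypothesis y_uniform : forall e, 0 < e -> exists2 d, 0 < d &
  forall r r', `|r - r'| < d -> `|y r - y r'| < e.
Hypothesis Sol_translates : forall (chi : R -> H) (s : nat -> R),
  (forall n, 0 < s n) -> continuous chi ->
  (forall t, 0 <= t -> y (s n + t) @[n --> \oo] --> chi t) -> Sol chi.

Lemma small_index (N : nat) (B e : R) : 0 < e ->
  exists k, [/\ (N <= k)%N, B <= k%:R & k.+1%:R^-1 < e].
Proof.
move=> e0; exists (maxn N (maxn (Num.truncn B).+1 (Num.truncn e^-1).+1)); split.
- exact: leq_maxl.
- apply: le_trans (ltW (truncnS_gt B)) _; rewrite ler_nat.
  by rewrite leq_max (leq_maxl (Num.truncn B).+1) orbT.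
- rewrite invf_plt ?posrE//; apply: lt_le_trans (truncnS_gt _) _.
  by rewrite ler_nat leqW// leq_max (leq_maxr _ (Num.truncn e^-1).+1) orbT.
Qed.

Lemma approx_limit_eq (x p : H) (u : nat -> H) :
  (forall n, `|u n - x| < n.+1%:R^-1) -> (forall n, `|u n - p| < n.+1%:R^-1) -> p = x.
Proof.
move=> ux up; apply/eqP; rewrite -subr_eq0 -normr_le0.
apply/ler_addgt0Pl => e e0; rewrite addr0.
have e2 : 0 < e / 2 by rewrite divr_gt0.
have [k [_ _ ke]] := small_index 0 0 e2.
have -> : p - x = (u k - x) - (u k - p) by rewrite opprB [RHS]addrC addrA subrK.
have h1 := lt_trans (ux k) ke; have h2 := lt_trans (up k) ke.
have := ler_normB (u k - x) (u k - p); lra.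
Qed.

Lemma inv_succ_anti (m n : nat) : (m <= n)%N -> n.+1%:R^-1 <= m.+1%:R^-1 :> R.
Proof. by move=> mn; rewrite lef_pV2 ?posrE// ler_nat ltnS. Qed.

(** Translates by times tending to infinity converge locally uniformly on the whole line, so their
    limit is defined at negative times as well and passes through x at time 0. *)
Lemma omega_limit_quasi_invariant : quasi_invariant Sol (omega_limit y).
Proof.
move=> x /omega_limitE hx.
have sel n : exists r, n%:R <= r /\ `|y r - x| < n.+1%:R^-1.
  by have [|r nr yr] := hx n%:R n.+1%:R^-1; [rewrite invr_gt0|exists r].
have [s hs] := choice sel.
have [psi [h [hk cpsi _ hpsi]]] := translates_compact cK s yK y_uniform.
have sk k : k%:R <= s (h k) by apply: le_trans (hs (h k)).1; rewrite ler_nat.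
exists psi; split.
(* Discarding the first m > |c| terms makes all the shifted times positive, since [s (h (k + m))] is
   at least k + m. *)
- move=> c; pose m := (Num.truncn `|c|).+1.
  have cm : `|c| < m%:R by exact: truncnS_gt.
  apply: (Sol_translates (s := fun k => s (h (k + m)%N) + c)).
  + move=> k; have := sk (k + m)%N; rewrite natrD => ?.
    have : 0 <= k%:R :> R by [].
    by have := ler_norm (- c); rewrite normrN; lra.
  + by move=> t; apply: continuous_comp; [apply: cvgD; [exact: cvg_id|exact: cvg_cst]|exact: cpsi].
  + move=> t _; apply/cvg_seqP => e e0.
    have [N [_ BN Ne]] := small_index 0 `|c + t| e0.
    exists N => n Nn; rewrite -addrA [t + c]addrC.
    have Nn' : (N <= n + m)%N by exact: leq_trans Nn (leq_addr _ _).
    have h1 : `|c + t| <= (n + m)%:R by apply: le_trans BN _; rewrite ler_nat.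
    apply: lt_trans (hpsi _ _ h1) _; exact: le_lt_trans (inv_succ_anti Nn') Ne.
- apply: (approx_limit_eq (u := fun k => y (s (h k)))) => k.
    exact: lt_le_trans (hs (h k)).2 (inv_succ_anti (hk k)).
  by have := hpsi k 0; rewrite normr0 addr0; exact.
- move=> _ [t _ <-]; apply/omega_limitE => N e e0.
  have [k [_ Bk ke]] := small_index 0 (`|N| + `|t|) e0.
  exists (s (h k) + t).
    have := sk k; have := ler_norm N; have := ler_norm (- t); rewrite normrN; lra.
  apply: lt_trans ke; apply: hpsi; apply: le_trans Bk.
  by rewrite lerDr.
Qed.

(** By contradiction: starting times whose values converge to x give translates converging to a
    solution issued from x, uniformly on [-2t, 2t]. The convergence is therefore uniform over the
    offending tau, which need not converge. *)
Lemma shadowing (x : H) (e t : R) : 0 < e -> 0 < t ->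
  exists2 d, 0 < d & forall s, 0 < s -> `|y s - x| < d ->
    forall tau, t <= tau <= 2 * t ->
    exists psi, [/\ Sol psi, psi 0 = x & `|y (s + tau) - psi tau| < e].
Proof.
move=> e0 t0; apply: contrapT => nd.
have sel n : exists st : R * R, [/\ 0 < st.1, `|y st.1 - x| < n.+1%:R^-1,
    t <= st.2 <= 2 * t &
    forall psi, Sol psi -> psi 0 = x -> e <= `|y (st.1 + st.2) - psi st.2|].
  apply: contrapT => h; apply: nd; exists n.+1%:R^-1; first by rewrite invr_gt0.
  move=> s s0 ys tau ttau; apply: contrapT => nopsi.
  apply: h; exists (s, tau); split => // psi Spsi psi0.
  by rewrite leNgt; apply/negP => lt_e; apply: nopsi; exists psi.
have [st hst] := choice sel.
have [psi [h [hk cpsi _ hpsi]]] :=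
  translates_compact cK (fun n => (st n).1) yK y_uniform.
have Spsi : Sol psi.
  apply: (Sol_translates (s := fun k => (st (h k)).1)) => // [k|r r0].
    by have [] := hst (h k).
  apply/cvg_seqP => b b0; have [N [_ BN Ne]] := small_index 0 `|r| b0.
  exists N => n Nn.
  have h1 : `|r| <= n%:R by apply: le_trans BN _; rewrite ler_nat.
  apply: lt_trans (hpsi _ _ h1) _; exact: le_lt_trans (inv_succ_anti Nn) Ne.
have psi0 : psi 0 = x.
  apply: (approx_limit_eq (u := fun k => y (st (h k)).1)) => k.
    by have [_ q _ _] := hst (h k); exact: lt_le_trans q (inv_succ_anti (hk k)).
  by have := hpsi k 0; rewrite normr0 addr0; exact.
have [k [_ Bk ke]] := small_index 0 (2 * t) e0.
have [_ _ /andP[tau1 tau2] /(_ psi Spsi psi0)] := hst (h k).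
apply/negP; rewrite -ltNge; apply: lt_trans ke; apply: hpsi.
by rewrite ger0_norm; lra.
Qed.

(** The radii may vary without any uniformity. Late samples outside all the balls would accumulate
    at a point l of the limit set and so enter the ball of radius [rho l] around l. *)
Lemma omega_limit_attracts (rho : H -> R) : (forall x, 0 < rho x) ->
  exists2 S, 0 < S & forall s, S <= s -> exists x, omega_limit y x /\ `|y s - x| < rho x.
Proof.
move=> rho0; apply: contrapT => nS.
have sel n : exists s, n.+1%:R <= s /\ forall x, omega_limit y x -> rho x <= `|y s - x|.
  apply: contrapT => h; apply: nS; exists n.+1%:R => // s ns.
  apply: contrapT => nox; apply: h; exists s; split => // x ox.
  by rewrite leNgt; apply/negP => lt_r; apply: nox; exists x.
have [s hs] := choice sel.
have [l Kl [h hk /cvg_seqP hl]] := compact_subseq cK (x := fun n => y (s n)) (fun n => yK _).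
have ol : omega_limit y l.
  apply/omega_limitE => N e e0; have [M hM] := hl e e0.
  have [k [Mk Bk _]] := small_index M N e0.
  exists (s (h k)); last exact: hM.
  apply: le_trans Bk _; apply: le_trans (hs (h k)).1; rewrite ler_nat.
  by apply: leq_trans (hk k) _.
have [M hM] := hl _ (rho0 l).
have := hM M (leqnn M); rewrite ltNge => /negP; apply; exact: (hs (h M)).2.
Qed.

Lemma omega_limit_chain (x : H) (e t : R) : omega_limit y x -> 0 < e -> 0 < t ->
  chain (msemiflow Sol) (omega_limit y) e t x x.
Proof.
move=> ox e0 t0; have e2 : 0 < e / 2 by rewrite divr_gt0.
have sel z : exists d, 0 < d /\ forall s, 0 < s -> `|y s - z| < d ->
    forall tau, t <= tau <= 2 * t ->
    exists psi, [/\ Sol psi, psi 0 = z & `|y (s + tau) - psi tau| < e / 2].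
  by have [d d0 hd] := shadowing z e2 t0; exists d.
have [delta hdelta] := choice sel.
(* The first bound makes the sample a valid start for shadowing from z; the second pays for
   replacing the arrival sample by the next point of the chain. *)
pose rho z := Num.min (delta z) (e / 2).
have rho0 z : 0 < rho z by rewrite lt_min e2 (hdelta z).1.
have [S S0 hS] := omega_limit_attracts rho0.
have selc s : exists z, S <= s -> omega_limit y z /\ `|y s - z| < rho z.
  have [Ss|sS] := leP S s; last by exists x.
  by have [z hz] := hS s Ss; exists z.
have [ctr hctr] := choice selc.
have [s0 Ss0 xs0] := (omega_limitE y x).1 ox S _ (rho0 x).
have [s1 s01 xs1] := (omega_limitE y x).1 ox (s0 + t) _ (rho0 x).
have q0 : 0 <= (s1 - s0) / t by rewrite divr_ge0 ?(ltW t0)//; lra.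
(* As s1 - s0 >= t, the integer part n of (s1 - s0) / t is at least 1, and n t <= s1 - s0 < (n + 1)
   t <= 2 n t puts the step (s1 - s0) / n in [t, 2t]. *)
have := truncn_itv q0; set n := Num.truncn _ => /andP[n1 n2].
have n_gt0 : (0 < n)%N.
  by rewrite /n truncn_gt0 ler_pdivlMr//; lra.
have nR : 1 <= n%:R :> R by rewrite ler1n.
pose tau := (s1 - s0) / n%:R.
have tauE : n%:R * tau = s1 - s0 by rewrite /tau mulrC divfK// pnatr_eq0 -lt0n.
have tau12 : t <= tau <= 2 * t.
  move: n1 n2; rewrite ler_pdivlMr// ltr_pdivrMr// -natr1 mulrDl mul1r => n1 n2.
  rewrite /tau ler_pdivlMr ?ler_pdivrMr ?ltr0n//; apply/andP; split; nra.
have tau0 : 0 < tau by move: tau12 => /andP[? ?]; lra.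
(* Both ends are x itself rather than a chosen centre, which is allowed because the samples at s0
   and s1 lie within [rho x] of x. *)
pose ys i := if (i == 0%N) || (i == n) then x else ctr (s0 + i%:R * tau).
have Si i : S <= s0 + i%:R * tau.
  by apply: le_trans Ss0 _; rewrite lerDl mulr_ge0 ?(ltW tau0).
have hys i : omega_limit y (ys i) /\ `|y (s0 + i%:R * tau) - ys i| < rho (ys i).
  rewrite /ys; have [->|_] := eqVneq i 0%N; first by rewrite mul0r addr0.
  have [->|_] := eqVneq i n; first by rewrite tauE addrC subrK.
  exact: hctr (Si i).
exists n, ys, (fun=> tau); split => //.
- by rewrite /ys eqxx orbT.
- by move=> i _; exact: (hys i).1.
- move=> i _; split; first by case/andP: tau12.
  have [_ hi] := hys i; have [_ hi1] := hys i.+1.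
  have hid : `|y (s0 + i%:R * tau) - ys i| < delta (ys i).
    by apply: lt_le_trans hi _; rewrite ge_min lexx.
  have [psi [Spsi psi0 hpsi]] :=
    (hdelta (ys i)).2 _ (lt_le_trans S0 (Si i)) hid tau tau12.
  apply/point_dist_ltP; exists (psi tau); first by exists psi.
  have E1 : s0 + i.+1%:R * tau = s0 + i%:R * tau + tau.
    by rewrite -natr1 mulrDl mul1r addrA.
  rewrite E1 in hi1.
  have hi2 : `|y (s0 + i%:R * tau + tau) - ys i.+1| < e / 2.
    by apply: lt_le_trans hi1 _; rewrite ge_min lexx orbT.
  have -> : ys i.+1 - psi tau = (y (s0 + i%:R * tau + tau) - psi tau) -
      (y (s0 + i%:R * tau + tau) - ys i.+1).
    by rewrite opprB [RHS]addrC addrA subrK.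
  have := ler_normB (y (s0 + i%:R * tau + tau) - psi tau)
      (y (s0 + i%:R * tau + tau) - ys i.+1); lra.
Qed.

End OmegaLimit.

Theorem theorem8 (R : realType) (V H V' : completeNormedModType R)
    (ip : {dot H for idfun}) (pr : {bilinear V' -> V -> R | *%R & *%R})
    (iV : {linear V -> H}) (iH : {linear H -> V'})
    (hG : gelfand_triple ip pr iV iH)
    (A : {linear V -> V'}) (lambda1 lambda2 : R)
    (hA_cont : continuous A)
    (hA_sym : forall u v : V, pr (A u) v = pr (A v) u)
    (hlambda1 : 0 < lambda1) (hlambda12 : lambda1 < lambda2)
    (hA_bounds : forall u : V,
       lambda1 * `|u| ^+ 2 <= pr (A u) u <= lambda2 * `|u| ^+ 2)
    (F : H -> set H)
    (hF_val : closed_convex_bounded_values F)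
    (hF_usc : w_usc F)
    (C1 C2 : R) (hC1 : 0 < C1) (hC2 : 0 < C2)
    (hF_growth : forall y : H,
       (ereal_sup [set `|a|%:E | a in F y] <= (C1 + C2 * `|y|)%:E)%E)
    (FN : nat -> H -> set H) (c : nat -> R)
    (hFN_val : forall N, (1 <= N)%N -> closed_convex_bounded_values (FN N))
    (hFN_sup : forall N (y : H), (1 <= N)%N -> F y `<=` FN N y)
    (hFN_cvg : forall y : H,
       semi_dist (FN N y) (F y) @[N --> \oo] --> 0%E)
    (hc : forall N, (1 <= N)%N -> 0 < c N)
    (hFN_lip : forall N (y1 y2 : H), (1 <= N)%N ->
       (hausdorff_dist (FN N y1) (FN N y2) <= (c N * `|y1 - y2|)%:E)%E)
    (phi : R -> H)
    (hphi : mild_solutions pr iV iH A F phi)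
    (hphi_compact : compact (closure (phi @` [set t : R | 0 <= t]))) :
  chain_recurrent (mild_solutions pr iV iH A F) (omega_limit phi).
Proof.
have [y0 phi_sol] := hphi.
pose K := closure (phi @` [set t : R | 0 <= t]).
have phiK t : K (forward phi t).
  by apply: subset_closure; exists (Num.max t 0) => //=; rewrite le_max lexx orbT.
have uc := mild_solution_uniformly_continuous hG hA_sym hlambda1 hA_bounds hC1 hC2
  hF_growth phi_sol hphi_compact phiK.
have lim (chi : R -> H) (s : nat -> R) : (forall n, 0 < s n) -> continuous chi ->
    (forall t, 0 <= t -> forward phi (s n + t) @[n --> \oo] --> chi t) ->
    mild_solutions pr iV iH A F chi.
  move=> s0 cchi hchi; exists (chi 0).
  exact: (mild_solution_translates hG hA_cont hA_sym hlambda1 hA_bounds hF_val hF_usc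
    hC1 hC2 hF_growth phi_sol hphi_compact phiK s0 cchi hchi).
rewrite omega_limit_forward; split.
  exact: (omega_limit_quasi_invariant hphi_compact phiK uc lim).
by move=> x e t; exact: (omega_limit_chain hphi_compact phiK uc lim).
Qed.
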